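(* Let $\varepsilon>0$. Then there exists $n_0=n_0(\varepsilon)$ such that for every integer $n\ge n_0$, every connected vertex-transitive graph of order $n$ contains a cycle of length at least $n^{2/3-\varepsilon}$.
   Context: Graphs are finite and simple. The order of a graph is its number of vertices, and the length of a cycle is its number of edges. A graph is vertex-transitive if its automorphism group acts transitively on its vertex set. *)

(* Defs.v *)
From mathcomp Require Import all_boot all_fingroup.

Set Implicit Arguments.
Unset Strict Implicit.
Unset Printing Implicit Defensive.

Record sgraph := SGraph {
  vertex :> finType;
  adj : rel vertex;
  adj_sym : symmetric adj;
  adj_irr : irreflexive adj }.

Definition graph_order (G : sgraph) : nat := #|vertex G|.

Definition graph_connected (G : sgraph) : Prop :=
  forall x y : G, connect (@adj G) x y.

Definition graph_aut (G : sgraph) : {set {perm G}} :=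
  [set s : {perm G} | [forall x, forall y, adj (s x) (s y) == adj x y]].

Lemma graph_aut_group_set (G : sgraph) : group_set (graph_aut G).
Proof.
apply/group_setP; split.
  by rewrite inE; apply/'forall_forallP => x y; rewrite !perm1.
move=> s t; rewrite !inE => /'forall_forallP sP /'forall_forallP tP.
by apply/'forall_forallP => x y; rewrite !permM (eqP (tP _ _)) (eqP (sP _ _)).
Qed.

Canonical graph_aut_group (G : sgraph) : {group {perm G}} :=
  Group (graph_aut_group_set G).

Definition vertex_transitive (G : sgraph) : Prop :=
  [transitive graph_aut G, on [set: G] | 'P].

(* A cycle is given by the cyclic list of its distinct vertices.  The bound    *)
(* excludes the degenerate lists (an edge traversed back and forth is a ucycle *)
(* of size 2); above it, [size c] is also the number of edges of the cycle.    *)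
Definition is_cycle (G : sgraph) (c : seq G) : Prop :=
  ucycle (@adj G) c /\ 3 <= size c.

(* Main.v *)
Require Import Defs.
From mathcomp Require Import all_boot all_order all_algebra all_fingroup.
From mathcomp Require Import reals exp.
From mathcomp Require boolp.
From mathcomp Require Import zify ring lra.

(** Let [n] be the order of the graph [G] and [l] the length of a longest
    cycle.  The theorem follows from [n ^ 2 <= (l ^ 3 + l * n) * n ^ o(1)]
    ([circumference_bound]), which forces [l >= n ^ (2/3 - o(1))].

    Transitivity enters through averaging: for vertex sets [X] and [Y], some
    automorphism [s] satisfies [n * #|X :&: s Y| <= #|X| * #|Y|]
    ([average_meet]).  For a longest cycle [C] and [X = Y = C] this gives a
    second longest cycle [D = s C] with [k <= l ^ 2 / n], where [k] is the
    number of common vertices.  A connected vertex-transitive graph has no cut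
    vertex ([no_cut_vertex]), so any two longest cycles meet; a set separating
    [C] from [D] then meets every image of [C], hence has at least [n / l]
    elements, by averaging again ([card_separator]).  By Menger's theorem there
    are [n / l] disjoint paths from [C] to [D].  At most [k] of them meet
    [C :&: D]; call the others links.

    The heart of the proof is a bound [(k + 1) * n ^ o(1)] for the number of
    links ([few_links]), which yields the inequality above.  The common
    vertices cut each of [C] and [D] into at most [k + 1] segments.  Two links
    ending in the same segment of [D] form an ear of [C], which follows one
    link, then [D], then the other link; its inner vertices avoid [C], and ears
    through different segments of [D] are disjoint.  An ear is never longer
    than the part of [C] that it spans.  Since [C] and [D] play symmetric
    roles, two links cannot share their segments on both cycles
    ([segments_inj]).

    Group the links, by their order on [C], into groups of [g] consecutive ones,
    and do the same on [D].  After exchanging [C] and [D] if necessary and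
    keeping one dyadic class of links, every group spans less than [s] on [C]
    and at least [s / 2] on [D] ([select]).  A row consists of the links in the
    same group and the same segment on [C], a column of the links in the same
    segment on [D].  Within a row, positions on [C] differ by less than [s];
    within a column, a given link is at distance at least [2 * s] on [D] from
    all but [18 * g] links.  So an ear inside a column usually gains [2 * s]
    vertices, while leaving out a stretch of [C] inside a row costs less than
    [s].

    To turn this into a cycle longer than [C], consider walks which arrive at a
    link, move back along [C] to an earlier link of the same row, and there take
    a long ear to a later row.  If there are many links, the walks from a common
    start form a tree with more leaves than there are rows, so two of them
    arrive in the same row.  This produces a bigon: two routes from one row to
    another through distinct columns and, in between, distinct rows
    ([two_walks_bigon], [bigon_exists]).  Applied twice, the argument gives two
    bigons, the second starting in the row where the first one ends
    ([two_bigons]).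

    While scanning [C] across a bigon one keeps two disjoint strands joining, in
    pairs, the start of [C], the current position and the heads of the two
    routes.  Crossing the rows permutes the three possible pairings, and at the
    end of the bigon all but one of the pairings closes up to a single cycle.  A
    bigon that fails for the initial pairing can be followed by the second
    bigon, entered with another pairing.  If the second bigon also fails on its
    own, then the injectivity of its action on pairings makes the concatenation
    succeed ([two_bigons_cycle]).  The cycle obtained is longer than [C], a
    contradiction. *)

Set Implicit Arguments.
Unset Strict Implicit.
Unset Printing Implicit Defensive.

Local Open Scope nat_scope.

(** * Walks and bigons among marked positions *)

Ltac glia := clear; move=> *; lia.

Lemma first_split (T : Type) (a : pred T) (s : seq T) : has a s ->
  exists s1 x s2, [/\ s = s1 ++ x :: s2, a x & ~~ has a s1].
Proof.
elim: s => //= x s IH; case ax: (a x) => /= hs.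
  by exists [::], x, s.
have [s1 [y [s2 [-> ay ns1]]]] := IH hs.
by exists (x :: s1), y, s2; rewrite /= ax.
Qed.

Lemma count_all (T : Type) (a : pred T) s : all a s -> count a s = size s.
Proof. by rewrite all_count => /eqP. Qed.

(** An abstract picture of the links: each [i] has a position [pos i] on the
    cycle, a row and a column, and a pair [(i, j)] in one column, from an
    earlier row to a later one, stands for an ear leaving the cycle at [pos i]
    and returning at [pos j].  The relation [far] singles out the long ears. *)
Section Bigons.
Variables (I K : finType) (row : I -> nat) (col : I -> K) (pos : I -> nat).
Variable far : rel I.

(** A list of ears followed in succession, starting from an arrival at [f].
    Each ear departs to the left of the previous arrival, so the cycle is
    traversed backwards inside a row and the skipped stretch stays in it. *)
Fixpoint walk (f : I) (p : seq (I * I)) : bool :=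
  if p is x :: p' then
    [&& row x.1 == row f, pos x.1 < pos f, col x.1 == col x.2,
        row x.1 < row x.2 & walk x.2 p']
  else true.

(** As a walk, but the first departure may be anywhere in row [z]. *)
Definition route (z v : nat) (p : seq (I * I)) : bool :=
  if p is x :: p' then
    [&& row x.1 == z, col x.1 == col x.2, row x.1 < row x.2, walk x.2 p'
      & row (last x p').2 == v]
  else false.

Definition ears_in (E : {set I}) (p : seq (I * I)) :=
  all (fun x => (x.1 \in E) && (x.2 \in E)) p.

Notation cols p := [seq col x.1 | x <- p].
Notation deps p := [seq x.1 | x <- p].

Definition is_far (x : I * I) := far x.1 x.2.

(** The last condition is all that the length count needs: half of the ears are
    long.  One ear may be short, because closing a bigon at a shared column
    replaces two long ears by a single one of unknown length. *)
Definition bigon (E : {set I}) (z v : nat) (p q : seq (I * I)) : Prop :=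
  [/\ route z v p /\ route z v q, ears_in E (p ++ q), uniq (cols (p ++ q)),
      forall x y, x \in p -> y \in q -> row x.2 = row y.2 -> row x.2 = v
    & size (p ++ q) <= 2 * count is_far (p ++ q)].

Lemma walk_cat f p q : walk f (p ++ q) = walk f p && walk (last (f, f) p).2 q.
Proof. by elim: p f => //= x p IH f; rewrite IH -!andbA; case: p {IH} => //= y p. Qed.

Lemma walk_rows f p x : walk f p -> x \in p -> row f <= row x.1 < row x.2.
Proof.
elim: p f => //= y p IH f /and5P[/eqP r1 _ _ r2 wp]; rewrite inE => /orP[/eqP ->|xp].
  by rewrite -r1 leqnn r2.
have /andP[h1 h2] := IH _ wp xp; rewrite h2 andbT -r1.
exact: leq_trans (ltnW r2) h1.
Qed.

Lemma walk_left f p x : walk f p -> x \in p -> row x.1 = row f -> pos x.1 < pos f.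
Proof.
case: p => //= y p /and5P[/eqP ry py _ ly wp]; rewrite inE => /orP[/eqP -> //|xp] rx.
have /andP[h _] := walk_rows wp xp.
by move: (leq_trans ly h); rewrite rx ry ltnn.
Qed.

Lemma walk_last f p : walk f p -> row f + (p != [::]) <= row (last (f, f) p).2.
Proof.
case: (lastP p) => [|s x] wp; first by rewrite addn0.
rewrite last_rcons; have /(_ x) := walk_rows wp.
rewrite mem_rcons inE eqxx => /(_ isT) /andP[h1 h2].
by rewrite (leq_trans (leq_add h1 (leq_b1 _))) // addn1.
Qed.

Lemma walk_route f p : walk f p -> p != [::] -> route (row f) (row (last (f, f) p).2) p.
Proof. by case: p => //= x p /and5P[-> _ -> -> ->] _ /=; rewrite eqxx. Qed.

Lemma walk_rcons_route f p x : walk f p -> row x.1 = row (last (f,f) p).2 ->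
  (p != [::] -> pos x.1 < pos (last (f,f) p).2) ->
  col x.1 = col x.2 -> row x.1 < row x.2 -> route (row f) (row x.2) (rcons p x).
Proof.
case: p => [_ /= -> _ -> -> | y p wp rx /(_ isT) px cx lx]; first by rewrite !eqxx.
have wpx : walk f (rcons (y :: p) x).
  by rewrite -cats1 walk_cat wp /= in rx px *; rewrite rx cx px !eqxx -rx lx.
by have := walk_route wpx isT; rewrite last_rcons.
Qed.

Lemma bigon_sym E z v p q : bigon E z v p q -> bigon E z v q p.
Proof.
case=> -[rp rq] inE' uc dr sz; split=> //.
- by rewrite /ears_in all_cat andbC -all_cat.
- by rewrite map_cat uniq_catC -map_cat.
- by move=> x y xq yp e; rewrite e; apply: dr xq _.
- by rewrite count_cat addnC -count_cat size_cat addnC -size_cat.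
Qed.

(** Follow [p] up to its first conflict [x] with [q]: an ear of [q] in the
    column of [x], or an ear of [q] arriving in the row that [x] reaches.  A row
    conflict is itself the common end of two routes.  For a column conflict,
    with an ear [y] of [q], the departures of [x] and [y] lie in one column;
    joining the earlier one to the later one by a new ear ends both routes in
    the row of the later one.  The two departures cannot lie in one row: either
    this row would be a conflict before [x], or [x] and [y] would be the first
    ears, in distinct columns. *)
Lemma two_walks_bigon (E : {set I}) f p q :
  walk f p -> walk f q -> ears_in E (p ++ q) -> all is_far (p ++ q) ->
  uniq (cols p) -> uniq (cols q) -> p != [::] -> q != [::] ->
  (forall x y, ohead p = Some x -> ohead q = Some y -> col x.1 != col y.1) ->
  row (last (f, f) p).2 = row (last (f, f) q).2 ->
  exists v p' q', [/\ bigon E (row f) v p' q',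
    {subset deps (p' ++ q') <= deps (p ++ q)} & size (p' ++ q') <= size (p ++ q)].
Proof.
move=> wp wq inpq farpq up uq p0 q0 hd lastrow.
have /andP[farp farq] : all is_far p && all is_far q by rewrite -all_cat.
have /andP[inp inq] : ears_in E p && ears_in E q by rewrite /ears_in -all_cat.
pose rows (s : seq (I * I)) := [seq row x.2 | x <- s].
pose cf (x : I * I) := (col x.1 \in cols q) || (row x.2 \in rows q).
have lastq : row (last (f, f) q).2 \in rows q.
  by case: (lastP q) q0 => // s y _; rewrite last_rcons /rows map_rcons mem_rcons inE eqxx.
have hcf : has cf p.
  case: (lastP p) p0 lastrow => // s x _; rewrite last_rcons => e.
  by rewrite has_rcons /cf e lastq orbT.
have [p1 [x [p2 [ep cfx ncf]]]] := first_split hcf.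
have wp1x : walk f (rcons p1 x).
  by move: wp; rewrite ep -cat_rcons walk_cat => /andP[].
have := wp1x; rewrite -cats1 walk_cat => /andP[wp1 /=].
case/and5P=> /eqP rx px /eqP cx lx _.
have xp : x \in p by rewrite ep mem_cat inE eqxx orbT.
have ncf1 y : y \in p1 -> (col y.1 \notin cols q) /\ (row y.2 \notin rows q).
  by move=> yp; move/hasPn/(_ _ yp): ncf; rewrite /cf negb_or => /andP[].
have farp1 : all is_far p1 by move: farp; rewrite ep all_cat => /andP[].
have inp1 : ears_in E p1 by move: inp; rewrite ep /ears_in all_cat => /andP[].
have inx : (x.1 \in E) && (x.2 \in E) by move: inp => /allP/(_ _ xp).
have farx : is_far x by move: farp => /allP/(_ _ xp).
have up1x : uniq (cols (rcons p1 x)).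
  by move: up; rewrite ep -cat_rcons map_cat cat_uniq => /andP[].
have colsp1 : {subset deps (rcons p1 x) <= deps p}.
  by move=> c; rewrite ep -cat_rcons map_cat mem_cat => ->.
have szp1 : size p1 < size p by rewrite ep size_cat /= addnS ltnS leq_addr.
have qsplit y : y \in q -> exists q1 q2, q = q1 ++ y :: q2.
  by case/splitPr=> q1 q2; exists q1, q2.
have disj1 (q1 : seq (I * I)) : {subset q1 <= q} -> forall a b, a \in p1 -> b \in q1 ->
    (col a.1 != col b.1) /\ (row a.2 <> row b.2).
  move=> sq a b /ncf1[n1 n2] /sq bq; split.
    by apply: contraNneq n1 => ->; apply/mapP; exists b.
  by move=> e; move: n2; rewrite e => /mapP; apply; exists b.
case: (boolP (col x.1 \in cols q)) cfx => [/mapP[y yq cxy] _|ncx /=].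
- have [q1 [q2 eq]] := qsplit y yq.
  have wq1y : walk f (rcons q1 y) by move: wq; rewrite eq -cat_rcons walk_cat => /andP[].
  have := wq1y; rewrite -cats1 walk_cat => /andP[wq1 /=].
  case/and5P=> /eqP ry py /eqP cy ly _.
  have sq1 : {subset q1 <= q} by move=> a; rewrite eq mem_cat => ->.
  have farq1 : all is_far q1 by move: farq; rewrite eq all_cat => /andP[].
  have inq1 : ears_in E q1 by move: inq; rewrite eq /ears_in all_cat => /andP[].
  have iny : (y.1 \in E) && (y.2 \in E) by move: inq => /allP/(_ _ yq).
  have uq1y : uniq (cols (rcons q1 y)).
    by move: uq; rewrite eq -cat_rcons map_cat cat_uniq => /andP[].
  have colsq1 : {subset deps (rcons q1 y) <= deps q}.
    by move=> c; rewrite eq -cat_rcons map_cat mem_cat => ->.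
  have szq1 : size q1 < size q by rewrite eq size_cat /= addnS ltnS leq_addr.
  move: up1x uq1y; rewrite !map_rcons !rcons_uniq => /andP[xp1 up1] /andP[yq1 uq1].
  have ucat : uniq (cols (p1 ++ q1)).
    rewrite map_cat cat_uniq up1 uq1 andbT /=.
    apply/hasPn => c /mapP[b bq ->]; apply/mapP => -[a ap e].
    by have [] := disj1 q1 sq1 a b ap bq; rewrite e eqxx.
  have nxc : col x.1 \notin cols (p1 ++ q1).
    by rewrite map_cat mem_cat negb_or xp1 cxy.
  case: (ltngtP (row x.1) (row y.1)) => cmp.
  + have q1n : q1 != [::].
      apply: contraL cmp => /eqP q1e; rewrite -leqNgt ry q1e /=.
      by rewrite rx; apply: leq_trans (walk_last wp1); rewrite leq_addr.
    exists (row y.1), (rcons p1 (x.1, y.1)), q1; split.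
    * split.
      - split; first by apply: walk_rcons_route.
        by rewrite ry; apply: walk_route.
      - rewrite /ears_in all_cat all_rcons /= -!/(ears_in _ _) inp1 inq1 !andbT.
        by case/andP: inx => ->; case/andP: iny => ->.
      - by rewrite cat_rcons map_cat /= -cat1s uniq_catCA /= -map_cat nxc.
      - move=> a b; rewrite mem_rcons inE => /orP[/eqP -> //|ap bq] e.
        by have [_] := disj1 q1 sq1 a b ap bq; rewrite e.
      - rewrite size_cat size_rcons count_cat -cats1 count_cat /=.
        rewrite (count_all farp1) (count_all farq1).
        have : 0 < size q1 by case: (q1) q1n.
        by case: (is_far _); move: (size p1) (size q1); glia.
    * move=> c; rewrite cat_rcons -cat1s catA !map_cat !mem_cat /= inE.
      case/orP=> [/orP[cp|/eqP ->]|cq].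
      - by rewrite colsp1 // map_rcons mem_rcons inE cp orbT.
      - by rewrite colsp1 // map_rcons mem_rcons inE eqxx.
      - by rewrite [c \in deps q]colsq1 ?orbT // map_rcons mem_rcons inE cq orbT.
    * by rewrite !size_cat size_rcons; move: szp1 szq1; move: (size p1) (size q1) (size p) (size q); glia.
  + have p1n : p1 != [::].
      apply: contraL cmp => /eqP p1e; rewrite -leqNgt rx p1e /=.
      by rewrite ry; apply: leq_trans (walk_last wq1); rewrite leq_addr.
    exists (row x.1), p1, (rcons q1 (y.1, x.1)); split.
    * split.
      - split; first by rewrite rx; apply: walk_route.
        by apply: walk_rcons_route.
      - rewrite /ears_in all_cat all_rcons /= -!/(ears_in _ _) inp1 inq1 !andbT.
        by case/andP: inx => ->; case/andP: iny => ->.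
      - rewrite -cats1 catA map_cat cats1 rcons_uniq /= -cxy nxc.
        by rewrite ucat.
      - move=> a b ap; rewrite mem_rcons inE => /orP[/eqP -> //|bq] e.
        by have [_] := disj1 q1 sq1 a b ap bq; rewrite e.
      - rewrite size_cat size_rcons count_cat -cats1 count_cat /=.
        rewrite (count_all farp1) (count_all farq1).
        have : 0 < size p1 by case: (p1) p1n.
        by case: (is_far _); move: (size p1) (size q1); glia.
    * move=> c; rewrite -cats1 !map_cat !mem_cat /= inE.
      case/orP=> [cp|/orP[cq|/eqP ->]].
      - by rewrite colsp1 // map_rcons mem_rcons inE cp orbT.
      - by rewrite [c \in deps q]colsq1 ?orbT // map_rcons mem_rcons inE cq orbT.
      - by rewrite [_ \in deps q]colsq1 ?orbT // map_rcons mem_rcons inE eqxx.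
    * by rewrite !size_cat size_rcons; move: szp1 szq1; move: (size p1) (size q1) (size p) (size q); glia.
  + exfalso; case: (lastP p1) ep rx ncf1 => [|s a] ep rx ncf1'.
      rewrite /= in rx; have q1e : q1 = [::].
        by apply/eqP; have := walk_last wq1; rewrite -ry -cmp rx; case: (q1 == [::]) => //=; glia.
      by have := hd x y; rewrite ep eq q1e /= => /(_ erefl erefl); rewrite cxy eqxx.
    rewrite last_rcons in rx.
    have am : a \in rcons s a by rewrite mem_rcons inE eqxx.
    have [_ /negP] := ncf1' a am; apply; case: (lastP q1) eq ry => [|s' b] eq ry.
      have /(_ a) := walk_rows wp; rewrite ep mem_cat am => /(_ isT).
      by rewrite /= in ry; rewrite -rx cmp ry => /andP[h1 h2]; have := leq_ltn_trans h1 h2; rewrite ltnn.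
    rewrite last_rcons in ry; apply/mapP; exists b; last by rewrite -rx cmp ry.
    by rewrite eq mem_cat mem_rcons inE eqxx.
- rewrite /cf (negbTE ncx) => /mapP[y yq rxy].
  have [q1 [q2 eq]] := qsplit y yq.
  have wq1y : walk f (rcons q1 y) by move: wq; rewrite eq -cat_rcons walk_cat => /andP[].
  have sq1 : {subset rcons q1 y <= q} by move=> a; rewrite eq -cat_rcons mem_cat => ->.
  have colsq1 : {subset deps (rcons q1 y) <= deps q}.
    by move=> c; rewrite eq -cat_rcons map_cat mem_cat => ->.
  exists (row x.2), (rcons p1 x), (rcons q1 y); split.
  + split.
    * split; first by have := walk_route wp1x; rewrite last_rcons; apply; case: (p1).
      by have := walk_route wq1y; rewrite last_rcons rxy; apply; case: (q1).
    * move: inpq; rewrite /ears_in ep eq -!cat_rcons !all_cat.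
      by case/andP=> /andP[-> _] /andP[-> _].
    * rewrite map_cat cat_uniq up1x /=; apply/andP; split; last first.
        by move: uq; rewrite eq -cat_rcons map_cat cat_uniq => /andP[].
      have cq' : {subset cols (rcons q1 y) <= cols q}.
        by move=> c; rewrite eq -cat_rcons map_cat mem_cat => ->.
      apply/hasPn => c /cq' cq; apply: contraL cq.
      rewrite map_rcons mem_rcons inE => /orP[/eqP -> //|/mapP[a ap ->]].
      by have [] := ncf1 a ap.
    * move=> a b ap /sq1 bq e; move: ap; rewrite mem_rcons inE => /orP[/eqP -> //|ap].
      by have [_ /mapP[]] := ncf1 a ap; exists b.
    * move: farpq; rewrite ep eq -!cat_rcons !all_cat => /andP[/andP[h _] /andP[h' _]].
      by rewrite size_cat count_cat (count_all h) (count_all h'); move: (size (rcons p1 x)) (size (rcons q1 y)); glia.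
  + move=> c; rewrite !map_cat !mem_cat => /orP[] cc; apply/orP.
      by left; apply: colsp1; rewrite map_rcons; rewrite map_rcons in cc.
    by right; apply: colsq1; rewrite map_rcons; rewrite map_rcons in cc.
  + by rewrite ep eq -!cat_rcons !size_cat; move: (size (rcons p1 x)) (size (rcons q1 y)); glia.
Qed.

(** The tree of walks.  Assuming that no short bigon exists, walks starting at a
    fixed element reach pairwise distinct rows, although each of them can be
    continued in at least [t] ways at each of [r] steps.  The sets [Z] are
    columns to be avoided by bigons that open at a given element. *)
Section Existence.
Variables (E : {set I}) (Z : I -> {set K}) (r t c cn NR : nat).
Let T := t + r * c.+1.
Hypothesis simple : forall i j, row i = row j -> col i = col j -> i = j.
Hypothesis pos_inj : injective pos.
Hypothesis ZP : forall x, #|Z x| <= c.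
Hypothesis near : forall i, i \in E -> #|[set j in E | (col j == col i) && ~~ far i j]| <= cn.
Hypothesis far_irr : irreflexive far.
Hypothesis rowNR : forall i, row i < NR.

Definition leaving (A : {set I}) : {set I} :=
  [set e in E | [exists e' in A, [&& col e' == col e, row e < row e' & far e e']]].

(** Elements from which [n] successive steps are possible, each with at least
    [T] choices.  The excess of [T] over [t] allows for the columns that a walk
    has to avoid. *)
Fixpoint live n : {set I} :=
  if n is m.+1 then
    [set f in E | T <= #|[set e in leaving (live m) | (row e == row f) && (pos e < pos f)]|]
  else E.

Definition next n e : I :=
  odflt e [pick e' in live n | [&& col e' == col e, row e < row e' & far e e']].

Definition steps n f (H : {set K}) : {set I} :=
  [set e in leaving (live n) | [&& row e == row f, pos e < pos f & col e \notin H :|: Z f]].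

(** Arrivals of the walks of [n] steps from [f], in the tree where [H] collects
    the columns used by, or forbidden at, the ancestors of [f]. *)
Fixpoint endpoints n f H : {set I} :=
  if n is m.+1 then
    \bigcup_(e in steps m f H) endpoints m (next m e) (col e |: (H :|: Z f))
  else [set f].

Lemma liveE n : live n \subset E.
Proof. by case: n => //= n; apply/subsetP => f; rewrite inE => /andP[]. Qed.

Lemma nextP n e : e \in leaving (live n) ->
  [/\ next n e \in live n, col (next n e) = col e, row e < row (next n e) & far e (next n e)].
Proof.
rewrite inE => /andP[_ /existsP[e' /andP[h1 h2]]]; rewrite /next.
case: pickP => [x /andP[-> /and3P[/eqP -> -> ->]] //|/(_ e')].
by rewrite h1 h2.
Qed.

Lemma endpoints_walk n f H x : f \in E -> x \in endpoints n f H -> exists p,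
  [/\ walk f p, size p = n & x = (last (f, f) p).2] /\
  [/\ ears_in E p, all is_far p, uniq (cols p)
    & forall k, k \in cols p -> k \notin H :|: Z f].
Proof.
elim: n f H => [|n IH] f H fE /=; first by rewrite inE => /eqP ->; exists [::].
case/bigcupP=> e; rewrite inE => /andP[le /and3P[re pe ce]] xe.
have [nl nc nr nf] := nextP le.
have nE : next n e \in E by apply: (subsetP (liveE n)).
have [p [[wp sp xl] [inp fp up cp]]] := IH _ _ nE xe.
exists ((e, next n e) :: p); split; split=> //=.
- by rewrite re pe nc eqxx nr.
- by rewrite sp.
- by rewrite xl; case: (p).
- by rewrite nE andbT inp andbT; move: le; rewrite inE => /andP[].
- by rewrite {1}/is_far nf.
- rewrite up andbT; apply/negP => /cp; by rewrite !inE eqxx.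
- move=> k; rewrite inE => /orP[/eqP -> //|/cp].
  by rewrite !inE !negb_or -!andbA => /and4P[_ -> -> _].
Qed.

Lemma card_steps n f H : f \in live n.+1 -> #|H :|: Z f| <= r * c.+1 -> t <= #|steps n f H|.
Proof.
rewrite [live _]/= inE => /andP[_ hT] hH.
pose W := [set e in leaving (live n) | (row e == row f) && (pos e < pos f)].
have aux (L : {set I}) (a b : pred I) (S : {set K}) :
    [set e in L | [&& a e, b e & col e \notin S]] =
    [set e in L | a e && b e] :\: [set e in [set e in L | a e && b e] | col e \in S].
  by apply/setP => e; rewrite !inE; case: (e \in L) (a e) (b e) (_ \in S) => [] [] [] [].
have -> : steps n f H = W :\: [set e in W | col e \in H :|: Z f] := aux _ _ _ _.
have sub : [set e in W | col e \in H :|: Z f] \subset W.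
  by apply/subsetP => e; rewrite inE => /andP[].
rewrite cardsD (setIidPr sub).
have : #|[set e in W | col e \in H :|: Z f]| <= r * c.+1.
  apply: leq_trans hH; rewrite -(@card_in_imset _ _ col).
    by apply/subset_leq_card/subsetP => k /imsetP[e]; rewrite inE => /andP[_ ?] ->.
  move=> e1 e2; rewrite !inE -!andbA => /and5P[_ _ /eqP r1 _ _] /and5P[_ _ /eqP r2 _ _].
  by apply: simple; rewrite r1 r2.
by move: hT; rewrite /T -/W; glia.
Qed.

Hypothesis NB : forall f v p q, f \in E -> bigon E (row f) v p q ->
  (forall x, x \in p ++ q -> row x.1 = row f -> pos x.1 < pos f) ->
  (forall x, x \in p ++ q -> col x.1 \notin Z f) -> size (p ++ q) <= r.*2 -> False.

(** Two walks of the tree that part at [f] and arrive in the same row contain a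
    bigon opening at [f], by [two_walks_bigon].  So the subtrees of distinct
    children have disjoint sets of end rows, and the cardinals multiply. *)
Lemma card_endpoints n f (H : {set K}) : n <= r -> f \in live n -> #|H| <= (r - n) * c.+1 ->
  t ^ n <= #|endpoints n f H| /\ {in endpoints n f H &, injective row}.
Proof.
elim: n f H => [|n IH] f H nr fl hH.
  by rewrite /= cards1; split=> // x y; rewrite !inE => /eqP -> /eqP ->.
have hHZ : #|H :|: Z f| <= (r - n.+1) * c.+1 + c.
  by apply: leq_trans (leq_card_setU _ _) _; rewrite leq_add.
have hHZ' : #|H :|: Z f| <= r * c.+1.
  apply: leq_trans hHZ _; rewrite -{2}(subnK nr) mulnDl leq_add2l mulSn.
  by move: (n * _); glia.
have ho := card_steps fl hHZ'.
pose F e := endpoints n (next n e) (col e |: (H :|: Z f)).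
have fE : f \in E := subsetP (liveE _) _ fl.
have IHe e : e \in steps n f H -> t ^ n <= #|F e| /\ {in F e &, injective row}.
  rewrite inE => /andP[/nextP[nl _ _ _] _]; apply: IH => //; first exact: ltnW.
  rewrite cardsU1; apply: leq_trans (leq_add (leq_b1 _) hHZ) _.
  have -> : r - n = (r - n.+1).+1 by move: nr; glia.
  by rewrite mulSn; glia.
have key e1 e2 x1 x2 : e1 \in steps n f H -> e2 \in steps n f H -> x1 \in F e1 -> x2 \in F e2 ->
    row x1 = row x2 -> e1 = e2.
  move=> o1 o2 h1 h2 rx; apply/eqP; apply/negPn/negP => ne.
  have walkF e x : e \in steps n f H -> x \in F e -> exists p,
      [/\ walk f ((e, next n e) :: p), size p = n & x = (last (f, f) ((e, next n e) :: p)).2] /\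
      [/\ ears_in E ((e, next n e) :: p), all is_far ((e, next n e) :: p),
          uniq (cols ((e, next n e) :: p))
        & forall k, k \in cols ((e, next n e) :: p) -> k \notin H :|: Z f].
    move=> oe xe; have xe' : x \in endpoints n.+1 f H by apply/bigcupP; exists e.
    move: oe; rewrite inE => /andP[le /and3P[re pe ce]].
    have [nl nc nr' nf] := nextP le.
    have nE : next n e \in E by apply: (subsetP (liveE n)).
    have [p [[wp sp xl] [inp fp up cp]]] := endpoints_walk nE xe.
    exists p; split; split=> //=.
    - by rewrite re pe nc eqxx nr'.
    - by rewrite xl; case: (p).
    - by rewrite nE andbT inp andbT; move: le; rewrite inE => /andP[].
    - by rewrite {1}/is_far nf.
    - rewrite up andbT; apply/negP => /cp; by rewrite !inE eqxx.
    - move=> k; rewrite inE => /orP[/eqP -> //|/cp].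
      by rewrite !inE !negb_or -!andbA => /and4P[_ -> -> _].
  have [p [[wp sp xp] [inp fp up cp]]] := walkF _ _ o1 h1.
  have [q [[wq sq xq] [inq fq uq cq]]] := walkF _ _ o2 h2.
  have [||||v [p' [q' [bg sc sz]]]] := @two_walks_bigon E f _ _ wp wq _ _ up uq isT isT.
  - by rewrite /ears_in all_cat; apply/andP.
  - by rewrite all_cat; apply/andP.
  - move=> x y [<-] [<-] /=; apply: contraNneq ne => ce.
    apply/eqP; apply: simple => //.
    by move: o1 o2; rewrite !inE => /andP[_ /and3P[/eqP -> _ _]] /andP[_ /and3P[/eqP -> _ _]].
  - by rewrite -xp -xq.
  - have sub x : x \in p' ++ q' ->
        exists2 y, y \in ((e1, next n e1) :: p) ++ ((e2, next n e2) :: q) & x.1 = y.1.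
      by move=> xpq; apply/mapP; apply: sc; apply: map_f.
    apply: NB fE bg _ _ _.
    + move=> x /sub[y ypq ->] ry.
      by move: ypq; rewrite mem_cat => /orP[] yp; [apply: walk_left wp yp ry|apply: walk_left wq yp ry].
    + move=> x /sub[y + ->]; rewrite mem_cat => /orP[] yp.
        have /cp : col y.1 \in cols ((e1, next n e1) :: p) by apply: map_f.
        by rewrite inE negb_or => /andP[].
      have /cq : col y.1 \in cols ((e2, next n e2) :: q) by apply: map_f.
      by rewrite inE negb_or => /andP[].
    + by apply: leq_trans sz _; rewrite size_cat /= sp sq -addnn leq_add.
split; last first.
  move=> x1 x2 /= /bigcupP[e1 o1 h1] /bigcupP[e2 o2 h2] rx.
  have e12 := key _ _ _ _ o1 o2 h1 h2 rx; subst e2.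
  exact: (IHe _ o1).2.
rewrite [endpoints _ _ _]/= -/F -sum1_card.
have -> : \bigcup_(e in steps n f H) F e = cover [set F e | e in steps n f H].
  by rewrite cover_imset.
have tn0 : 0 < t ^ n \/ t ^ n = 0 by case: (t ^ n); [right|left].
case: tn0 => tn0; last by rewrite expnSr tn0 mul0n.
have injF : {in steps n f H &, injective F}.
  move=> e1 e2 o1 o2 eF; have [h _] := IHe _ o1.
  have /card_gt0P[x xF] : 0 < #|F e1| by apply: leq_trans h.
  by apply: (key _ _ x x) => //; rewrite -eF.
have tr : trivIset [set F e | e in steps n f H].
  apply/trivIsetP => _ _ /imsetP[e1 o1 ->] /imsetP[e2 o2 ->] ne.
  rewrite -setI_eq0; apply/eqP/setP => x; rewrite !inE; apply/negP => /andP[h1 h2].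
  by move/eqP: ne; apply; rewrite (key _ _ x x o1 o2 h1 h2).
rewrite sum1_card -(eqP tr) big_imset //=.
apply: (@leq_trans (\sum_(e in steps n f H) t ^ n)); last by apply: leq_sum => e /IHe[].
by rewrite sum_nat_const expnS leq_mul2r ho orbT.
Qed.
End Existence.

Section Count.
Variables (E : {set I}) (T cn NR : nat).
Hypothesis simple : forall i j, row i = row j -> col i = col j -> i = j.
Hypothesis pos_inj : injective pos.
Hypothesis near : forall i, i \in E -> #|[set j in E | (col j == col i) && ~~ far i j]| <= cn.
Hypothesis far_irr : irreflexive far.
Hypothesis rowNR : forall i, row i < NR.

(** In each column, the stuck elements of [A] are close to the topmost one of
    them, as otherwise that one could leave. *)
Lemma card_stuck_col (A : {set I}) : A \subset E -> #|A :\: leaving E A| <= #|K| * cn.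
Proof.
move=> AE; rewrite -sum1_card (partition_big col predT) //=.
rewrite -sum_nat_const; apply: leq_sum => k _; rewrite sum1dep_card.
set X := [set e | _]; have [->|[e1 e1X]] := set_0Vmem X; first by rewrite cards0.
have [e0 e0X minr] := arg_minnP row e1X.
have XP e : e \in X -> [/\ e \in A, e \notin leaving E A & col e = k].
  by rewrite inE in_setD => /andP[/andP[-> ->] /eqP].
have [e0A e0n e0k] := XP _ e0X.
have e0E := subsetP AE _ e0A.
apply: leq_trans (near e0E); apply/subset_leq_card/subsetP => e eX.
have [eA en ek] := XP _ eX; rewrite inE (subsetP AE _ eA) ek e0k eqxx /=.
have := minr e eX; rewrite leq_eqVlt => /orP[/eqP re|re].
  by rewrite -(simple re) ?far_irr // ek e0k.
apply/negP => fe; move/negP: e0n; apply; rewrite inE e0E /=.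
by apply/existsP; exists e; rewrite eA ek e0k eqxx re fe.
Qed.

(** In each row, the elements with few others of [L] to their left all lie to
    the left of the rightmost of them. *)
Lemma card_stuck_row (L : {set I}) :
  #|[set f in L | #|[set e in L | (row e == row f) && (pos e < pos f)]| < T]| <= NR * T.
Proof.
rewrite -sum1_card (partition_big (fun i => Ordinal (rowNR i)) predT) //=.
have -> : NR * T = #|'I_NR| * T by rewrite card_ord.
rewrite -sum_nat_const; apply: leq_sum => k _; rewrite sum1dep_card.
set X := [set e | _]; have [->|[e1 e1X]] := set_0Vmem X; first by rewrite cards0.
have [e0 e0X maxp] := arg_maxnP pos e1X.
have XP e : e \in X -> [/\ e \in L, #|[set e' in L | (row e' == row e) && (pos e' < pos e)]| < T & row e = k].
  by rewrite inE in_set => /andP[/andP[-> ->] /eqP <-].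
have [e0A e0n e0k] := XP _ e0X.
apply: leq_trans e0n; have -> : #|X| = (#|X :\ e0|).+1 by rewrite (cardsD1 e0) (_ : e0 \in X).
rewrite ltnS.
apply/subset_leq_card/subsetP => e; rewrite in_setD1 => /andP[ne eX].
have [eA en ek] := XP _ eX; rewrite inE eA ek e0k eqxx /=.
have /= pe : pos e <= pos e0 by apply: maxp.
by rewrite ltn_neqAle pe andbT; apply: contraNneq ne => /pos_inj ->.
Qed.
End Count.

(** Passing from one level of [live] to the next loses few elements, so some
    element is live for [r] steps; its tree would have [t ^ r] leaves in
    pairwise distinct rows if there were no bigon. *)
Theorem bigon_exists (E : {set I}) (Z : I -> {set K}) (r t c cn NR : nat) :
  (forall i j, row i = row j -> col i = col j -> i = j) ->
  injective pos ->
  (forall x, #|Z x| <= c) ->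
  (forall i, i \in E -> #|[set j in E | (col j == col i) && ~~ far i j]| <= cn) ->
  irreflexive far ->
  (forall i, row i < NR) ->
  NR < t ^ r ->
  r * (#|K| * cn + NR * (t + r * c.+1)) < #|E| ->
  exists f v p q, [/\ f \in E, bigon E (row f) v p q,
    forall x, x \in p ++ q -> row x.1 = row f -> pos x.1 < pos f,
    forall x, x \in p ++ q -> col x.1 \notin Z f
    & size (p ++ q) <= r.*2].
Proof.
move=> simple pos_inj ZP near far_irr rowNR tr big.
apply: boolp.contrapT => nob.
have NB f v p q : f \in E -> bigon E (row f) v p q ->
  (forall x, x \in p ++ q -> row x.1 = row f -> pos x.1 < pos f) ->
  (forall x, x \in p ++ q -> col x.1 \notin Z f) -> size (p ++ q) <= r.*2 -> False.
  by move=> fE b1 b2 b3 b4; apply: nob; exists f, v, p, q.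
have sub n : #|E :\: live E r t c n| <= n * (#|K| * cn + NR * (t + r * c.+1)).
  elim: n => [|n IH]; first by rewrite /= setDv cards0.
  set A := live E r t c n; set L := leaving E A.
  have AE : A \subset E := liveE _ _ _ _ _.
  have h1 := card_stuck_col simple near far_irr AE.
  have h2 := card_stuck_row (t + r * c.+1) pos_inj rowNR L.
  rewrite mulSn; apply: leq_trans (leq_add (leq_add h1 h2) IH).
  apply: leq_trans _ (leq_trans (leq_card_setU _ _) (leq_add (leq_card_setU _ _) (leqnn _))).
  apply/subset_leq_card/subsetP => f; rewrite !in_setU !in_setD => /andP[nf fE].
  rewrite fE andbT; case fA: (f \in A); rewrite ?orbT // andbT orbF.
  case fL: (f \in L) => //=; move: nf; rewrite [live _ _ _ _ _]/= inE fE /= -ltnNge => nf.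
  by rewrite inE fL nf.
have /card_gt0P[f fl] : 0 < #|live E r t c r|.
  have := sub r; rewrite cardsD; have := subset_leq_card (subsetIr E (live E r t c r)).
  by move: big; move: (r * _) #|E| #|live _ _ _ _ _| #|_ :&: _| => a b d e; lia.
have c0 : #|(set0 : {set K})| <= (r - r) * c.+1 by rewrite cards0.
have [h1 h2] := card_endpoints simple ZP NB (leqnn r) fl c0.
move: h1; rewrite leqNgt => /negP; apply.
apply: leq_ltn_trans tr; rewrite -(card_in_imset (f := fun i => Ordinal (rowNR i))).
  by apply: leq_trans (max_card _) _; rewrite card_ord.
by move=> x y xe ye [] /h2; apply.
Qed.

Lemma two_bigons (E : {set I}) (r t cn NR : nat) :
  (forall i j, row i = row j -> col i = col j -> i = j) ->
  injective pos ->
  (forall i, i \in E -> #|[set j in E | (col j == col i) && ~~ far i j]| <= cn) ->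
  irreflexive far ->
  (forall i, row i < NR) ->
  NR < t ^ r ->
  (r * (#|K| * cn + NR * (t + r * r.*2.+1))).*2.+1 < #|E| ->
  exists z v w p q p' q', [/\ bigon E z v p q, bigon E v w p' q',
    uniq (cols ((p ++ q) ++ (p' ++ q')))
    & forall x y, x \in p ++ q -> y \in p' ++ q' -> row x.2 = v -> row y.1 = v -> pos y.1 < pos x.2].
Proof.
move=> simple pos_inj near far_irr rowNR tr; set Th := r * _ => big.
pose ok f (Z : {set K}) := exists v p q, [/\ bigon E (row f) v p q,
    forall x, x \in p ++ q -> row x.1 = row f -> pos x.1 < pos f
    & forall x, x \in p ++ q -> col x.1 \notin Z].
pose rich f := forall Z : {set K}, #|Z| <= r.*2 -> ok f Z.
pose N := [set f in E | ~~ boolp.asbool (rich f)].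
have nearS (A : {set I}) : A \subset E ->
    forall i, i \in A -> #|[set j in A | (col j == col i) && ~~ far i j]| <= cn.
  move=> AE i iA; apply: leq_trans (near i (subsetP AE _ iA)).
  apply/subset_leq_card/subsetP => j; rewrite !inE => /andP[jA ->].
  by rewrite (subsetP AE).
have NE : N \subset E by apply/subsetP => f; rewrite inE => /andP[].
have bigS (A : {set I}) z v p q : A \subset E -> bigon A z v p q -> bigon E z v p q.
  move=> AE [h1 h2 h3 h4 h5]; split=> //; apply: sub_all h2 => x /andP[a b].
  by rewrite !(subsetP AE).
have exZ f : exists Z : {set K}, #|Z| <= r.*2 /\ (f \in N -> ~ ok f Z).
  case: (boolP (f \in N)) => [|_]; last by exists set0; rewrite cards0.
  rewrite inE => /andP[_ /boolp.asboolPn nr].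
  have [Z /boolp.not_implyP[h1 h2]] : exists Z : {set K}, ~ (#|Z| <= r.*2 -> ok f Z).
    by apply/boolp.existsNP.
  by exists Z.
have [Z ZP] := boolp.choice exZ.
have NTh : #|N| <= Th.
  rewrite leqNgt; apply/negP => ltN.
  have [f [v [p [q [fN bg left av _]]]]] := bigon_exists simple pos_inj (fun f => (ZP f).1)
    (nearS _ NE) far_irr rowNR tr ltN.
  by apply: (ZP f).2 => //; exists v, p, q; split=> //; apply: bigS bg.
have RTh : Th < #|E :\: N|.
  rewrite cardsD (setIidPr NE); move: big NTh; move: #|E| #|N| => a b; rewrite -addnn; glia.
have RE : E :\: N \subset E by apply: subsetDl.
have [f [v [p [q [fN bg _ _ sz]]]]] := bigon_exists (Z := fun=> set0) simple pos_inj
  (fun=> leq_trans (eq_leq (cards0 _)) (leq0n r.*2)) (nearS _ RE) far_irr rowNR tr RTh.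
have [[rp rq] inR uc dr szf] := bg.
(* the leftmost arrival *)
have [g [gR rg gmin]] : exists g, [/\ g \in E :\: N, row g = v &
    forall x, x \in p ++ q -> row x.2 = v -> pos g <= pos x.2].
  have arr : exists x, (x \in p ++ q) && (row x.2 == v).
    case: p rp {bg inR uc dr szf sz} => //= x p /and5P[_ _ _ _ rv].
    by exists (last x p); rewrite -cat_cons mem_cat mem_last rv.
  case: (arg_minnP (P := fun x => (x \in p ++ q) && (row x.2 == v)) (fun x => pos x.2) (xchooseP arr)).
  move=> x /andP[xpq /eqP rx] mx; exists x.2; split=> //.
    by move/allP/(_ _ xpq): inR => /andP[].
  by move=> y ypq ry; apply: mx; rewrite ypq ry eqxx.
have rich_g : rich g.
  move: gR; rewrite inE => /andP[+ gE]; rewrite inE gE /= negbK => /boolp.asboolP //.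
have szZ : #|[set k in cols (p ++ q)]| <= r.*2.
  apply: leq_trans sz; rewrite -(size_map (fun x => col x.1)) cardsE.
  exact: card_size.
have [w [p' [q' [bg' left' av']]]] := rich_g _ szZ.
rewrite rg in bg' left'.
exists (row f), v, w, p, q, p', q'; split=> //.
- exact: bigS bg.
- have [_ _ uc' _ _] := bg'.
  rewrite map_cat cat_uniq uc uc' andbT /=; apply/hasPn => k /mapP[x xpq ->].
  by have := av' x xpq; rewrite inE.
- by move=> x y xpq ypq rx ry; apply: leq_trans (gmin _ xpq rx); apply: left'.
Qed.
End Bigons.

(** * Rerouting a cycle along two bigons *)

(** The cycle [C] is fixed and its vertices are called [c 0], ..., [c l.-1].
    The ears [w x], for [x] in [L], run between positions of [C]. *)
Section Surgery.
Variables (T : eqType) (e : rel T).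
Hypothesis e_sym : symmetric e.

Lemma path_rev x s : path e x s -> path e (last x s) (rev (belast x s)).
Proof. by move=> ps; rewrite rev_path (eq_path (e' := e)). Qed.

Lemma last_rev_belast (x : T) s : last (last x s) (rev (belast x s)) = x.
Proof. by case: s => //= y s; rewrite rev_cons last_rcons. Qed.

Lemma closed_ucycle x s : path e x s -> last x s = x -> uniq s -> 0 < size s ->
  exists c, ucycle e c /\ size c = size s.
Proof.
case: (lastP s) => // s' y; rewrite last_rcons => ps yx us _; subst y.
exists (x :: s'); split; last by rewrite size_rcons.
by rewrite /ucycle /= ps; move: us; rewrite rcons_uniq.
Qed.

Variables (x0 : T) (C : seq T).
Let c i := nth x0 C i.
Let l := size C.
Hypothesis uC : uniq C.
Hypothesis adjC : forall i, i.+1 < l -> e (c i) (c i.+1).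
Hypothesis adj0 : e (c l.-1) (c 0).

(** The part of [C] from [c p] to [c q], without its starting point [c p]; a
    path is represented by its first vertex together with the list of the others. *)
Definition up p q := [seq c i | i <- iota p.+1 (q - p)].
Definition down p q := rev [seq c i | i <- iota q (p - q)].

Lemma up_path p q : p <= q -> q < l -> path e (c p) (up p q) /\ last (c p) (up p q) = c q.
Proof.
move=> pq ql; have aux n : forall p, p + n < l ->
    path e (c p) [seq c i | i <- iota p.+1 n] /\ last (c p) [seq c i | i <- iota p.+1 n] = c (p + n).
  elim: n => [|n IH] p' /=; first by rewrite addn0.
  rewrite -addSnnS => h; have [h1 h2] := IH _ h; rewrite h1 h2 adjC //.
  by apply: leq_ltn_trans h; rewrite leq_addr.
by have := aux (q - p) p; rewrite subnKC //; apply.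
Qed.

Lemma size_up p q : size (up p q) = q - p.
Proof. by rewrite size_map size_iota. Qed.

Lemma size_down p q : size (down p q) = p - q.
Proof. by rewrite size_rev size_map size_iota. Qed.

Lemma down_path p q : q <= p -> p < l -> path e (c p) (down p q) /\ last (c p) (down p q) = c q.
Proof.
move=> qp pl; have [h1 h2] := up_path qp pl.
have e1 : c q :: up q p = rcons [seq c i | i <- iota q (p - q)] (c p).
  have ei : iota q (p - q).+1 = rcons (iota q (p - q)) p.
    by rewrite -addn1 iotaD /= cats1 subnKC.
  by rewrite -map_rcons -ei.
have : belast (c q) (up q p) = [seq c i | i <- iota q (p - q)].
  by move: e1; rewrite lastI => /rcons_inj[].
rewrite /down => <-; rewrite -h2.
by split; [apply: path_rev|apply: last_rev_belast].
Qed.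

Lemma mem_up p q v : q < l -> v \in up p q -> v \in C /\ p < index v C <= q.
Proof.
move=> ql /mapP[i]; rewrite mem_iota => ib ->.
have iq : p < i <= q by move: ib; glia.
have il : i < l by apply: leq_ltn_trans ql; case/andP: iq.
by rewrite mem_nth // index_uniq.
Qed.

Lemma mem_down p q v : q <= p -> p < l -> v \in down p q -> v \in C /\ q <= index v C < p.
Proof.
move=> qp pl; rewrite mem_rev => /mapP[i]; rewrite mem_iota => ib ->.
have iq : q <= i < p by move: ib qp; glia.
have il : i < l by apply: ltn_trans pl; case/andP: iq.
by rewrite mem_nth // index_uniq.
Qed.

Lemma uniq_map_c r : all (gtn l) r -> uniq r -> uniq [seq c i | i <- r].
Proof.
move=> /allP rl ur; rewrite map_inj_in_uniq // => i j ir jr /eqP.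
have il : i < l := rl _ ir; have jl : j < l := rl _ jr.
by rewrite nth_uniq // => /eqP.
Qed.

Lemma uniq_up p q : q < l -> uniq (up p q).
Proof.
move=> ql; apply: uniq_map_c (iota_uniq _ _); apply/allP => i.
by rewrite mem_iota => ib; apply: leq_ltn_trans ql; move: ib; glia.
Qed.

Lemma uniq_down p q : p < l -> uniq (down p q).
Proof.
move=> pl; rewrite rev_uniq; apply: uniq_map_c (iota_uniq _ _); apply/allP => i.
by rewrite mem_iota => ib; apply: ltn_trans pl; move: ib; glia.
Qed.

(** Two disjoint paths, from [x] to [c 0] and from [y] to [z], with [n]
    vertices in total, all of them in [ok]. *)
Definition strands (x y z : T) (ok : pred T) (n : nat) : Prop :=
  exists P Q, [/\ path e x P /\ last x P = c 0, path e y Q /\ last y Q = z,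
    uniq ((x :: P) ++ (y :: Q)), all ok ((x :: P) ++ (y :: Q))
    & size ((x :: P) ++ (y :: Q)) = n].

Lemma strands_swap x y z ok n : strands x y z ok n -> strands x z y ok n.
Proof.
case=> P [Q [hP [pQ lQ] u a s]]; exists P, (rev (belast y Q)).
have pm : perm_eq (z :: rev (belast y Q)) (y :: Q).
  by rewrite [y :: Q]lastI lQ perm_sym perm_rcons perm_cons perm_sym perm_rev.
have pm2 : perm_eq ((x :: P) ++ z :: rev (belast y Q)) ((x :: P) ++ y :: Q).
  by rewrite perm_cat2l.
split=> //.
- by rewrite -lQ; split; [apply: path_rev|apply: last_rev_belast].
- by rewrite (perm_uniq pm2).
- by rewrite (perm_all _ pm2).
- by rewrite (perm_size pm2).
Qed.

Lemma strands_weaken x y z (ok ok' : pred T) n :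
  (forall v, ok v -> ok' v) -> strands x y z ok n -> strands x y z ok' n.
Proof. by move=> sub [P [Q [h1 h2 h3 h4 h5]]]; exists P, Q; split=> //; apply: sub_all h4. Qed.

Lemma ext_path x s x' P : path e x (rcons s x') -> path e x P ->
  path e x' (rev (x :: s) ++ P) /\ last x' (rev (x :: s) ++ P) = last x P.
Proof.
move=> ps pP; have := path_rev ps; rewrite last_rcons belast_rcons => pr.
by rewrite cat_path pr rev_cons last_rcons last_cat last_rcons.
Qed.

Lemma ext_perm (x : T) s x' P : perm_eq (x' :: (rev (x :: s) ++ P)) (rcons s x' ++ (x :: P)).
Proof.
rewrite rev_cons cat_rcons -cat_cons perm_cat2r perm_sym perm_rcons perm_cons.
by rewrite perm_sym perm_rev.
Qed.

(** The strand that ends at [x] grows by a path from [x] to [x'] outside [ok]. *)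
Lemma strands_ext1 x y z ok n s x' : strands x y z ok n -> path e x (rcons s x') ->
  uniq (rcons s x') -> (forall v, v \in rcons s x' -> ~~ ok v) ->
  strands x' y z (fun v => ok v || (v \in rcons s x')) (n + (size s).+1).
Proof.
move=> [P [Q [[pP lP] hQ u a sz]]] ps us nok; exists (rev (x :: s) ++ P), Q.
have [h1 h2] := ext_path ps pP.
have pm : perm_eq ((x' :: (rev (x :: s) ++ P)) ++ y :: Q) (rcons s x' ++ ((x :: P) ++ (y :: Q))).
  by rewrite catA perm_cat2r ext_perm.
split=> //.
- by rewrite h2.
- rewrite (perm_uniq pm) cat_uniq us u andbT andTb; apply/hasPn => v vu.
  by apply/negP => /nok; rewrite (allP a v vu).
- rewrite (perm_all _ pm) all_cat; apply/andP; split; apply/allP => v vu /=.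
    by rewrite vu orbT.
  by rewrite (allP a v vu).
- by rewrite (perm_size pm) size_cat size_rcons sz addnC.
Qed.

Lemma strands_ext2 x y z ok n s y' : strands x y z ok n -> path e y (rcons s y') ->
  uniq (rcons s y') -> (forall v, v \in rcons s y' -> ~~ ok v) ->
  strands x y' z (fun v => ok v || (v \in rcons s y')) (n + (size s).+1).
Proof.
move=> [P [Q [hP [pQ lQ] u a sz]]] ps us nok; exists P, (rev (y :: s) ++ Q).
have [h1 h2] := ext_path ps pQ.
have pm : perm_eq ((x :: P) ++ (y' :: (rev (y :: s) ++ Q))) (rcons s y' ++ ((x :: P) ++ (y :: Q))).
  rewrite perm_sym (perm_trans (_ : perm_eq _ ((x :: P) ++ (rcons s y' ++ (y :: Q))))) //.
    by rewrite perm_catCA.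
  by rewrite perm_cat2l perm_sym ext_perm.
split=> //.
- by rewrite h2.
- rewrite (perm_uniq pm) cat_uniq us u andbT andTb; apply/hasPn => v vu.
  by apply/negP => /nok; rewrite (allP a v vu).
- rewrite (perm_all _ pm) all_cat; apply/andP; split; apply/allP => v vu /=.
    by rewrite vu orbT.
  by rewrite (allP a v vu).
- by rewrite (perm_size pm) size_cat size_rcons sz addnC.
Qed.

Variables (I K : finType) (row pos : I -> nat) (col : I -> K) (w : I * I -> seq T).
Variables (s : nat) (L : pred (I * I)).
Hypothesis pos_lt : forall i, pos i < l.
Hypothesis row_pos : forall i j, row i < row j -> pos i < pos j.
Hypothesis pos_inj : injective pos.
Hypothesis gap : forall i j, row i = row j -> pos i < pos j + s.
Hypothesis ear_path : forall x, L x -> path e (c (pos x.1)) (rcons (w x) (c (pos x.2))).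
Hypothesis ear_uniq : forall x, L x -> uniq (w x).
Hypothesis ear_off : forall x v, L x -> v \in w x -> v \notin C.
Hypothesis ear_disj : forall x y v, L x -> L y -> x != y -> v \in w x -> v \notin w y.

(** The vertices that strands may occupy when [C] has been scanned up to position
    [p], the heads being at positions [a] and [b] and the ears in [rem] being
    still unused. *)
Definition confined p a b (rem : seq (I * I)) (v : T) :=
  ((v \in C) ==> [|| index v C <= p, v == c a | v == c b]) && all (fun x => v \notin w x) rem.

(** The free ends of the two strands are the current vertex [c p] and the heads
    [c a] and [c b]; [lam] says which of the three is joined to [c 0]: the
    current vertex for [None], the first head for [Some true], the second for
    [Some false].  The strands have at least as many vertices as the scanned
    part of [C] and the two heads, up to a loss of [s] for each of the [k] ears used and a gain of
    [W], the total length of these ears. *)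
Definition state (lam : option bool) p a b rem k W : Prop :=
  exists2 n, p + 3 + W <= n + k * s &
  match lam with
  | None => strands (c p) (c a) (c b) (confined p a b rem) n
  | Some true => strands (c a) (c p) (c b) (confined p a b rem) n
  | Some false => strands (c b) (c p) (c a) (confined p a b rem) n
  end.

Definition swap_heads (lam : option bool) := omap negb lam.
(** Effect on the pairing of a row of the first route: its head becomes the
    current vertex, and the old current vertex is prolonged to the new head. *)
Definition pass_row (lam : option bool) :=
  match lam with None => Some true | Some true => None | Some false => Some false end.

Lemma pass_row_inj : injective pass_row. Proof. by case=> [[]|] [[]|]. Qed.
Lemma swap_heads_inj : injective swap_heads. Proof. by case=> [[]|] [[]|]. Qed.

Lemma state_swap lam p a b rem k W : state lam p a b rem k W -> state (swap_heads lam) p b a rem k W.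
Proof.
case=> n h st; exists n => //.
have sub v : confined p a b rem v -> confined p b a rem v by rewrite /confined [(v == c a) || _]orbC.
case: lam st => [[]|] /= st; [exact: strands_weaken sub st|exact: strands_weaken sub st|].
by apply: strands_swap; apply: strands_weaken sub st.
Qed.

Lemma state_weaken lam p a b rem rem' k W :
  {subset rem' <= rem} -> state lam p a b rem k W -> state lam p a b rem' k W.
Proof.
move=> sr [n h st]; exists n => //.
have sub v : confined p a b rem v -> confined p a b rem' v.
  by case/andP=> h1 /allP h2; rewrite /confined h1; apply/allP => x /sr /h2.
by case: lam st => [[]|]; apply: strands_weaken.
Qed.

Lemma cC i : i < l -> c i \in C. Proof. exact: mem_nth. Qed.
Lemma indexc i : i < l -> index (c i) C = i. Proof. by move=> il; rewrite index_uniq. Qed.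
Lemma c_inj i j : i < l -> j < l -> c i = c j -> i = j.
Proof. by move=> il jl cij; rewrite -(indexc il) cij indexc. Qed.

Lemma up_ear p x : L x -> p <= pos x.1 ->
  path e (c p) (rcons (up p (pos x.1) ++ w x) (c (pos x.2))).
Proof.
move=> Lx px; have [h1 h2] := up_path px (pos_lt x.1).
by rewrite rcons_cat cat_path h1 h2 ear_path.
Qed.

Lemma down_ear p x : L x -> pos x.1 <= p -> p < l ->
  path e (c p) (rcons (down p (pos x.1) ++ w x) (c (pos x.2))).
Proof.
move=> Lx px pl; have [h1 h2] := down_path px pl.
by rewrite rcons_cat cat_path h1 h2 ear_path.
Qed.

Lemma up_ear_uniq p x : L x -> p <= pos x.1 -> pos x.1 < pos x.2 ->
  uniq (rcons (up p (pos x.1) ++ w x) (c (pos x.2))).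
Proof.
move=> Lx px px2; rewrite rcons_uniq cat_uniq uniq_up // ear_uniq // andbT mem_cat negb_or.
apply/and3P; split.
- apply/andP; split; last by apply: contraL (cC (pos_lt x.2)) => /(ear_off Lx).
  apply/negP => /(mem_up (pos_lt x.1))[_]; rewrite indexc // => /andP[_].
  by rewrite leqNgt px2.
- by [].
- apply/hasPn => v /(ear_off Lx); apply: contra => /(mem_up (pos_lt x.1))[].
  by [].
Qed.

Lemma down_ear_uniq p x : L x -> pos x.1 <= p -> p < l -> p < pos x.2 ->
  uniq (rcons (down p (pos x.1) ++ w x) (c (pos x.2))).
Proof.
move=> Lx px pl px2; rewrite rcons_uniq cat_uniq uniq_down // ear_uniq // andbT mem_cat negb_or.
apply/and3P; split.
- apply/andP; split; last by apply: contraL (cC (pos_lt x.2)) => /(ear_off Lx).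
  apply/negP => /(mem_down px pl)[_]; rewrite indexc // => /andP[_ h].
  by have := ltn_trans h px2; rewrite ltnn.
- by [].
- apply/hasPn => v /(ear_off Lx); apply: contra => /(mem_down px pl)[].
  by [].
Qed.

(** The current vertex advances along [C] to the departure of [x] and takes the
    ear.  The vertices strictly between this departure and the old head are
    left out; they are fewer than [s], being inside a row. *)
Lemma pass_row_state lam p ja b x rem k W :
  state lam p (pos ja) b (x :: rem) k W ->
  uniq (x :: rem) -> L x -> all L rem -> row x.1 = row ja -> pos x.1 < pos ja -> row x.1 < row x.2 ->
  (forall i, row ja <= row i -> p < pos i) -> pos ja < b -> pos x.2 != b -> b < l ->
  state (pass_row lam) (pos ja) (pos x.2) b rem k.+1 (W + size (w x)).
Proof.
move=> st ux Lx Lrem rx px rx2 pP jab x2b bl.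
have px1 : p < pos x.1 by apply: pP; rewrite rx.
have px2 : p < pos x.2 by apply: pP; rewrite -rx ltnW.
have jx2 : pos ja < pos x.2 by apply: row_pos; rewrite -rx.
have x12 : pos x.1 < pos x.2 by apply: ltn_trans jx2.
pose ext := rcons (up p (pos x.1) ++ w x) (c (pos x.2)).
have extp : path e (c p) ext by apply: up_ear => //; apply: ltnW.
have extu : uniq ext by apply: up_ear_uniq => //; apply: ltnW.
have pl := pos_lt.
have extok v : v \in ext -> ~~ confined p (pos ja) b (x :: rem) v.
  rewrite mem_rcons inE mem_cat /confined => /or3P[/eqP ->|/(mem_up (pl _))[vC hv]|vw].
  - rewrite cC //= indexc // leqNgt px2 /= negb_and; apply/orP; left.
    rewrite negb_or; apply/andP; split; apply/negP => /eqP /c_inj h.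
      by move: jx2; rewrite h // ltnn.
    by move: x2b; rewrite h // eqxx.
  - rewrite vC /= negb_and; apply/orP; left; rewrite !negb_or -ltnNge.
    case/andP: hv => hv1 hv2; rewrite hv1 /=.
    apply/andP; split; apply/negP => /eqP ve; move: hv2; rewrite ve indexc //.
      by rewrite leqNgt px.
    by rewrite leqNgt (ltn_trans px jab).
  - by rewrite /= vw andbF.
have okext v : confined p (pos ja) b (x :: rem) v || (v \in ext) -> confined (pos ja) (pos x.2) b rem v.
  case/orP; rewrite /confined.
    case/andP=> h1 /=/andP[_ ->]; rewrite andbT; apply/implyP => vC.
    move: h1; rewrite vC /= => /or3P[h|/eqP ->|->]; last by rewrite !orbT.
      by rewrite (leq_trans h) //; apply: leq_trans (ltnW px1) (ltnW px).
    by rewrite indexc // leqnn.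
  move: ux => /= /andP[xrem _].
  rewrite mem_rcons inE mem_cat => /or3P[/eqP ->|/(mem_up (pl _))[vC hv]|vw].
  - rewrite eqxx /= orbT implybT /=; apply/allP => y yr.
    by apply: contraL (cC (pl x.2)) => /(ear_off (allP Lrem _ yr)).
  - case/andP: hv => _ hv; rewrite vC (leq_trans hv (ltnW px)) /=.
    by apply/allP => y yr; apply: contraL vC => /(ear_off (allP Lrem _ yr)).
  - rewrite (negbTE (ear_off Lx vw)) /=; apply/allP => y yr.
    apply: ear_disj vw => //; first exact: (allP Lrem).
    by apply: contraNneq xrem => ->.
case: st => n hn st; exists (n + (size (up p (pos x.1) ++ w x)).+1).
  have := gap (esym rx); rewrite size_cat size_up mulSn.
  by move: hn px1 px; move: (pos ja) (pos x.1) (size (w x)) (k * s); glia.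
case: lam st => [[]|] /= st.
- exact: (strands_weaken okext (strands_ext2 st extp extu extok)).
- exact: (strands_swap (strands_weaken okext (strands_ext2 st extp extu extok))).
- exact: (strands_weaken okext (strands_ext1 st extp extu extok)).
Qed.

(** The rows of the two routes are distinct until the end, so they are passed
    one at a time, in the order of [C]. *)
Lemma run_paths v la lb ja jb rest :
  walk row col pos ja la -> walk row col pos jb lb ->
  row (last (ja, ja) la).2 = v -> row (last (jb, jb) lb).2 = v ->
  uniq (la ++ lb ++ rest) -> all L (la ++ lb ++ rest) ->
  uniq ([seq x.2 | x <- (ja, ja) :: la] ++ [seq x.2 | x <- (jb, jb) :: lb]) ->
  (forall x y, x \in (ja, ja) :: la -> y \in (jb, jb) :: lb -> row x.2 = row y.2 -> row x.2 = v) ->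
  exists2 f : option bool -> option bool, injective f &
  forall lam p k W, state lam p (pos ja) (pos jb) (la ++ lb ++ rest) k W ->
    (forall i, minn (row ja) (row jb) <= row i -> p < pos i) ->
    exists2 p', (forall i, v <= row i -> p' < pos i) &
    state (f lam) p' (pos (last (ja, ja) la).2) (pos (last (jb, jb) lb).2) rest
      (k + size (la ++ lb)) (W + sumn [seq size (w x) | x <- la ++ lb]).
Proof.
have stop la' lb' ja' jb' : la' = [::] -> lb' = [::] -> row ja' = v ->
  exists2 f : option bool -> option bool, injective f &
  forall lam p k W, state lam p (pos ja') (pos jb') (la' ++ lb' ++ rest) k W ->
    (forall i, minn (row ja') (row jb') <= row i -> p < pos i) ->
    exists2 p', (forall i, v <= row i -> p' < pos i) &
    state (f lam) p' (pos (last (ja', ja') la').2) (pos (last (jb', jb') lb').2) rest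
      (k + size (la' ++ lb')) (W + sumn [seq size (w x) | x <- la' ++ lb']).
  move=> -> -> rv; exists id => // lam p k W st pP; exists p; last by rewrite /= !addn0.
  by move=> i vi; apply: pP; rewrite geq_min rv vi.
move: {2}(size la + size lb) (leqnn (size la + size lb)) => N.
elim: N la lb ja jb => [|N IH] la lb ja jb szN wa wb ea eb ul al ud dr.
  move: szN; rewrite leqn0 addn_eq0 !size_eq0 => /andP[/eqP la0 /eqP lb0].
  by apply: stop => //; rewrite -ea la0.
have wal := walk_last wa; have wbl := walk_last wb.
have lastE (j : I) (x : I * I) s' : last (x.2, x.2) s' = last (x.2, x.2) s' -> (last (j, j) (x :: s')).2 = (last (x.2, x.2) s').2.
  by move=> _; case: s'.
have [cmp|[cmp|cmp]] : row ja < row jb \/ row jb < row ja \/ row ja = row jb.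
  by case: ltngtP; [left|right; left|right; right].
- case: la => [|x la] in szN wa ea ul al ud dr wal *.
    by move: wbl; rewrite eb -ea /= => h; have := leq_trans cmp (leq_trans (leq_addr _ _) h); rewrite ltnn.
  move: wa => /= /and5P[/eqP rx px _ rx2 wa].
  rewrite lastE // in ea; move: ul al => /= /andP[xl ul] /andP[Lx al].
  have ud' : uniq ([seq x.2 | x <- (x.2, x.2) :: la] ++ [seq x.2 | x <- (jb, jb) :: lb]).
    by move: ud => /andP[].
  have [||f fi fP] := IH la lb x.2 jb _ wa wb ea eb ul al ud' _.
  + exact: szN.
  + move=> y z; rewrite inE => /orP[/eqP ->|ya] zb; last by apply: dr => //; rewrite !inE ya !orbT.
    by move=> /= h; apply: (dr x z) => //; rewrite !inE eqxx orbT.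
  exists (f \o pass_row); first by apply: inj_comp => //; apply: pass_row_inj.
  move=> lam p k W st pP.
  have st' : state (pass_row lam) (pos ja) (pos x.2) (pos jb) (la ++ lb ++ rest) k.+1 (W + size (w x)).
    have x2jb : pos x.2 != pos jb.
      apply: contraTneq ud => /pos_inj e2; rewrite /= e2; apply/negP => /and3P[_ + _].
      by rewrite mem_cat !inE eqxx !orbT.
    have pP' i : row ja <= row i -> p < pos i by move=> hi; apply: pP; rewrite geq_min hi.
    have u' : uniq (x :: la ++ lb ++ rest) by rewrite /= xl.
    exact: (pass_row_state st u' Lx al rx px rx2 pP' (row_pos cmp) x2jb (pos_lt jb)).
  have pP2 i : minn (row x.2) (row jb) <= row i -> pos ja < pos i.
    rewrite geq_min => /orP[] h; apply: row_pos; last exact: leq_trans cmp h.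
    by rewrite -rx; apply: leq_trans rx2 h.
  have [p' p'P st2] := fP (pass_row lam) (pos ja) k.+1 (W + size (w x)) st' pP2.
  exists p' => //; rewrite lastE //=.
  by rewrite addnS -addSn addnA.
- case: lb => [|x lb] in szN wb eb ul al ud dr wbl *.
    by move: wal; rewrite ea -eb /= => h; have := leq_trans cmp (leq_trans (leq_addr _ _) h); rewrite ltnn.
  move: wb => /= /and5P[/eqP rx px _ rx2 wb].
  rewrite lastE // in eb.
  have pm : perm_eq (x :: la ++ lb ++ rest) (la ++ (x :: lb) ++ rest).
    by rewrite -cat1s perm_catCA.
  rewrite -(perm_uniq pm) in ul; rewrite -(perm_all _ pm) in al.
  move: ul al => /= /andP[xl ul] /andP[Lx al].
  have ud' : uniq ([seq x.2 | x <- (ja, ja) :: la] ++ [seq x.2 | x <- (x.2, x.2) :: lb]).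
    by apply: subseq_uniq ud; apply: cat_subseq => //; apply: subseq_cons.
  have [||f fi fP] := IH la lb ja x.2 _ wa wb ea eb ul al ud' _.
  + by move: szN; rewrite addnS ltnS.
  + move=> y z ya; rewrite inE => /orP[/eqP ->|zb]; last by apply: dr => //; rewrite !inE zb !orbT.
    by move=> /= h; apply: (dr y x) => //; rewrite !inE eqxx orbT.
  exists (f \o (swap_heads \o (pass_row \o swap_heads))).
    by apply: inj_comp => //; apply: inj_comp; [apply: swap_heads_inj|apply: inj_comp; [apply: pass_row_inj|apply: swap_heads_inj]].
  move=> lam p k W st pP.
  have st0 : state (swap_heads lam) p (pos jb) (pos ja) (x :: la ++ lb ++ rest) k W.
    by apply: state_weaken (state_swap st) => z; rewrite (perm_mem pm).
  have st' : state (swap_heads (pass_row (swap_heads lam))) (pos jb) (pos ja) (pos x.2) (la ++ lb ++ rest) k.+1 (W + size (w x)).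
    have x2ja : pos x.2 != pos ja.
      apply: contraTneq ud => /pos_inj e2; rewrite cat_uniq; apply/negP => /and3P[_ /hasPn h _].
      by have := h x.2; rewrite /= !inE e2 !eqxx !orbT => /(_ isT).
    have pP' i : row jb <= row i -> p < pos i by move=> hi; apply: pP; rewrite geq_min hi orbT.
    have u' : uniq (x :: la ++ lb ++ rest) by rewrite /= xl.
    apply: state_swap.
    exact: (pass_row_state st0 u' Lx al rx px rx2 pP' (row_pos cmp) x2ja (pos_lt ja)).
  have pP2 i : minn (row ja) (row x.2) <= row i -> pos jb < pos i.
    rewrite geq_min => /orP[] h; apply: row_pos; first exact: leq_trans cmp h.
    by rewrite -rx; apply: leq_trans rx2 h.
  have [p' p'P st2] := fP (swap_heads (pass_row (swap_heads lam))) (pos jb) k.+1 (W + size (w x)) st' pP2.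
  have e3 : (last x lb).2 = (last (x.2, x.2) lb).2 by case: (lb).
  exists p' => //; rewrite e3.
  have -> : k + size (la ++ x :: lb) = k.+1 + size (la ++ lb).
    by rewrite !size_cat /= addSnnS addnS.
  have -> : W + sumn [seq size (w x) | x <- la ++ x :: lb] =
      W + size (w x) + sumn [seq size (w x) | x <- la ++ lb].
    by rewrite !map_cat !sumn_cat /= -!addnA; congr (_ + _); rewrite addnCA.
  exact: st2.
- have rv : row ja = v.
    by apply: (dr (ja, ja) (jb, jb)) => //; rewrite inE eqxx.
  apply: stop => //.
    by apply/eqP; move: wal; rewrite ea -rv; case: (la) => //= ? ?; rewrite addn1 ltnn.
  by apply/eqP; move: wbl; rewrite eb -cmp -rv; case: (lb) => //= ? ?; rewrite addn1 ltnn.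
Qed.

Lemma confined_final p a b rem v : confined p a b rem v -> (v \in C) ==> [|| index v C <= p, v == c a | v == c b].
Proof. by case/andP. Qed.

Lemma confined_ear x rem p a b v : L x -> all L rem -> x \notin rem -> v \in w x -> confined p a b rem v.
Proof.
move=> Lx al xr vw; rewrite /confined (negbTE (ear_off Lx vw)) /=; apply/allP => y yr.
apply: ear_disj vw => //; first exact: (allP al).
by apply: contraNneq xr => ->.
Qed.

Lemma confined_cycle rem p a b i : all L rem -> i < l -> [|| i <= p, i == a | i == b] -> confined p a b rem (c i).
Proof.
move=> al il h; rewrite /confined cC // indexc //=; apply/andP; split.
  by case/or3P: h => [->|/eqP ->|/eqP ->]; rewrite ?eqxx ?orbT.
by apply/allP => y yr; apply: contraL (cC il) => /(ear_off (allP al _ yr)).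
Qed.

Lemma nth_index_cycle v : v \in C -> v = c (index v C).
Proof. by move=> vC; rewrite /c nth_index. Qed.

Lemma confined_up rem p a b p1 q1 v : all L rem -> q1 < l -> q1 <= p -> v \in up p1 q1 -> confined p a b rem v.
Proof.
move=> al ql qp /(mem_up ql)[vC /andP[_ h]]; rewrite (nth_index_cycle vC); apply: confined_cycle => //.
  exact: leq_ltn_trans h ql.
by rewrite (leq_trans h qp).
Qed.

Lemma confined_down rem p a b p1 q1 v : all L rem -> q1 <= p1 -> p1 < l -> p1 <= p -> v \in down p1 q1 -> confined p a b rem v.
Proof.
move=> al qp1 pl qp /(mem_down qp1 pl)[vC /andP[_ h]]; rewrite (nth_index_cycle vC); apply: confined_cycle => //.
  exact: ltn_trans h pl.
by rewrite (leq_trans (ltnW h) qp).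
Qed.

(** At the top of a bigon, [C] is followed from [c 0] to the departure of [x],
    which takes [x]; the other strand consists of the ear [y] alone.  The
    stretch between the two departures is left out. *)
Lemma start_state x y rem :
  uniq [:: x, y & rem] -> all L [:: x, y & rem] -> row x.1 = row y.1 -> pos x.1 < pos y.1 ->
  row x.1 < row x.2 -> row y.1 < row y.2 -> x.2 != y.2 ->
  state (Some true) (pos y.1) (pos x.2) (pos y.2) rem 1 (size (w x) + size (w y)).
Proof.
move=> u al rxy pxy rx ry ne; have pl := pos_lt.
case/and3P: al => Lx Ly al; case/and3P: u => xr yr _.
move: xr; rewrite inE negb_or => /andP[xy xr].
have x2 : pos y.1 < pos x.2 by apply: row_pos; rewrite -rxy.
have y2 : pos y.1 < pos y.2 by apply: row_pos.
have x12 : pos x.1 < pos x.2 by apply: ltn_trans x2.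
have ne2 : pos x.2 != pos y.2 by apply: contraNneq ne => /pos_inj ->.
have l0 : 0 < l by apply: leq_ltn_trans (pl x.1).
have p0 : strands (c 0) (c (pos y.1)) (c (pos y.1)) (pred2 (c 0) (c (pos y.1))) 2.
  exists [::], [::]; split=> //=; last by rewrite !eqxx !orbT.
  rewrite inE andbT; apply/negP => /eqP /c_inj h.
  by move: pxy; rewrite -h.
pose ext1 := rcons (up 0 (pos x.1) ++ w x) (c (pos x.2)).
have e1p : path e (c 0) ext1 by apply: up_ear.
have e1u : uniq ext1 by apply: up_ear_uniq.
have e1f v : v \in ext1 -> ~~ pred2 (c 0) (c (pos y.1)) v.
  rewrite mem_rcons inE mem_cat /= => /or3P[/eqP ->|/(mem_up (pl _))[vC hv]|vw].
  - rewrite negb_or; apply/andP; split; apply/negP => /eqP /c_inj h.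
      by move: x2; rewrite h.
    by move: x2; rewrite h // ltnn.
  - rewrite negb_or; apply/andP; split; apply/negP => /eqP ve; move: hv; rewrite ve indexc //.
    by rewrite ?ltnn ?[pos y.1 <= _]leqNgt ?pxy ?andbF.
  - by rewrite negb_or; apply/andP; split; apply/negP => /eqP ve; move: (ear_off Lx vw);
       rewrite ve cC.
have s1 := strands_ext1 p0 e1p e1u e1f.
pose ext2 := rcons (w y) (c (pos y.2)).
have e2p : path e (c (pos y.1)) ext2 by apply: ear_path.
have e2u : uniq ext2.
  rewrite rcons_uniq ear_uniq // andbT; apply: contraL (cC (pl y.2)); exact: ear_off.
have e2f v : v \in ext2 -> ~~ (pred2 (c 0) (c (pos y.1)) v || (v \in ext1)).
  rewrite mem_rcons inE => /orP[/eqP ->|vw]; rewrite negb_or; apply/andP; split.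
  - rewrite /= negb_or; apply/andP; split; apply/negP => /eqP /c_inj h.
      by move: y2; rewrite h.
    by move: y2; rewrite h // ltnn.
  - rewrite mem_rcons inE mem_cat !negb_or; apply/and3P; split.
    + by apply: contra ne2 => /eqP /c_inj ->.
    + apply/negP => /(mem_up (pl _))[_]; rewrite indexc // => /andP[_].
      by rewrite leqNgt (ltn_trans pxy y2).
    + by apply: contraL (cC (pl y.2)); exact: ear_off.
  - rewrite /= negb_or; apply/andP; split; apply/negP => /eqP ve; move: (ear_off Ly vw);
       by rewrite ve cC.
  - rewrite mem_rcons inE mem_cat !negb_or; apply/and3P; split.
    + by apply/eqP => ve; move: (ear_off Ly vw); rewrite ve cC.
    + by apply/negP => /(mem_up (pl _))[vC]; move: (ear_off Ly vw); rewrite vC.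
    + by apply: ear_disj vw; rewrite // eq_sym.
have s2 := strands_swap (strands_ext2 s1 e2p e2u e2f).
eexists; last first.
  apply: strands_weaken s2 => v /orP[/orP[/orP[]/eqP ->|]|].
  - by apply: confined_cycle.
  - by apply: confined_cycle => //; rewrite leqnn.
  - rewrite mem_rcons inE mem_cat => /or3P[/eqP ->|vu|vw].
    + by apply: confined_cycle => //; rewrite eqxx orbT.
    + by apply: confined_up vu => //; apply: ltnW.
    + exact: confined_ear vw.
  - rewrite mem_rcons inE => /orP[/eqP ->|vw].
    + by apply: confined_cycle => //; rewrite eqxx !orbT.
    + exact: confined_ear vw.
have := gap (esym rxy); rewrite size_cat size_up.
by move: (pos x.1) (pos y.1) (size (w x)) (size (w y)); glia.
Qed.

(** In the pairing that cannot be closed, the current vertex is joined to the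
    left head [c (pos ja)].  The next bigon departs between them: the ear [x] is
    reached going forwards from the current vertex, the ear [y] going backwards
    from that head, and the right head becomes the current vertex. *)
Lemma turn_state p ja jb x y rem k W :
  state (Some false) p (pos ja) (pos jb) [:: x, y & rem] k W ->
  uniq [:: x, y & rem] -> all L [:: x, y & rem] ->
  row x.1 = row jb -> row y.1 = row jb -> row ja = row jb ->
  p < pos x.1 -> pos x.1 < pos y.1 -> pos y.1 < pos ja -> pos ja < pos jb ->
  row x.1 < row x.2 -> row y.1 < row y.2 -> x.2 != y.2 ->
  state None (pos jb) (pos x.2) (pos y.2) rem k.+2 (W + (size (w x) + size (w y))).
Proof.
move=> [n hn st] u al rx ry rj px pxy pyj pj rx2 ry2 ne; have pl := pos_lt.
case/and3P: al => Lx Ly al; case/and3P: u => xr yr _.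
move: xr; rewrite inE negb_or => /andP[xy xr].
have x2 : pos jb < pos x.2 by apply: row_pos; rewrite -rx.
have y2 : pos jb < pos y.2 by apply: row_pos; rewrite -ry.
have ne2 : pos x.2 != pos y.2 by apply: contraNneq ne => /pos_inj ->.
have xb : pos x.1 < pos jb by apply: ltn_trans pj; apply: ltn_trans pyj.
have yb : pos y.1 < pos jb by apply: ltn_trans pj.
have pb : p < pos jb by apply: ltn_trans xb.
pose ext1 := rcons (up p (pos x.1) ++ w x) (c (pos x.2)).
have e1p : path e (c p) ext1 by apply: up_ear => //; apply: ltnW.
have e1u : uniq ext1 by apply: up_ear_uniq => //; [apply: ltnW|apply: ltn_trans x2].
have okrem v z : z \in [:: x, y & rem] -> v \in w z -> ~~ confined p (pos ja) (pos jb) [:: x, y & rem] v.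
  move=> zr vw; rewrite /confined negb_and; apply/orP; right; apply/negP => /allP /(_ _ zr).
  by rewrite vw.
have okC i : i < l -> p < i -> i != pos ja -> i != pos jb -> ~~ confined p (pos ja) (pos jb) [:: x, y & rem] (c i).
  move=> il pi ia ib; rewrite /confined negb_and cC // indexc // leqNgt pi /= negb_or.
  by apply/orP; left; apply/andP; split; apply/negP => /eqP /c_inj h;
    [move: ia|move: ib]; rewrite h // eqxx.
have e1f v : v \in ext1 -> ~~ confined p (pos ja) (pos jb) [:: x, y & rem] v.
  rewrite mem_rcons inE mem_cat => /or3P[/eqP ->|/(mem_up (pl _))[vC hv]|vw].
  - by apply: okC => //; rewrite ?gtn_eqF //; [apply: ltn_trans x2|apply: ltn_trans x2].
  - case/andP: hv => h1 h2; rewrite (nth_index_cycle vC); apply: okC => //; first exact: leq_ltn_trans h2 _.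
      by rewrite ltn_eqF // (leq_ltn_trans h2) // (ltn_trans pxy).
    by rewrite ltn_eqF // (leq_ltn_trans h2).
  - by apply: okrem vw; rewrite inE eqxx.
have s1 := strands_swap (strands_ext2 st e1p e1u e1f).
pose ext2 := rcons (down (pos ja) (pos y.1) ++ w y) (c (pos y.2)).
have yj := ltnW pyj.
have e2p : path e (c (pos ja)) ext2 by apply: down_ear.
have e2u : uniq ext2 by apply: down_ear_uniq => //; apply: ltn_trans y2.
have e2f v : v \in ext2 -> ~~ (confined p (pos ja) (pos jb) [:: x, y & rem] v || (v \in ext1)).
  rewrite mem_rcons inE mem_cat negb_or => /or3P[/eqP ->|/(mem_down yj (pl _))[vC /andP[h1 h2]]|vw].
  - apply/andP; split.
      by apply: okC => //; rewrite ?gtn_eqF //; [apply: ltn_trans y2|apply: ltn_trans y2].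
    rewrite mem_rcons inE mem_cat !negb_or; apply/and3P; split.
    + by apply: contra ne2 => /eqP /c_inj ->.
    + apply/negP => /(mem_up (pl _))[_]; rewrite indexc // => /andP[_].
      by rewrite leqNgt (ltn_trans xb y2).
    + by apply: contraL (cC (pl y.2)); exact: ear_off.
  - apply/andP; split.
      have il : index v C < l by rewrite /l index_mem.
      rewrite (nth_index_cycle vC); apply: okC => //.
      - exact: ltn_trans px (leq_trans pxy h1).
      - by rewrite ltn_eqF.
      - by rewrite ltn_eqF // (ltn_trans h2).
    rewrite mem_rcons inE mem_cat !negb_or; apply/and3P; split.
    + apply/eqP => ve; move: h2; rewrite ve indexc // ltnNge.
      by rewrite (ltnW (ltn_trans pj x2)).
    + apply/negP => /(mem_up (pl _))[_] /andP[_].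
      by rewrite leqNgt (leq_trans pxy h1).
    + by apply: contraL vC; exact: ear_off.
  - apply/andP; split; first by apply: okrem vw; rewrite !inE eqxx orbT.
    rewrite mem_rcons inE mem_cat !negb_or; apply/and3P; split.
    + by apply/eqP => ve; move: (ear_off Ly vw); rewrite ve cC.
    + by apply/negP => /(mem_up (pl _))[vC]; move: (ear_off Ly vw); rewrite vC.
    + by apply: ear_disj vw; rewrite // eq_sym.
have s2 := strands_swap (strands_ext2 s1 e2p e2u e2f).
eexists; last first.
  apply: strands_weaken s2 => v /orP[/orP[|]|].
  - case/andP=> h1 /= /and3P[_ _ h2]; rewrite /confined h2 andbT; apply/implyP => vC.
    move: h1; rewrite vC /= => /or3P[h|/eqP ->|/eqP ->].
    + by rewrite (leq_trans h) // ltnW.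
    + by rewrite indexc // ltnW.
    + by rewrite indexc // leqnn.
  - rewrite mem_rcons inE mem_cat => /or3P[/eqP ->|vu|vw].
    + by apply: confined_cycle => //; rewrite eqxx orbT.
    + by apply: confined_up vu => //; apply: ltnW.
    + exact: confined_ear vw.
  - rewrite mem_rcons inE mem_cat => /or3P[/eqP ->|vd|vw].
    + by apply: confined_cycle => //; rewrite eqxx !orbT.
    + by apply: confined_down vd => //; apply: ltnW.
    + exact: confined_ear vw.
have g1 : pos y.1 < pos x.1 + s by apply: gap; rewrite rx ry.
have g2 : pos jb < pos ja + s by apply: gap.
rewrite !size_cat size_up size_down !mulSn.
move: hn px pxy pyj g1 g2; move: (pos x.1) (pos y.1) (pos ja) (pos jb) (size (w x)) (size (w y)) (k * s); glia.
Qed.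

(** The part of [C] between the current vertex and the left head joins these
    two, and the part after the right head leads back to [c 0].  The result is
    a single cycle unless the current vertex was already joined to the left
    head, which is the excluded pairing. *)
Lemma close_state lam p ja jb k W :
  state lam p (pos ja) (pos jb) [::] k W -> lam != Some false ->
  p < pos ja -> pos ja < pos jb -> row ja = row jb ->
  exists cyc, ucycle e cyc /\ l + W < size cyc + k.+1 * s.
Proof.
move=> [n hn st] nl pa ab rab; have pl := pos_lt.
have l1 : l.-1 < l by move: (pl ja); case: (l).
have bl : pos jb <= l.-1 by move: (pl jb); case: (l).
have [upb lastb] := up_path bl l1.
have g : pos jb < pos ja + s by apply: gap.
have disj P (ok : pred T) u d : all ok P -> (forall v, ok v -> confined p (pos ja) (pos jb) [::] v) ->
    u = up (pos jb) l.-1 -> (forall v, v \in d -> v \in C /\ (p < index v C < pos ja)) ->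
    (forall v, v \in P -> v \notin u ++ d) /\ (forall v, v \in u -> v \notin d).
  move=> aP sub -> hd; split=> v.
    move=> /(allP aP) /sub /confined_final h; rewrite mem_cat negb_or; apply/andP; split.
      apply/negP => /(mem_up l1)[vC /andP[h1 h2]]; move: h; rewrite vC /= => /or3P[|/eqP|/eqP] h.
      - by have := leq_trans (ltn_trans (ltn_trans pa ab) h1) h; rewrite ltnn.
      - by move: h1; rewrite h indexc // ltnNge (ltnW ab).
      - by move: h1; rewrite h indexc // ltnn.
    apply/negP => /hd[vC /andP[h1 h2]]; move: h; rewrite vC /= => /or3P[|/eqP|/eqP] h.
    - by have := leq_trans h1 h; rewrite ltnn.
    - by move: h2; rewrite h indexc // ltnn.
    - by move: h2; rewrite h indexc // ltnNge (ltnW ab).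
  move=> /(mem_up l1)[vC /andP[h1 _]]; apply/negP => /hd[_ /andP[_ h2]].
  by have := ltn_trans (ltn_trans h2 ab) h1; rewrite ltnn.
have fin x P y Q d : path e x P -> last x P = c 0 -> path e y Q -> last y Q = c (pos jb) ->
   uniq ((x :: P) ++ (y :: Q)) -> all (confined p (pos ja) (pos jb) [::]) ((x :: P) ++ y :: Q) ->
   path e x (rcons d y) -> uniq d -> (forall v, v \in d -> v \in C /\ (p < index v C < pos ja)) ->
   size ((x :: P) ++ (y :: Q)) = n -> size d = pos ja - p.+1 ->
   exists cyc, ucycle e cyc /\ l + W < size cyc + k.+1 * s.
  move=> pP lP pQ lQ u ok pd ud hd sz szd.
  pose S := Q ++ (up (pos jb) l.-1 ++ (rev (x :: P) ++ rcons d y)).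
  have pS : path e y S.
    rewrite cat_path pQ lQ cat_path upb lastb /=.
    rewrite [x :: P]lastI lP rev_rcons cat_cons /= adj0 /= cat_path -lP path_rev //=.
    by rewrite last_rev_belast pd.
  have lS : last y S = y by rewrite !last_cat last_rcons.
  have pmS : perm_eq S (((x :: P) ++ (y :: Q)) ++ (up (pos jb) l.-1 ++ d)).
    apply/seq.permP => a; rewrite /S !count_cat count_rev -cats1 count_cat /=.
    move: (count a Q) (count a (up _ _)) (count a P) (count a d) (nat_of_bool (a x)) (nat_of_bool (a y)).
    by glia.
  have uS : uniq S.
    rewrite (perm_uniq pmS) cat_uniq u /=.
    have [h1 h2] := disj _ _ _ _ ok (fun v h => h) erefl hd.
    rewrite cat_uniq uniq_up // ud andbT /= -!/(has _ _); apply/andP; split.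
      by apply/hasPn => v vu; apply/negP => /h1; rewrite vu.
    by apply/hasPn => v vd; apply/negP => /h2; rewrite vd.
  have szS : size S = n + (l.-1 - pos jb + (pos ja - p.+1)).
    by rewrite (perm_size pmS) size_cat sz size_cat size_up szd.
  have S0 : 0 < size S by rewrite szS -sz.
  have [cyc [uc sc]] := closed_ucycle pS lS uS S0.
  exists cyc; split=> //; rewrite sc szS mulSn.
  move: hn pa ab g bl (pl jb); move: (k * s) (pos ja) (pos jb) n {S pS lS pmS uS szS S0 sc sz szd disj st}.
  by move: l; glia.
case: lam st nl => [[]|] // [P [Q [[pP lP] [pQ lQ] u ok sz]]] _.
- have [dp ld] := down_path (ltnW pa) (pl ja).
  have ds := size_down (pos ja) p; have du := uniq_down p (pl ja).
  have dm v := @mem_down (pos ja) p v (ltnW pa) (pl ja).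
  case/lastP: (down (pos ja) p) => [|d z] in dp ld ds du dm *.
    by move: ds pa => /= /esym /eqP; rewrite subn_eq0 leqNgt => /negP.
  rewrite last_rcons in ld; subst z; move: du; rewrite rcons_uniq => /andP[pd du].
  apply: (fin _ P _ Q d pP lP pQ lQ u ok dp du _ sz); last by move: ds; rewrite size_rcons; move: (pos ja) pa; glia.
  move=> v vd; have [|vC /andP[h1 h2]] := dm v; first by rewrite mem_rcons inE vd orbT.
  split=> //; rewrite h2 andbT ltn_neqAle h1 andbT; apply: contraNneq pd => ->.
  by rewrite -(nth_index_cycle vC).
- have [dp ld] := up_path (ltnW pa) (pl ja).
  have ds := size_up p (pos ja); have du := uniq_up p (pl ja).
  have dm v := @mem_up p (pos ja) v (pl ja).
  case/lastP: (up p (pos ja)) => [|d z] in dp ld ds du dm *.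
    by move: ds pa => /= /esym /eqP; rewrite subn_eq0 leqNgt => /negP.
  rewrite last_rcons in ld; subst z; move: du; rewrite rcons_uniq => /andP[pd du].
  apply: (fin _ P _ Q d pP lP pQ lQ u ok dp du _ sz); last by move: ds; rewrite size_rcons; move: (pos ja) pa; glia.
  move=> v vd; have [|vC /andP[h1 h2]] := dm v; first by rewrite mem_rcons inE vd orbT.
  split=> //; rewrite h1 /= ltn_neqAle h2 andbT; apply: contraNneq pd => <-.
  by rewrite -(nth_index_cycle vC).
Qed.

Variables (far : rel I).
Hypothesis far_long : forall x, L x -> far x.1 x.2 -> 2 * s <= size (w x).

Notation bigon := (bigon row col pos far).
Notation cols p := [seq col x.1 | x <- p].

Lemma walk_cols f p : walk row col pos f p -> [seq col x.2 | x <- p] = cols p.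
Proof. by elim: p f => //= x p IH f /and5P[_ _ /eqP -> _ /IH ->]. Qed.

Lemma route_cols z v p : route row col pos z v p -> [seq col x.2 | x <- p] = cols p.
Proof. by case: p => //= x p /and5P[_ /eqP -> _ /walk_cols -> _]. Qed.

(** From just after its first two ears to its last row, a bigon acts on pairings
    by a map [f] which depends on the bigon alone, and which is injective as a
    composite of the involutions [pass_row] and [swap_heads]. *)
Lemma bigon_transfer E z v x la y lb rest :
  bigon E z v (x :: la) (y :: lb) -> uniq ((x :: la) ++ (y :: lb) ++ rest) ->
  all L ((x :: la) ++ (y :: lb) ++ rest) ->
  exists2 f : option bool -> option bool, injective f &
  forall lam p k W, state lam p (pos x.2) (pos y.2) (la ++ lb ++ rest) k W ->
    (forall i, z < row i -> p < pos i) ->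
    exists2 p', (forall i, v <= row i -> p' < pos i) &
    state (f lam) p' (pos (last x la).2) (pos (last y lb).2) rest
      (k + size (la ++ lb)) (W + sumn [seq size (w x) | x <- la ++ lb]).
Proof.
case=> [[/= /and5P[/eqP rx cx lx wa ea] /and5P[/eqP ry cy ly wb eb]]] inE' uc dr szf.
case/andP=> _ ul /andP[_ al].
have lE (a : I * I) (s' : seq (I * I)) : (last a s').2 = (last (a.2, a.2) s').2 by case: s'.
have pm : perm_eq (y :: la ++ lb ++ rest) (la ++ (y :: lb) ++ rest).
  by rewrite -cat1s perm_catCA.
have := ul; rewrite -(perm_uniq pm) => /andP[_ ul'].
have := al; rewrite -(perm_all _ pm) => /andP[_ al'].
have [||||f fi fP] := @run_paths v la lb x.2 y.2 rest wa wb _ _ ul' al' _ _.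
- by rewrite -lE; apply/eqP.
- by rewrite -lE; apply/eqP.
- apply: (@map_uniq _ _ col); rewrite map_cat -!map_comp.
  move: uc; rewrite /= map_cat /= (eqP cx) (eqP cy) => uc.
  rewrite /= /comp /=.
  by rewrite (walk_cols wa) (walk_cols wb).
- move=> a b; rewrite !inE => aa bb.
  have [a' [a'm <-]] : exists a', a' \in x :: la /\ a'.2 = a.2.
    by case/orP: aa => [/eqP ->|h]; [exists x|exists a]; rewrite inE ?eqxx ?h ?orbT.
  have [b' [b'm <-]] : exists b', b' \in y :: lb /\ b'.2 = b.2.
    by case/orP: bb => [/eqP ->|h]; [exists y|exists b]; rewrite inE ?eqxx ?h ?orbT.
  exact: dr.
exists f => // lam p k W st pP.
have [|p' p'P st'] := fP lam p k W st _.
  by move=> i; rewrite geq_min => /orP[] h; apply: pP; [rewrite -rx|rewrite -ry]; apply: leq_trans h.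
by exists p' => //; rewrite [(last x la).2]lE [(last y lb).2]lE.
Qed.

Lemma close_bigon lam p i j v k W :
  state lam p (pos i) (pos j) [::] k W -> row i = v -> row j = v -> i != j ->
  (forall i', v <= row i' -> p < pos i') ->
  lam != Some (pos j < pos i) ->
  exists cyc, ucycle e cyc /\ l + W < size cyc + k.+1 * s.
Proof.
move=> st ri rj ij pP; case: (ltngtP (pos j) (pos i)) => [h|h|/pos_inj h] nl.
- apply: (close_state (state_swap st)) => //; last by rewrite ri rj.
    by case: lam nl {st} => [[]|].
  by apply: pP; rewrite rj.
- by apply: (close_state st) => //; [apply: pP; rewrite ri|rewrite ri rj].
- by rewrite h eqxx in ij.
Qed.

Lemma gain_enough p : all L p -> size p <= 2 * count (is_far far) p -> 
  size p * s <= sumn [seq size (w x) | x <- p].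
Proof.
move=> al h; apply: (@leq_trans (2 * count (is_far far) p * s)); first by rewrite leq_mul2r h orbT.
rewrite mulnAC; elim: p al {h} => [|x p IH] /=; first by rewrite muln0.
case/andP=> Lx /IH h; rewrite mulnDr leq_add //; case fx: (is_far far x); last by rewrite muln0.
by rewrite muln1 far_long.
Qed.

Lemma bigon_cons E z v p q : bigon E z v p q -> exists x la y lb, p = x :: la /\ q = y :: lb.
Proof. by case: p => [|x la] [[]] //; case: q => // y lb; exists x, la, y, lb. Qed.

(** Let [f] and [f'] be the actions of the two bigons, both entered with the
    pairing [Some true].  If neither can be closed on its own, then the second is
    entered from the first through [turn_state] with the pairing [None], and
    [f' None] differs from the pairing [f' (Some true)] that cannot be closed. *)
Lemma two_bigons_ordered E1 E2 z v u x la y lb x' la' y' lb' :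
  bigon E1 z v (x :: la) (y :: lb) -> bigon E2 v u (x' :: la') (y' :: lb') ->
  uniq (cols (((x :: la) ++ (y :: lb)) ++ ((x' :: la') ++ (y' :: lb')))) ->
  all L (((x :: la) ++ (y :: lb)) ++ ((x' :: la') ++ (y' :: lb'))) ->
  (forall a b, a \in (x :: la) ++ (y :: lb) -> b \in (x' :: la') ++ (y' :: lb') ->
     row a.2 = v -> row b.1 = v -> pos b.1 < pos a.2) ->
  pos x.1 < pos y.1 -> pos x'.1 < pos y'.1 ->
  exists cyc, ucycle e cyc /\ l < size cyc.
Proof.
set p := x :: la; set q := y :: lb; set p' := x' :: la'; set q' := y' :: lb'.
move=> bg bg' uc al left_of xy xy'.
have ul : uniq ((p ++ q) ++ (p' ++ q')) := map_uniq uc.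
have [al1 al2] : all L (p ++ q) /\ all L (p' ++ q') by apply/andP; rewrite -all_cat.
have [ul1 ul2] : uniq (p ++ q) /\ uniq (p' ++ q').
  by move: ul; rewrite cat_uniq => /and3P[].
have facts E z0 v0 (a : I * I) r b t : bigon E z0 v0 (a :: r) (b :: t) ->
   [/\ [/\ row a.1 = z0, row b.1 = z0, row a.1 < row a.2 & row b.1 < row b.2], a.2 != b.2,
     row (last a r).2 = v0, row (last b t).2 = v0 & (last a r).2 != (last b t).2].
  case=> [[ra rb] _ uc' _ _]; have ca := route_cols ra; have cb := route_cols rb.
  have ne i j : i \in a :: r -> j \in b :: t -> i.2 != j.2.
    move=> ir jt; apply/eqP => e2; move: uc'; rewrite map_cat cat_uniq => /and3P[_ /hasPn h _].
    have /h /negP : col i.2 \in cols (b :: t) by rewrite -cb e2; apply: map_f.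
    by apply; rewrite -ca; apply: map_f.
  move: ra rb => /= /and5P[/eqP -> _ -> _ /eqP ->] /and5P[/eqP -> _ -> _ /eqP ->].
  by split=> //; apply: ne; rewrite ?mem_last ?mem_head.
have [[rx ry lx ly] nxy rA rB nAB] := facts _ _ _ _ _ _ _ bg.
have [[rx' ry' lx' ly'] nxy' rA' rB' nAB'] := facts _ _ _ _ _ _ _ bg'.
have [_ _ _ _ gain] := bg; have [_ _ _ _ gain'] := bg'.
set A := (last x la).2 in rA nAB; set B := (last y lb).2 in rB nAB.
set A' := (last x' la').2 in rA' nAB'; set B' := (last y' lb').2 in rB' nAB'.
have fin k W : k * s <= W -> (exists cyc, ucycle e cyc /\ l + W < size cyc + k * s) ->
    exists cyc, ucycle e cyc /\ l < size cyc.
  by move=> kW [cyc [h1 h2]]; exists cyc; split=> //; move: kW h2; move: (k * s) (size cyc) l; glia.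
have gA := gain_enough al1 gain; have gA' := gain_enough al2 gain'.
pose rest := p' ++ q'.
have ul0 : uniq (p ++ q ++ rest) by rewrite catA.
have al0 : all L (p ++ q ++ rest) by rewrite catA.
have st0 rest' : uniq (p ++ q ++ rest') -> all L (p ++ q ++ rest') ->
   state (Some true) (pos y.1) (pos x.2) (pos y.2) (la ++ lb ++ rest') 1 (size (w x) + size (w y)).
  move=> h1 h2.
  have pm : perm_eq [:: x, y & la ++ lb ++ rest'] (p ++ q ++ rest').
    by rewrite /p /q cat_cons perm_cons -cat1s perm_catCA.
  by apply: start_state; rewrite ?(perm_uniq pm) ?(perm_all _ pm) // rx ry.
have st0' : state (Some true) (pos y'.1) (pos x'.2) (pos y'.2) (la' ++ lb') 1 (size (w x') + size (w y')).
  have pm : perm_eq [:: x', y' & la' ++ lb'] (p' ++ q').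
    by rewrite /p' /q' cat_cons perm_cons -cat1s perm_catCA.
  by apply: start_state; rewrite ?(perm_uniq pm) ?(perm_all _ pm) // rx' ry'.
have [f fi fP] := bigon_transfer bg ul0 al0.
have ul2' : uniq (p' ++ q' ++ [::]) by rewrite cats0.
have al2' : all L (p' ++ q' ++ [::]) by rewrite cats0.
have [f' fi' fP'] := bigon_transfer bg' ul2' al2'.
have below i : z < row i -> pos y.1 < pos i by move=> h; apply: row_pos; rewrite ry.
have below' i : v < row i -> pos y'.1 < pos i by move=> h; apply: row_pos; rewrite ry'.
have [p1 p1P st1] := fP _ _ _ _ (st0 rest ul0 al0) below.
have cnt : (1 + size (la ++ lb)).+1 = size (p ++ q) by rewrite /= !size_cat /= addnS.
have cnt' : (1 + size (la' ++ lb')).+1 = size (p' ++ q') by rewrite /= !size_cat /= addnS.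
have sm (a : I * I) r b t : size (w a) + size (w b) + sumn [seq size (w x) | x <- r ++ t] =
    sumn [seq size (w x) | x <- (a :: r) ++ (b :: t)].
  by rewrite !map_cat !sumn_cat /= -!addnA; congr (_ + _); rewrite addnCA.
rewrite sm in st1.
case: (eqVneq (f (Some true)) (Some (pos B < pos A))) => [bad|good]; last first.
  apply: fin gA _; rewrite -cnt.
  by apply: close_bigon (state_weaken _ st1) rA rB nAB p1P good.
have := st0'; rewrite -[la' ++ lb']cats0 -catA => st0''.
have [p2 p2P st2] := fP' _ _ _ _ st0'' below'.
rewrite sm in st2.
case: (eqVneq (f' (Some true)) (Some (pos B' < pos A'))) => [bad'|good]; last first.
  apply: fin gA' _; rewrite -cnt'.
  exact: close_bigon st2 rA' rB' nAB' p2P good.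
(* neither bigon closes up on its own: chain them *)
have pm : perm_eq [:: x', y' & la' ++ lb'] rest.
  by rewrite /rest /p' /q' cat_cons perm_cons -cat1s perm_catCA.
have mA : last x la \in p ++ q by rewrite mem_cat mem_last.
have mB : last y lb \in p ++ q by rewrite mem_cat mem_last orbT.
have mx' : x' \in p' ++ q' by rewrite inE eqxx.
have my' : y' \in p' ++ q' by rewrite mem_cat [y' \in q']inE eqxx orbT.
have turn : exists j, row j = v /\ (forall i, v < row i -> pos j < pos i) /\
    state None (pos j) (pos x'.2) (pos y'.2) (la' ++ lb') (1 + size (la ++ lb)).+2
      (sumn [seq size (w x) | x <- p ++ q] + (size (w x') + size (w y'))).
  have ulr : uniq [:: x', y' & la' ++ lb'] by rewrite (perm_uniq pm).
  have alr : all L [:: x', y' & la' ++ lb'] by rewrite (perm_all _ pm).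
  have p1x' : p1 < pos x'.1 by apply: p1P; rewrite rx'.
  have y'A : pos y'.1 < pos A by apply: left_of.
  have y'B : pos y'.1 < pos B by apply: left_of.
  have st1' : state (f (Some true)) p1 (pos A) (pos B) [:: x', y' & la' ++ lb']
      (1 + size (la ++ lb)) (sumn [seq size (w x) | x <- p ++ q]).
    by apply: state_weaken st1 => a; rewrite (perm_mem pm).
  rewrite bad in st1'.
  case: (ltngtP (pos B) (pos A)) => [h|h|/pos_inj h] in bad st1' *.
  - exists A; rewrite rA; split=> //; split; first by move=> i; rewrite -{1}rA; apply: row_pos.
    by apply: (turn_state (state_swap st1')) => //; rewrite ?rB ?rA ?rx' ?ry' // -?rx' -?ry'.
  - exists B; rewrite rB; split=> //; split; first by move=> i; rewrite -{1}rB; apply: row_pos.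
    by apply: (turn_state st1') => //; rewrite ?rB ?rA ?rx' ?ry' // -?rx' -?ry'.
  - by rewrite h eqxx in nAB.
case: turn => j [rj [jP st3]].
move: st3; rewrite -[la' ++ lb']cats0 -catA => st3.
have [p4 p4P st4] := fP' _ _ _ _ st3 jP.
have ne : f' None != Some (pos B' < pos A').
  by rewrite -bad'; apply/eqP => /fi'.
have := close_bigon st4 rA' rB' nAB' p4P ne.
rewrite -addnA sm; apply: fin.
have -> : ((1 + size (la ++ lb)).+2 + size (la' ++ lb')).+1 = size (p ++ q) + size (p' ++ q').
  rewrite -cnt -cnt'; move: (size (la ++ lb)) (size (la' ++ lb')); glia.
by rewrite mulnDl leq_add.
Qed.

(** An element is rich if, whatever set of [2 * r] columns is forbidden, some
    bigon opens to its left.  By [bigon_exists] with the forbidden sets that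
    witness poverty, few elements are not rich.  So there is a bigon among rich
    elements, and its leftmost arrival in its last row opens a second bigon that
    avoids the columns of the first. *)
Theorem two_bigons_cycle E1 E2 z v u p q p' q' :
  bigon E1 z v p q -> bigon E2 v u p' q' ->
  uniq (cols ((p ++ q) ++ (p' ++ q'))) -> all L ((p ++ q) ++ (p' ++ q')) ->
  (forall a b, a \in p ++ q -> b \in p' ++ q' ->
     row a.2 = v -> row b.1 = v -> pos b.1 < pos a.2) ->
  exists cyc, ucycle e cyc /\ l < size cyc.
Proof.
move=> bg bg' uc al left_of.
have [x [la [y [lb [ep eq]]]]] := bigon_cons bg.
have [x' [la' [y' [lb' [ep' eq']]]]] := bigon_cons bg'.
have hd E z0 v0 a r b t : bigon E z0 v0 (a :: r) (b :: t) -> pos a.1 != pos b.1.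
  case=> _ _ uc' _ _; apply/eqP => /pos_inj ab; move: uc'.
  by rewrite /= map_cat mem_cat /= ab inE eqxx orbT.
wlog xy : p q x la y lb ep eq bg uc al left_of / pos x.1 < pos y.1 => [W|].
  have := bg; rewrite ep eq => /hd; rewrite neq_ltn => /orP[lt|gt].
    exact: (W p q x la y lb).
  have pm : perm_eq ((q ++ p) ++ (p' ++ q')) ((p ++ q) ++ (p' ++ q')).
    by rewrite perm_cat2r perm_catC.
  apply: (W q p y lb x la) => //; first exact: bigon_sym.
  - by rewrite (perm_uniq (perm_map _ pm)).
  - by rewrite (perm_all _ pm).
  - by move=> a b; rewrite mem_cat orbC -mem_cat; apply: left_of.
wlog xy' : p' q' x' la' y' lb' ep' eq' bg' uc al left_of / pos x'.1 < pos y'.1 => [W|].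
  have := bg'; rewrite ep' eq' => /hd; rewrite neq_ltn => /orP[lt|gt].
    exact: (W p' q' x' la' y' lb').
  have pm : perm_eq ((p ++ q) ++ (q' ++ p')) ((p ++ q) ++ (p' ++ q')).
    by rewrite perm_cat2l perm_catC.
  apply: (W q' p' y' lb' x' la') => //; first exact: bigon_sym.
  - by rewrite (perm_uniq (perm_map _ pm)).
  - by rewrite (perm_all _ pm).
  - by move=> a b am; rewrite mem_cat orbC -mem_cat; apply: left_of.
subst; exact: two_bigons_ordered bg bg' uc al left_of xy xy'.
Qed.
End Surgery.

(** * Sorting the links into rows and columns *)

(** The elements of [I], sorted by the position [p], are cut into groups of [g]
    consecutive ones. *)
Section Ranks.
Variables (I : finType) (p : I -> nat) (g : nat).
Hypothesis p_inj : injective p.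
Hypothesis g_gt0 : 0 < g.

Definition rank_of i := #|[set j | p j < p i]|.
Definition group_of i := rank_of i %/ g.

Lemma rank_mono i j : p i < p j -> rank_of i < rank_of j.
Proof.
move=> ij; apply: proper_card; apply/properP; split.
  by apply/subsetP => x; rewrite !inE => /ltn_trans; apply.
by exists i; rewrite inE // ltnn.
Qed.

Lemma rank_inj : injective rank_of.
Proof.
move=> i j e; apply: p_inj; case: (ltngtP (p i) (p j)) => // /rank_mono; by rewrite e ltnn.
Qed.

Lemma rank_le i j : p i <= p j -> rank_of i <= rank_of j.
Proof. by rewrite leq_eqVlt => /orP[/eqP/p_inj ->//|/rank_mono/ltnW]. Qed.

Lemma group_le i j : p i <= p j -> group_of i <= group_of j.
Proof. by move=> /rank_le; apply: leq_div2r. Qed.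

Lemma group_lt i j : group_of i < group_of j -> p i < p j.
Proof. by move=> h; rewrite ltnNge; apply: contraL h => /group_le; rewrite leqNgt. Qed.

Lemma group_bound i : group_of i <= #|I| %/ g.
Proof. by apply: leq_div2r; apply: max_card. Qed.

Lemma card_group_of x : #|[set j | group_of j == x]| <= g.
Proof.
have h j : rank_of j %% g < g by rewrite ltn_mod.
rewrite -[X in _ <= X](card_ord g) -(@card_in_imset _ _ (fun j => Ordinal (h j))).
  exact: max_card.
move=> i j; rewrite !inE => /eqP gi /eqP gj [e].
by apply: rank_inj; rewrite (divn_eq (rank_of i) g) (divn_eq (rank_of j) g) -/(group_of i) -/(group_of j) gi gj e.
Qed.

(** A bound for the distances inside the group of [i]; the successor makes it
    positive, so that it has a dyadic class. *)
Definition span i := (\max_(x : I * I | (group_of x.1 == group_of i) && (group_of x.2 == group_of i)) (p x.1 - p x.2)).+1.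

Lemma span_ge i j j' : group_of j = group_of i -> group_of j' = group_of i -> p j - p j' < span i.
Proof.
move=> h1 h2; rewrite ltnS.
by apply: (@leq_bigmax_cond _ _ (fun x : I * I => p x.1 - p x.2) (j, j')); rewrite /= h1 h2 !eqxx.
Qed.

Lemma span_attained i : exists j j', [/\ group_of j = group_of i, group_of j' = group_of i & span i = (p j - p j').+1].
Proof.
have [|[j j'] h e] := @eq_bigmax_cond _ [pred x : I * I | (group_of x.1 == group_of i) && (group_of x.2 == group_of i)]
  (fun x : I * I => p x.1 - p x.2).
  by apply/card_gt0P; exists (i, i); rewrite !inE /= !eqxx.
by exists j, j'; move: h => /andP[/eqP h1 /eqP h2]; split=> //; congr _.+1.
Qed.

Lemma span_bound n i : (forall j, p j < n) -> span i <= n.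
Proof.
move=> pn; have [j [j' [_ _ ->]]] := span_attained i.
by apply: leq_ltn_trans (leq_subr _ _) (pn j).
Qed.

(** A group strictly between two groups that meet the window lies inside the
    window, so its span is less than [d], against the assumption on [E]. *)
Lemma card_window (E : {set I}) d x : 0 < d -> (forall i, i \in E -> d <= span i) ->
  #|[set j in E | p j %/ d == x]| <= g.*2.
Proof.
move=> d0 hE; set X := [set j in E | _].
have [->|[e0 e0X]] := set_0Vmem X; first by rewrite cards0.
have [e1 e1X min1] := arg_minnP group_of e0X.
have [e3 e3X max3] := arg_maxnP group_of e0X.
have XP j : j \in X -> j \in E /\ p j %/ d = x by rewrite inE => /andP[-> /eqP].
have sub : X \subset [set j | group_of j == group_of e1] :|: [set j | group_of j == group_of e3].
  apply/subsetP => e2 e2X; rewrite !inE; have /= m1 := min1 _ e2X; have /= m3 := max3 _ e2X.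
  apply/negPn/negP; rewrite negb_or => /andP[n1 n3].
  have l1 : group_of e1 < group_of e2 by rewrite ltn_neqAle eq_sym n1.
  have l3 : group_of e2 < group_of e3 by rewrite ltn_neqAle n3; apply: m3.
  have [j [j' [gj gj' sj]]] := span_attained e2.
  have [e2E c2] := XP _ e2X; have [_ c1] := XP _ e1X; have [_ c3] := XP _ e3X.
  have h1 : p e1 < p j' by apply: group_lt; rewrite gj'.
  have h2 : p e1 < p j by apply: group_lt; rewrite gj.
  have h3 : p j < p e3 by apply: group_lt; rewrite gj.
  have := hE _ e2E; rewrite sj => hs.
  have := divn_eq (p e1) d; have := divn_eq (p e3) d; rewrite c1 c3.
  have := ltn_pmod (p e3) d0; have := ltn_pmod (p e1) d0.
  move: hs h1 h2 h3; move: (p e1) (p e3) (p j) (p j') (_ %% _) (_ %% _) (x * d); glia.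
apply: leq_trans (subset_leq_card sub) _; apply: leq_trans (leq_card_setU _ _) _.
by rewrite -addnn leq_add // card_group_of.
Qed.
End Ranks.

Lemma cell_near d x y : 0 < d -> (x - y) + (y - x) < 4 * d -> x %/ d <= y %/ d + 4.
Proof.
move=> d0 h; rewrite leqNgt; apply/negP => lt5.
have : (y %/ d + 5) * d <= x %/ d * d.
  by rewrite leq_mul2r; apply/orP; right; move: lt5; move: (_ %/ _) (_ %/ _); glia.
have := divn_eq x d; have := divn_eq y d; have := ltn_pmod x d0; have := ltn_pmod y d0.
rewrite mulnDl; move: h; move: (x %/ d * d) (y %/ d * d) (_ %% _) (_ %% _); glia.
Qed.

(** The positions [p] and [q] of each link on the two cycles, and the segments
    [sp] and [sq] in which it ends. *)
Section Select.
Variables (I : finType) (p q sp sq : I -> nat) (n k g t r : nat).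
Hypothesis p_inj : injective p.
Hypothesis q_inj : injective q.
Hypothesis p_lt : forall i, p i < n.
Hypothesis g_gt0 : 0 < g.
Hypothesis sp_mono : forall i j, p i <= p j -> sp i <= sp j.
Hypothesis sp_le : forall i, sp i <= k.
Hypothesis sq_le : forall i, sq i <= k.
Hypothesis simple : forall i j, sp i = sp j -> sq i = sq j -> i = j.

Let NR := #|I| %/ g + k + 1.
Hypothesis trNR : NR < t ^ r.
Hypothesis big : (trunc_log 2 n).+1.*2 *
  (r * (k.+1 * (18 * g) + NR * (t + r * r.*2.+1))).+1.*2 <= #|I|.

(** Two consecutive bigons among a subfamily [J] of links, together with the
    metric conditions on rows and long ears that the rerouting uses. *)
Definition chain_found : Prop :=
  exists (J : finType) (iota : J -> I) (s : nat) (row : J -> nat) (col : J -> 'I_k.+1)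
    (z v u : nat) (a b a' b' : seq (J * J)),
  let pos := p \o iota in
  let far := fun i j => 2 * s <= (q (iota i) - q (iota j)) + (q (iota j) - q (iota i)) in
  [/\ injective iota, forall j, col j = sq (iota j) :> nat,
     (forall i j, row i < row j -> pos i < pos j) /\
     (forall i j, row i = row j -> pos i < pos j + s) ,
     bigon row col pos far [set: J] z v a b /\ bigon row col pos far [set: J] v u a' b' &
     uniq [seq col x.1 | x <- (a ++ b) ++ (a' ++ b')] /\
     forall x y, x \in a ++ b -> y \in a' ++ b' -> row x.2 = v -> row y.1 = v -> pos y.1 < pos x.2].

(** The row of a link adds the index of its group to the index of its segment:
    both are monotone along the first cycle, so the sum determines both.  Long
    ears abound because the groups on the second cycle span at least [s / 2]: a
    window of length [4 * s] is covered by nine cells of length [s / 2], each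
    containing at most [2 * g] links. *)
Lemma select : #|I| <= #|[set i | span p g i <= span q g i]|.*2 -> chain_found.
Proof.
set S := [set i | _] => hS; set Lg := (trunc_log 2 n).+1.
have lt i : trunc_log 2 (span p g i) < Lg.
  by rewrite ltnS leq_trunc_log // span_bound.
pose X (c : nat) := [set i in S | trunc_log 2 (span p g i) == c].
have [c hc] : exists c, #|S| <= Lg * #|X c|.
  have [c _ maxc] := @arg_maxnP 'I_Lg ord0 predT (fun c => #|X c|) isT.
  exists c; rewrite -sum1_card (partition_big (fun i => Ordinal (lt i)) predT) //=.
  rewrite -[X in X * _](card_ord Lg) -sum_nat_const; apply: leq_sum => d _.
  by rewrite sum1dep_card; have /= := maxc d isT; apply: leq_trans.
set E := X c in hc.
have EP i : i \in E -> [/\ span p g i <= span q g i, 2 ^ c <= span p g i & span p g i < 2 ^ c.+1].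
  rewrite !inE => /andP[h1 /eqP h2]; split=> //; last by rewrite -h2 trunc_log_ltn.
  by rewrite -h2 trunc_logP.
pose J := {i | i \in E}; pose iota (j : J) := val j.
have JE (j : J) : iota j \in E := valP j.
pose s := 2 ^ c.+1; pose pos := p \o iota.
pose row (j : J) := group_of p g (iota j) + sp (iota j).
pose col (j : J) : 'I_k.+1 := inord (sq (iota j)).
pose far (i j : J) := 2 * s <= (q (iota i) - q (iota j)) + (q (iota j) - q (iota i)).
have colE j : col j = sq (iota j) :> nat by rewrite inordK // ltnS.
have row_pos i j : row i < row j -> pos i < pos j.
  move=> h; rewrite ltnNge; apply: contraL h => h; rewrite -leqNgt.
  by rewrite leq_add // ?group_le // sp_mono.
have rowE i j : row i = row j -> group_of p g (iota i) = group_of p g (iota j) /\ sp (iota i) = sp (iota j).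
  wlog: i j / pos i <= pos j => [W h|ij].
    case: (leqP (pos i) (pos j)) => [|/ltnW] ij; first exact: W.
    by have [] := W j i ij (esym h).
  have h1 := group_le g p_inj ij; have h2 := sp_mono ij.
  rewrite /row; move: h1 h2; move: (group_of _ _ _) (group_of _ _ _) (sp _) (sp _) => a b c' d h1 h2 h.
  by split; move: h1 h2 h; clear; lia.
have gapP i j : row i = row j -> pos i < pos j + s.
  move=> /rowE[h1 _]; have [_ _ h2] := EP _ (JE i).
  have := span_ge (erefl (group_of p g (iota i))) (esym h1).
  rewrite /pos /= /s; move: h2; move: (p (iota i)) (p (iota j)) (span _ _ _) (2 ^ _); glia.
have simpleJ i j : row i = row j -> col i = col j -> i = j.
  move=> /rowE[_ h1] h2; apply: val_inj; apply: simple => //.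
  by rewrite -!colE h2.
have pos_inj : injective pos by move=> i j /p_inj /val_inj.
have rowNR j : row j < NR by rewrite /NR addn1 ltnS leq_add // group_bound.
have far_irr : irreflexive far.
  by move=> i; rewrite /far subnn addn0 leqNgt muln_gt0 expn_gt0.
have near (i : J) : i \in [set: J] -> #|[set j in [set: J] | (col j == col i) && ~~ far i j]| <= 18 * g.
  move=> _; pose Y := [set j in E | 2 * s > (q (iota i) - q j) + (q j - q (iota i))].
  apply: (@leq_trans #|Y|).
    rewrite -(card_imset _ val_inj); apply/subset_leq_card/subsetP => x /imsetP[j].
    rewrite inE => /andP[_ /andP[_ nf]] ->; rewrite inE; apply/andP; split; first exact: (valP j).
    by rewrite ltnNge.
  pose d := 2 ^ c; have d0 : 0 < d by rewrite expn_gt0.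
  pose f j : 'I_9 := inord (q j %/ d + 4 - q (iota i) %/ d).
  have fP j : j \in Y -> f j = q j %/ d + 4 - q (iota i) %/ d :> nat /\ q (iota i) %/ d <= q j %/ d + 4.
    rewrite inE => /andP[_]; rewrite /s expnS -/d => h.
    have h' : q (iota i) - q j + (q j - q (iota i)) < 4 * d by move: h; rewrite mulnA.
    have b2 := cell_near d0 h'; have b1 := @cell_near d (q j) (q (iota i)) d0 _.
    rewrite addnC in b1; have {}b1 := b1 h'.
    split=> //; rewrite inordK //; move: b1 b2; move: (_ %/ _) (_ %/ _); glia.
  rewrite -sum1_card (partition_big f predT) //=.
  have -> : 18 * g = #|'I_9| * g.*2 by rewrite card_ord -muln2; move: g; glia.
  rewrite -sum_nat_const; apply: leq_sum => y _; rewrite sum1dep_card.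
  have w := @card_window I q g q_inj g_gt0 E d (y + q (iota i) %/ d - 4) d0 _.
  apply: leq_trans (w _); last by move=> j /EP[h1 h2 _]; apply: leq_trans h2 h1.
  apply/subset_leq_card/subsetP => j; rewrite inE => /andP[jY /eqP fy].
  have [h1 h2] := fP j jY; rewrite inE; move: jY; rewrite inE => /andP[-> _] /=.
  by move: h1 h2; rewrite fy; move: (q j %/ d) (_ %/ d) => a b; clear; case: y => y _ /=; lia.
have cardJ : #|[set: J]| = #|E| by rewrite cardsT card_sig.
have bigJ : (r * (#|'I_k.+1| * (18 * g) + NR * (t + r * r.*2.+1))).*2.+1 < #|[set: J]|.
  rewrite cardJ card_ord; have := big; set M := r * _ => big'; rewrite ltnNge; apply/negP => h.
  have : #|S|.*2 <= Lg.*2 * M.*2.+1.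
    rewrite -doubleMl leq_double; apply: leq_trans hc _; rewrite leq_mul2l h; by rewrite orbT.
  move/(leq_trans hS)/(leq_trans big'); rewrite leq_mul2l double_eq0 /=.
  by rewrite doubleS ltnn.
have [z [v [u [a [b [a' [b' [h1 h2 h3 h4]]]]]]]] :=
  two_bigons simpleJ pos_inj near far_irr rowNR trNR bigJ.
exists J, iota, s, row, col, z, v, u, a, b; exists a', b'; split=> //.
exact: val_inj.
Qed.
End Select.

(** * Menger's theorem *)

Lemma last_split (T : Type) (a : pred T) (s : seq T) : has a s ->
  exists s1 x s2, [/\ s = s1 ++ x :: s2, a x & ~~ has a s2].
Proof.
rewrite -has_rev => /first_split[s1 [x [s2 [es ax ns]]]].
exists (rev s2), x, (rev s1); split=> //; last by rewrite has_rev.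
by rewrite -[s]revK es rev_cat rev_cons cat_rcons.
Qed.

Section Menger.
Variable (T : finType).
Implicit Types (e : rel T) (A B S : {set T}).

(** A nonempty walk from [A] to [B] that may meet [A] and [B] in between. *)
Definition abpath e A B (p : seq T) : bool :=
  if p is a :: p' then [&& a \in A, path e a p' & last a p' \in B] else false.

Definition separates e A B S := forall p, abpath e A B p -> has (mem S) p.

Definition linked e A B q := exists f : 'I_q -> seq T,
  (forall i, abpath e A B (f i) /\ uniq (f i)) /\
  (forall i j v, v \in f i -> v \in f j -> i = j).

Lemma abpath_cat e A B p1 v p2 : abpath e A B (p1 ++ v :: p2) =
  abpath e A [set v] (rcons p1 v) && abpath e [set v] B (v :: p2).
Proof.
case: p1 => [|a p1] /=; first by rewrite set11 andbT.
by rewrite cat_path last_cat rcons_path last_rcons !set11 /= andbT -!andbA.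
Qed.

Lemma abpathS e A A' B B' p : A \subset A' -> B \subset B' -> abpath e A B p -> abpath e A' B' p.
Proof. by move=> /subsetP sA /subsetP sB; case: p => //= a p /and3P[/sA -> -> /sB ->]. Qed.

Lemma abpath_sub e e' A B p : subrel e e' -> abpath e A B p -> abpath e' A B p.
Proof. by move=> se; case: p => //= a p /and3P[-> /(sub_path se) -> ->]. Qed.

(** Cutting a path at its first vertex in [X]. *)
Lemma trim_end e A X p : abpath e A X p -> uniq p -> exists p1 s,
  [/\ abpath e A X (rcons p1 s), s \in X, {subset rcons p1 s <= p}, uniq (rcons p1 s)
    & forall v, v \in p1 -> v \notin X].
Proof.
move=> ap up; have hX : has (mem X) p.
  case: p ap {up} => //= a p /and3P[_ _ lX]; apply/orP.
  case/lastP: p lX => [|p b]; first by left.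
  by rewrite last_rcons => bX; right; rewrite has_rcons; apply/orP; left.
have [p1 [s [p2 [ep sX n1]]]] := first_split hX.
move: ap up; rewrite ep abpath_cat => /andP[a1 _]; rewrite -cat_rcons cat_uniq => /andP[u1 _].
exists p1, s; split=> //.
- by apply: abpathS a1 => //; rewrite sub1set.
- by move=> v; rewrite mem_cat => ->.
- by move=> v vp; apply: (hasPn n1).
Qed.

Lemma trim_start e Y B p : abpath e Y B p -> uniq p -> exists t p2,
  [/\ abpath e Y B (t :: p2), t \in Y, {subset t :: p2 <= p}, uniq (t :: p2)
    & forall v, v \in p2 -> v \notin Y].
Proof.
move=> ap up; have hY : has (mem Y) p by case: p ap {up} => //= a p /and3P[-> _ _].
have [p1 [t [p2 [ep tY n2]]]] := last_split hY.
move: ap up; rewrite ep abpath_cat => /andP[_ a2]; rewrite cat_uniq => /and3P[_ _ u2].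
exists t, p2; split=> //.
- by apply: abpathS a2 => //; rewrite sub1set.
- by move=> v; rewrite mem_cat orbC => ->.
- by move=> v vp; apply: (hasPn n2).
Qed.

Lemma inj_surj q (X : {set T}) (h : 'I_q -> T) : injective h -> (forall i, h i \in X) ->
  #|X| = q -> forall s, s \in X -> exists i, h i = s.
Proof.
move=> hi hX cX s sX; have : s \in [set h i | i : 'I_q].
  have -> : [set h i | i : 'I_q] = X; last by [].
  apply/eqP; rewrite eqEcard cX card_imset // card_ord leqnn andbT.
  by apply/subsetP => _ /imsetP[i _ ->].
by case/imsetP => i _ ->; exists i.
Qed.

(** Induction on the number of edges.  Deleting an edge [(x, y)] either keeps
    the hypothesis, or leaves a separator [S] with fewer than [q] elements.  Then
    [x |: S] and [y |: S] separate in the original graph and have exactly [q]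
    elements; by induction [q] disjoint paths lead to the first set and [q] from
    the second.  They are joined at [S] and through the edge [(x, y)]. *)
Theorem menger e A B q : (forall S, separates e A B S -> q <= #|S|) -> linked e A B q.
Proof.
move: {2}#|_| (leqnn #|[set x : T * T | e x.1 x.2]|) => N.
elim: N e A B => [|N IH] e A B szN sepq.
  have noe x y : e x y = false.
    apply/negP => exy; move: szN; rewrite leqn0 cards_eq0 => /eqP /setP /(_ (x, y)).
    by rewrite !inE exy.
  have qAB : q <= #|A :&: B|.
    apply: sepq => -[|a [|b p]] //=; last by rewrite noe andbF.
    by move=> /andP[aA aB]; rewrite inE aA aB.
  exists (fun i => [:: enum_val (widen_ord qAB i)]); split.
    move=> i; split=> //=.
    by have := enum_valP (widen_ord qAB i); rewrite inE => /andP[-> ->].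
  move=> i j v; rewrite !inE => /eqP -> /eqP /enum_val_inj [h]; exact: val_inj.
case: (set_0Vmem [set x : T * T | e x.1 x.2]) => [e0|[[x y]]].
  by apply: IH => //; rewrite e0 cards0.
rewrite inE /= => exy.
pose e' : rel T := [rel a b | e a b && ((a, b) != (x, y))].
have se : subrel e' e by move=> a b /andP[].
have szN' : #|[set x : T * T | e' x.1 x.2]| <= N.
  rewrite -ltnS; apply: leq_trans szN; apply: proper_card; apply/properP; split.
    by apply/subsetP => z; rewrite !inE; apply: se.
  by exists (x, y); rewrite inE /e' /= ?exy // eqxx andbF.
have up : forall A0 B0, linked e' A0 B0 q -> linked e A0 B0 q.
  move=> A0 B0 [f [h1 h2]]; exists f; split=> // i; have [h3 h4] := h1 i.
  by split=> //; apply: abpath_sub h3.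
case: (boolp.EM (forall S, separates e' A B S -> q <= #|S|)) => [h|].
  by apply: up; apply: IH.
case/boolp.existsNP => S /boolp.not_implyP[sepS /negP]; rewrite -ltnNge => ltS.
(* a walk avoiding x as a source, or y as a target, is a walk of e' *)
have pX a p : path e a p -> x \notin belast a p -> path e' a p.
  elim: p a => //= b p IHp a /andP[ab pp]; rewrite inE negb_or => /andP[xa xp].
  by rewrite IHp // andbT /e' /= ab /= xpair_eqE eq_sym (negbTE xa).
have pY a p : path e a p -> y \notin p -> path e' a p.
  elim: p a => //= b p IHp a /andP[ab pp]; rewrite inE negb_or => /andP[yb yp].
  by rewrite IHp // andbT /e' /= ab /= xpair_eqE [b == y]eq_sym (negbTE yb) andbF.
have endX p : abpath e A B p -> exists p1 s p2,
    [/\ p = p1 ++ s :: p2, s \in x |: S & abpath e' A [set s] (rcons p1 s)].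
  move=> ap; have hX : has (mem (x |: S)) p.
    case: (boolP (has (mem S) p)) => [/hasP[v vp vS]|nS].
      by apply/hasP; exists v => //=; rewrite inE (vS : v \in S) orbT.
    apply/hasP; exists x; last by rewrite /= setU11.
    apply: contraNT nS => xp; apply: sepS.
    case: p ap xp => //= a p /and3P[-> pp ->]; rewrite andbT /= => xp; apply: pX => //.
    by apply: contra xp => /mem_belast.
  have [p1 [s [p2 [ep sX n1]]]] := first_split hX.
  exists p1, s, p2; split=> //; move: ap; rewrite ep abpath_cat => /andP[a1 _].
  have xp1 : x \notin p1 by apply: contra n1 => xp1; apply/hasP; exists x => //=; rewrite setU11.
  case: p1 a1 xp1 {ep n1} => //= a p1 /and3P[-> pp ->]; rewrite andbT inE negb_or => /andP[xa xp1].
  by apply: pX => //; rewrite belast_rcons inE negb_or xa.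
have startY p : abpath e A B p -> exists p1 s p2,
    [/\ p = p1 ++ s :: p2, s \in y |: S & abpath e' [set s] B (s :: p2)].
  move=> ap; have hY : has (mem (y |: S)) p.
    case: (boolP (has (mem S) p)) => [/hasP[v vp vS]|nS].
      by apply/hasP; exists v => //=; rewrite inE (vS : v \in S) orbT.
    apply/hasP; exists y; last by rewrite /= setU11.
    apply: contraNT nS => yp; apply: sepS.
    case: p ap yp => //= a p /and3P[-> pp ->]; rewrite andbT /= inE negb_or => /andP[_ yp].
    by apply: pY.
  have [p1 [s [p2 [ep sY n2]]]] := last_split hY.
  exists p1, s, p2; split=> //; move: ap; rewrite ep abpath_cat => /andP[_ /= /and3P[-> pp ->]].
  rewrite andbT /=; apply: pY => //.
  by apply: contra n2 => yp2; apply/hasP; exists y => //=; rewrite setU11.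
have cX : q <= #|x |: S|.
  apply: sepq => p /endX[p1 [s [p2 [-> sX _]]]]; apply/hasP; exists s => //.
  by rewrite mem_cat inE eqxx orbT.
have cY : q <= #|y |: S|.
  apply: sepq => p /startY[p1 [s [p2 [-> sY _]]]]; apply/hasP; exists s => //.
  by rewrite mem_cat inE eqxx orbT.
have [xS eX] : x \notin S /\ #|x |: S| = q.
  by move: cX ltS; rewrite cardsU1; case: (x \in S) => /=; move: #|S|; glia.
have [yS eY] : y \notin S /\ #|y |: S| = q.
  by move: cY ltS; rewrite cardsU1; case: (y \in S) => /=; move: #|S|; glia.
have [f1 [f1P f1D]] : linked e' A (x |: S) q.
  apply: IH => // R sepR; apply: sepq => p /endX[p1 [s [p2 [-> sX ap]]]].
  have /sepR : abpath e' A (x |: S) (rcons p1 s) by apply: abpathS ap => //; rewrite sub1set.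
  by rewrite -cat_rcons has_cat => ->.
have [f2 [f2P f2D]] : linked e' (y |: S) B q.
  apply: IH => // R sepR; apply: sepq => p /startY[p1 [s [p2 [-> sY ap]]]].
  have /sepR : abpath e' (y |: S) B (s :: p2) by apply: abpathS ap => //; rewrite sub1set.
  by rewrite has_cat => ->; rewrite orbT.
have /boolp.choice[g1 g1P] : forall i, exists g : seq T * T,
    [/\ abpath e' A (x |: S) (rcons g.1 g.2), g.2 \in x |: S,
        {subset rcons g.1 g.2 <= f1 i}, uniq (rcons g.1 g.2)
      & forall v, v \in g.1 -> v \notin x |: S].
  move=> i; have [h1 h2] := f1P i; have [p1 [s h]] := trim_end h1 h2.
  by exists (p1, s).
have /boolp.choice[g2 g2P] : forall i, exists g : T * seq T,
    [/\ abpath e' (y |: S) B (g.1 :: g.2), g.1 \in y |: S,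
        {subset g.1 :: g.2 <= f2 i}, uniq (g.1 :: g.2)
      & forall v, v \in g.2 -> v \notin y |: S].
  move=> i; have [h1 h2] := f2P i; have [t [p2 h]] := trim_start h1 h2.
  by exists (t, p2).
have D1 i j v : v \in rcons (g1 i).1 (g1 i).2 -> v \in rcons (g1 j).1 (g1 j).2 -> i = j.
  by have [_ _ s1 _ _] := g1P i; have [_ _ s2 _ _] := g1P j => /s1 h1 /s2; apply: f1D.
have D2 i j v : v \in (g2 i).1 :: (g2 i).2 -> v \in (g2 j).1 :: (g2 j).2 -> i = j.
  by have [_ _ s1 _ _] := g2P i; have [_ _ s2 _ _] := g2P j => /s1 h1 /s2; apply: f2D.
have inj2 : injective (fun i => (g2 i).1).
  by move=> i j h; apply: (D2 i j (g2 i).1); rewrite ?h inE eqxx.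
have sur2 := inj_surj inj2 (fun i => let: And5 _ h _ _ _ := g2P i in h) eY.
pose tau s := if s == x then y else s.
have tauP i : tau (g1 i).2 \in y |: S.
  have [_ h _ _ _] := g1P i; move: h; rewrite /tau !inE; case: eqP => [_|_ /=]; first by rewrite eqxx.
  by move=> ->; rewrite orbT.
have [m mP] := boolp.choice (fun i => sur2 _ (tauP i)).
(* a vertex common to a path of each system lies at both junctions *)
have common i j v : v \in rcons (g1 i).1 (g1 i).2 -> v \in (g2 j).1 :: (g2 j).2 ->
    [/\ v = (g1 i).2, v = (g2 j).1 & v \in S].
  have [a1 sX _ u1 n1] := g1P i; have [a2 tY _ u2 n2] := g2P j.
  move=> v1 v2; have SX z : z \in S -> z \in x |: S by rewrite inE orbC => ->.
  have SY z : z \in S -> z \in y |: S by rewrite inE orbC => ->.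
  have vS : v \in S; last first.
    split=> //.
      by move: v1; rewrite mem_rcons inE => /orP[/eqP //|/n1]; rewrite SX.
    by move: v2; rewrite inE => /orP[/eqP //|/n2]; rewrite SY.
  have [r1 [r2 e1]] : exists r1 r2, rcons (g1 i).1 (g1 i).2 = r1 ++ v :: r2.
    by case/splitPr: v1 => r1 r2; exists r1, r2.
  have [r3 [r4 e2]] : exists r3 r4, (g2 j).1 :: (g2 j).2 = r3 ++ v :: r4.
    by case/splitPr: v2 => r3 r4; exists r3, r4.
  move: a1 a2; rewrite e1 e2 !abpath_cat => /andP[b1 _] /andP[_ b2].
  have /sepS : abpath e' A B (r1 ++ v :: r4) by rewrite abpath_cat b1 b2.
  case/hasP=> z; rewrite mem_cat inE => /or3P[zr|/eqP -> //|zr] zS.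
    have: z \notin x |: S; last by rewrite SX.
    apply: n1; move/(congr1 (fun s => belast v s)): e1.
    have -> : r1 ++ v :: r2 = rcons (r1 ++ belast v r2) (last v r2) by rewrite lastI rcons_cat.
    by rewrite !belast_rcons => -[->]; rewrite mem_cat zr.
  have: z \notin y |: S; last by rewrite SY.
  by apply: n2; case: r3 e2 => [|b r3] [_ ->] //; rewrite mem_cat inE zr !orbT.
pose tl i := if (g1 i).2 == x then y :: (g2 (m i)).2 else (g2 (m i)).2.
have tl_sub i v : v \in tl i -> v \in (g2 (m i)).1 :: (g2 (m i)).2.
  rewrite /tl; have := mP i; rewrite /tau; case: eqP => [_ -> //|_ _].
  by rewrite inE => ->; rewrite orbT.
have tl_off i j v : v \in rcons (g1 i).1 (g1 i).2 -> v \in tl j -> False.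
  move=> v1 v2; have [h1 h2 h3] := common _ _ _ v1 (tl_sub _ _ v2).
  have [_ _ _ u2 _] := g2P (m j); have := mP j; move: v2; rewrite /tl /tau -h2.
  case: eqP => [_ _ vy|_ v2 _]; first by move: yS; rewrite -vy h3.
  by move: u2; rewrite -h2 /= v2.
exists (fun i => rcons (g1 i).1 (g1 i).2 ++ tl i); split.
  move=> i; have [a1 sX _ u1 n1] := g1P i; have [a2 tY _ u2 n2] := g2P (m i).
  have e12 := mP i.
  have [ut at_] : uniq (tl i) /\ abpath e [set (g1 i).2] B ((g1 i).2 :: tl i).
    move: e12 u2 a2; rewrite /tl /tau; case: eqP => [->|_] -> u2.
      case/and3P=> _ pp lB; split=> //=; rewrite set11 exy lB andbT /=.
      exact: sub_path pp.
    case/and3P=> _ pp lB; split; first by case/andP: u2.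
    by rewrite /= set11 lB andbT /=; apply: sub_path pp.
  split.
    rewrite cat_rcons abpath_cat at_ andbT.
    have := abpath_sub se a1; case: (g1 i).1 => [|a r] /=; first by case/andP=> -> _; rewrite set11.
    by case/and3P=> -> -> _; rewrite last_rcons set11.
  rewrite cat_uniq u1 ut andbT /=; apply/hasPn => v vt; apply/negP => v1.
  exact: tl_off v1 vt.
move=> i j v; rewrite !mem_cat => /orP[v1|v1] /orP[v2|v2].
- exact: D1 v1 v2.
- by case: (tl_off _ _ _ v1 v2).
- by case: (tl_off _ _ _ v2 v1).
- have mij := D2 _ _ _ (tl_sub _ _ v1) (tl_sub _ _ v2).
  have tij : tau (g1 i).2 = tau (g1 j).2 by rewrite -!mP mij.
  have [_ si _ _ _] := g1P i; have [_ sj _ _ _] := g1P j.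
  have sij : (g1 i).2 = (g1 j).2.
    move: tij si sj; rewrite /tau !inE; case: eqP => [->|_]; case: eqP => [->|_] //=.
      by move=> <- _ h; rewrite h in yS.
    by move=> -> h; rewrite h in yS.
  by apply: (D1 i j (g1 i).2); rewrite ?sij mem_rcons inE eqxx.
Qed.
End Menger.

(** * Connectivity and averaging in vertex-transitive graphs *)

Lemma card_orbit_amove (gT : finGroupType) (H : {group gT}) (T : finType)
    (to : {action gT &-> T}) x a :
  a \in H -> #|orbit to H x| * #|amove to H x (to x a)| = #|H|.
Proof.
move=> aH; rewrite amove_act ?subsetT // card_rcoset.
by rewrite card_orbit_in_stab ?subsetT.
Qed.

Section Transitive.
Variable G : sgraph.
Hypothesis vt : vertex_transitive G.
Notation A := (graph_aut G).

Lemma card_move (x y : G) : #|G| * #|[set s in A | s x == y]| = #|A|.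
Proof.
have orb : orbit 'P A x = [set: G] := atransP vt x (in_setT x).
have : y \in orbit 'P A x by rewrite orb inE.
case/orbitP => a aA axy.
have e := card_orbit_amove (H := graph_aut_group G) 'P x aA.
rewrite -cardsT -orb; apply: etrans e; congr (_ * _).
by apply: eq_card => s; rewrite !inE axy.
Qed.

(** Any vertex [y] is mapped to a given vertex [x] by the same proportion
    [1 / #|G|] of the automorphisms, so [#|X| * #|Y| / #|G|] is the mean of the
    cardinal of the intersection. *)
Lemma average_meet (X Y : {set G}) : exists2 s : {perm G}, s \in A &
  #|G| * #|X :&: [set s y | y in Y]| <= #|X| * #|Y|.
Proof.
have tot : \sum_(s in A) #|G| * #|X :&: [set s y | y in Y]| = #|A| * (#|X| * #|Y|).
  have cnt (s : {perm G}) : #|X :&: [set s y | y in Y]| = \sum_(x in X) \sum_(y in Y) (s y == x).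
    rewrite -sum1_card (eq_bigl (fun x => (x \in X) && (x \in [set s y | y in Y]))); last by move=> x; rewrite inE.
    rewrite big_mkcondr; apply: eq_bigr => x _.
    case: ifP => [/imsetP[y yY ->]|nx].
      rewrite (bigD1 y) //= eqxx big1 ?addn0 // => z /andP[_ zy].
      by rewrite (inj_eq perm_inj) (negbTE zy).
    rewrite big1 // => y yY; apply/eqP; rewrite eqb0; apply/negP => /eqP sy.
    by move: nx; rewrite -sy imset_f.
  rewrite -big_distrr /= (eq_bigr _ (fun s _ => cnt s)) exchange_big /=.
  under eq_bigr => x _ do rewrite exchange_big /=.
  rewrite big_distrr /=.
  rewrite (eq_bigr (fun=> #|Y| * #|A|)); last first.
    move=> x xX; rewrite big_distrr /= -sum_nat_const; apply: eq_bigr => y yY.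
    rewrite -(card_move y x); congr (_ * _); rewrite -sum1dep_card big_mkcondr /=.
    by apply: eq_bigr => s _; case: (_ == _).
  by rewrite sum_nat_const mulnA mulnC.
apply: boolp.contrapT => no.
have ltA (s : {perm G}) : s \in A -> #|X| * #|Y| < #|G| * #|X :&: [set s y | y in Y]|.
  by move=> sA; rewrite ltnNge; apply/negP => h; apply: no; exists s.
have : #|A| * (#|X| * #|Y|).+1 <= \sum_(s in A) #|G| * #|X :&: [set s y | y in Y]|.
  by rewrite -sum_nat_const; apply: leq_sum.
have A0 : 0 < #|A| by apply: (cardG_gt0 [group of A]).
by rewrite tot leq_pmul2l // ltnn.
Qed.

Definition avoid (y : G) : rel G := [rel u v | [&& adj u v, u != y & v != y]].

Lemma avoid_sym y : symmetric (avoid y).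
Proof. by move=> u v; rewrite /avoid /= adj_sym [(u != y) && _]andbC. Qed.

Lemma adj_aut s u v : s \in A -> adj (s u) (s v) = adj u v :> bool.
Proof. by rewrite inE => /'forall_forallP /(_ u v) /eqP. Qed.

Lemma aut_transitive (x y : G) : exists2 s : {perm G}, s \in A & s x = y.
Proof.
have : y \in orbit 'P A x by rewrite (atransP vt x (in_setT x)) inE.
by case/orbitP => s sA <-; exists s.
Qed.

Hypothesis conn : graph_connected G.

(** Among the components of the graphs [G - y], take a largest one [K], obtained
    by deleting [y0].  If another vertex [v] were outside [K], then deleting [v]
    instead would leave a component containing [K] and [y0].  So [G - y0] is
    connected, and by transitivity so is every [G - y]. *)
Lemma no_cut_vertex (y a b : G) : a != y -> b != y -> connect (avoid y) a b.
Proof.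
pose Kc (w : G * G) := [set v | connect (avoid w.2) w.1 v].
move=> ay by_.
have [[x0 y0] /= xy0 maxK] := @arg_maxnP _ (a, y) (fun w : G * G => w.1 != w.2) (fun w => #|Kc w|) ay.
have all_in v : v != y0 -> connect (avoid y0) x0 v.
  move=> vy; apply/negPn/negP => nv.
  have Kz u : u \in Kc (x0, y0) -> u != v.
    by rewrite inE /=; apply: contraTneq => ->.
  have x0K : x0 \in Kc (x0, y0) by rewrite inE connect0.
  have tr u : u \in Kc (x0, y0) -> connect (avoid v) x0 u.
    rewrite inE /= => /connectP[p pp ->]; apply/connectP; exists p => //.
    have al : all (mem (Kc (x0, y0))) (x0 :: p).
      by apply/allP => w wp; rewrite /= inE; apply: path_connect wp.
    apply: sub_in_path al pp => u1 u2 /Kz h1 /Kz h2.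
    by rewrite /avoid /= h1 h2 => /andP[->].
  have /connectP[p pp lp] := conn x0 y0.
  have : has (pred1 y0) p.
    apply/hasP; exists y0; rewrite /= ?eqxx //.
    case: p pp lp => [_ /= e|u p _ e]; first by rewrite e eqxx in xy0.
    by rewrite e; exact: (mem_last u p).
  case/first_split => p1 [y1 [p2 [ep /= /eqP e1 n1]]]; subst y1.
  move: pp; rewrite ep cat_path /= => /and3P[pp1 ly _].
  have lK : last x0 p1 \in Kc (x0, y0).
    rewrite inE /=; apply/connectP; exists p1 => //.
    have xp : all (predC1 y0) (x0 :: p1).
      by rewrite /= xy0 /= all_predC.
    apply: (sub_in_path (P := predC1 y0)) xp pp1 => u1 u2.
    by rewrite !inE => h1 h2 h; rewrite /avoid /= h h1 h2.
  have yv : connect (avoid v) x0 y0.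
    apply: connect_trans (tr _ lK) (connect1 _).
    by rewrite /avoid /= ly Kz // eq_sym.
  have x0v : x0 != v := Kz _ x0K.
  have := maxK (x0, v) x0v; rewrite leqNgt => /negP; apply.
  apply: proper_card; apply/properP; split.
    by apply/subsetP => u /tr; rewrite inE.
  exists y0; first by rewrite inE.
  rewrite inE /=; apply/negP => /connectP[q qq]; case/lastP: q qq => [|q u] /=.
    by move=> _ e; rewrite -e eqxx in xy0.
  rewrite rcons_path last_rcons => /andP[_ h] e; move: h; rewrite -e /avoid /=.
  by rewrite eqxx !andbF.
have [s sA sy] := aut_transitive y y0.
have sn u : u != y -> s u != y0 by rewrite -sy (inj_eq perm_inj).
have cs : connect_sym (avoid y0) := sym_connect_sym (avoid_sym y0).
have : connect (avoid y0) (s a) (s b).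
  by apply: connect_trans (all_in _ (sn _ by_)); rewrite cs; apply: all_in; apply: sn.
case/connectP => p pp lp.
apply/connectP; exists (map s^-1%g p); last by rewrite -{1}[a](permK s) last_map -lp permK.
rewrite -{1}[a](permK s) path_map; apply: sub_path pp => u v.
rewrite /avoid /= => /and3P[uv h1 h2].
rewrite -(adj_aut (s^-1%g u) (s^-1%g v) sA) !permKV uv /=.
by rewrite -(inj_eq (@perm_inj _ s) (s^-1%g u)) -(inj_eq (@perm_inj _ s) (s^-1%g v)) !permKV sy h1 h2.
Qed.

(** Two neighbours of a vertex [y] are joined by a path avoiding [y]. *)
Lemma cycle_exists : 3 <= #|G| -> exists c : seq G, is_cycle c.
Proof.
move=> G3.
have /card_gt0P[y _] : 0 < #|G| by apply: leq_trans G3.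
have nbr : exists a, adj y a.
  have /card_gt0P[z] : 0 < #|[set~ y]| by rewrite cardsC1; move: G3; case: #|G| => [|[]].
  rewrite !inE => zy; have /connectP[[|a p] /=] := conn y z; first by move=> _ e; rewrite e eqxx in zy.
  by case/andP=> ya _ _; exists a.
case: nbr => a ya.
have ay : a != y by apply: contraTneq ya => ->; rewrite adj_irr.
have [b yb ba] : exists2 b, adj y b & b != a.
  have /card_gt0P[z] : 0 < #|~: [set y; a]|.
    by rewrite cardsCs setCK cards2 eq_sym ay; move: G3; move: #|G|; glia.
  rewrite !inE negb_or => /andP[zy za].
  have ya' : y != a by rewrite eq_sym.
  have /connectP[[|b p] /=] := no_cut_vertex ya' za; first by move=> _ e; rewrite e eqxx in zy.
  by case/andP=> /and3P[yb _ ba] _ _; exists b.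
have by_ : b != y by apply: contraTneq yb => ->; rewrite adj_irr.
have /connectP[p pp lp] := no_cut_vertex ay by_.
case/shortenP: pp lp => q qq uq _ lq.
have qy : y \notin a :: q.
  rewrite inE negb_or eq_sym ay; apply/negP => /splitPr sp; case: sp qq => q1 q2.
  by rewrite cat_path /= /avoid /= eqxx !andbF.
have q0 : 0 < size q by case: (q) lq => //= e; rewrite e eqxx in ba.
exists (y :: a :: q); split; last by case: (q) q0.
rewrite /ucycle /cycle /= rcons_path ya -lq adj_sym yb andbT.
rewrite -andbA; apply/and3P; split=> //; last by rewrite qy.
by apply: sub_path qq => u v /and3P[].
Qed.

Lemma map_aut_ucycle s c : s \in A -> ucycle (@adj G) c -> ucycle (@adj G) (map s c).
Proof.
move=> sA; rewrite /ucycle => /andP[cc uc]; rewrite (map_inj_uniq perm_inj) uc andbT.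
case: c cc {uc} => //= x c; rewrite -map_rcons path_map.
by apply: sub_path => u v h /=; rewrite adj_aut.
Qed.
End Transitive.

Definition longest (G : sgraph) (C : seq G) : Prop :=
  [/\ ucycle (@adj G) C, 3 <= size C & forall c, ucycle (@adj G) c -> size c <= size C].

Lemma longest_exists (G : sgraph) : (exists c : seq G, is_cycle c) -> exists C : seq G, longest C.
Proof.
case=> c0 [uc0 sc0].
pose P i := [exists c : i.-tuple G, path.cycle (@adj G) c && uniq c].
have Pc c : ucycle (@adj G) c -> P (size c).
  by move=> h; apply/existsP; exists (in_tuple c).
have ex : exists i, P i by exists (size c0); apply: Pc.
have ub i : P i -> i <= #|G|.
  by case/existsP => c /andP[_ /card_uniqP]; rewrite size_tuple => <-; apply: max_card.
case: (ex_maxnP ex ub) => i /existsP[c uc] mx.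
exists c; split=> //; rewrite size_tuple; last by move=> c' /Pc /mx.
exact: leq_trans sc0 (mx _ (Pc _ uc0)).
Qed.

(** * Links between two longest cycles *)

Section Cycles.
Variables (G : sgraph) (x0 : G).
Notation e := (@adj G).

Lemma ucycle_adj (C : seq G) : ucycle e C -> 0 < size C ->
  (forall i, i.+1 < size C -> e (nth x0 C i) (nth x0 C i.+1)) /\
  e (nth x0 C (size C).-1) (nth x0 C 0).
Proof.
case: C => // x C; rewrite /ucycle /= => /andP[pc _] _.
have h i : i < (size C).+1 -> e (nth x0 (x :: C) i) (nth x0 (rcons C x) i).
  move=> iC; have := (pathP x0 pc) i; rewrite size_rcons => /(_ iC).
  by case: i iC => //= i iC; rewrite ltnS in iC; rewrite {1}nth_rcons iC.
split=> [i iC|].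
  by have := h i (ltnW iC); rewrite nth_rcons; rewrite /= ltnS in iC; rewrite iC.
by have := h (size C) (leqnn _); rewrite nth_rcons ltnn eqxx.
Qed.

(** Otherwise replacing the part of [C] between its ends would give a longer cycle. *)
Lemma ear_bound (C : seq G) p q w : longest C -> p < q -> q < size C ->
  path e (nth x0 C p) (rcons w (nth x0 C q)) -> uniq w -> (forall v, v \in w -> v \notin C) ->
  size w < q - p.
Proof.
case=> uc sC mx pq qC pw uw off.
have C0 : 0 < size C by apply: leq_trans sC.
have [adjC adj0] := ucycle_adj uc C0.
have uC : uniq C by case/andP: uc.
have l1 : (size C).-1 < size C by case: (size C) C0.
have ql : q <= (size C).-1 by case: (size C) qC.
have pC : p < size C by apply: ltn_trans qC.
have [pu lu] := up_path adjC ql l1.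
have [pu2 lu2] := up_path adjC (leq0n p) pC.
pose S := rcons w (nth x0 C q) ++ up x0 C q (size C).-1 ++ nth x0 C 0 :: up x0 C 0 p.
have pS : path e (nth x0 C p) S.
  by rewrite cat_path pw last_rcons cat_path pu lu /= adj0.
have lS : last (nth x0 C p) S = nth x0 C p by rewrite !last_cat /= lu2.
have inC i : i < size C -> nth x0 C i \in C by apply: mem_nth.
have u1 : uniq (nth x0 C q :: up x0 C q (size C).-1).
  rewrite /= uniq_up // andbT; apply/negP => /(mem_up uC l1)[_].
  by rewrite index_uniq // ltnn.
have u2 : uniq (nth x0 C 0 :: up x0 C 0 p).
  rewrite /= uniq_up // andbT; apply/negP => /(mem_up uC pC)[_].
  by rewrite index_uniq.
have m1 v : v \in nth x0 C q :: up x0 C q (size C).-1 -> v \in C /\ q <= index v C.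
  rewrite inE => /orP[/eqP ->|/(mem_up uC l1)[vC /andP[/ltnW h _]] //].
  by rewrite inC // index_uniq.
have m2 v : v \in nth x0 C 0 :: up x0 C 0 p -> v \in C /\ index v C <= p.
  rewrite inE => /orP[/eqP ->|/(mem_up uC pC)[vC /andP[_ h]] //].
  by rewrite inC // index_uniq.
have uS : uniq S.
  rewrite /S cat_rcons -cat_cons cat_uniq uw andTb.
  apply/andP; split.
    apply/hasPn => v; rewrite mem_cat => vm; apply/negP => vw.
    have vC := off _ vw; move: vC.
    by case/orP: vm => [/m1[-> _]|/m2[-> _]].
  rewrite cat_uniq u1 u2 andbT andTb; apply/hasPn => v /m2[_ h]; apply/negP => /m1[_ h2].
  by have := leq_trans h2 h; rewrite leqNgt pq.
have sS : size S = size w + 1 + ((size C).-1 - q) + 1 + p.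
  by rewrite /S !size_cat size_rcons /= !size_up subn0; move: (size w) ((size C).-1 - q); glia.
have S0 : 0 < size S by rewrite sS addn1.
have [cyc [ucyc scyc]] := closed_ucycle pS lS uS S0.
have := mx _ ucyc; rewrite scyc sS.
by move: pq qC; move: (size C) (size w); glia.
Qed.

Lemma trim_both (A B : {set G}) p : abpath e A B p -> uniq p ->
  (exists v, v \in p /\ v \in A :&: B) \/
  (exists a m b, [/\ path e a (rcons m b), a \in A :\: B, b \in B :\: A,
     uniq (a :: rcons m b) /\ {subset a :: rcons m b <= p}
     & forall v, v \in m -> (v \notin A) && (v \notin B)]).
Proof.
move=> ap up; have [p1 [s [a1 sB sub1 u1 n1]]] := trim_end ap up.
have [t [p2 [a2 tA sub2 u2 n2]]] := trim_start a1 u1.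
case/lastP: p2 a2 sub2 u2 n2 => [|m b] a2 sub2 u2 n2.
  left; exists t; split; last by move: a2; rewrite /= inE => /andP[-> ->].
  by apply: sub1; apply: sub2; rewrite inE eqxx.
right; exists t, m, b; move: a2; rewrite /= last_rcons => /and3P[_ pp bB].
have inB v : v \in t :: rcons m b -> v \in B -> v = s.
  by move=> /sub2; rewrite mem_rcons inE => /orP[/eqP -> //|/n1 /negbTE ->].
have bs : b = s by apply: inB => //; rewrite inE mem_rcons inE eqxx orbT.
have bm : b \notin t :: m by move: u2; rewrite -rcons_cons rcons_uniq => /andP[].
split=> //.
- rewrite inE tA andbT; apply/negP => tB; move: bm; rewrite bs -(inB t) ?inE ?eqxx //.
- by rewrite inE bB andbT n2 // mem_rcons inE eqxx.
- by split=> // v /sub2 /sub1.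
- move=> v vm; rewrite n2 ?mem_rcons ?inE ?vm ?orbT //=; apply/negP => vB.
  by move: bm; rewrite bs -(inB v) // !inE ?mem_rcons ?inE vm ?orbT.
Qed.
End Cycles.

Section Links.
Variables (G : sgraph) (x0 : G).
Notation e := (@adj G).

(** Disjoint paths between [C] and [D], with inner vertices outside both cycles
    and ends outside their intersection.  The ends are recorded as positions,
    since the argument measures distances along the cycles. *)
Record links (C D : seq G) (I : finType) (pC pD : I -> nat) (inn : I -> seq G) : Prop := Links {
  link_pC : forall i, pC i < size C;
  link_pD : forall i, pD i < size D;
  link_path : forall i, path e (nth x0 C (pC i)) (rcons (inn i) (nth x0 D (pD i)));
  link_uniq : forall i, uniq (inn i);
  link_offC : forall i v, v \in inn i -> v \notin C;
  link_offD : forall i v, v \in inn i -> v \notin D;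
  link_disj : forall i j v, i != j -> v \in inn i -> v \notin inn j;
  link_endC : forall i, nth x0 C (pC i) \notin D;
  link_endD : forall i, nth x0 D (pD i) \notin C;
  link_injC : injective pC;
  link_injD : injective pD }.

Lemma links_sym C D (I : finType) (pC pD : I -> nat) inn :
  links C D pC pD inn -> links D C pD pC (fun i => rev (inn i)).
Proof.
case=> h1 h2 h3 h4 h5 h6 h7 h8 h9 h10 h11; split=> //.
- move=> i; have := path_rev (@adj_sym G) (h3 i).
  by rewrite last_rcons belast_rcons rev_cons.
- by move=> i; rewrite rev_uniq.
- by move=> i v; rewrite mem_rev; apply: h6.
- by move=> i v; rewrite mem_rev; apply: h5.
- by move=> i j v ij; rewrite !mem_rev; apply: h7.
Qed.

(** Numbers the segments into which [D] is cut by its vertices on [C]. *)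
Definition crossings (C D : seq G) a := count (mem C) (take a D).

Lemma crossings_mono C D a b : a <= b -> crossings C D a <= crossings C D b.
Proof. by move=> ab; rewrite /crossings -(subnKC ab) takeD count_cat leq_addr. Qed.

Lemma crossings_le C D a : crossings C D a <= count (mem C) D.
Proof. by rewrite -[D in count _ D](cat_take_drop a) count_cat leq_addr. Qed.

Lemma crossingsS C D a : a < size D -> nth x0 D a \in C -> crossings C D a < crossings C D a.+1.
Proof. by move=> aD aC; rewrite /crossings (take_nth x0 aD) -cats1 count_cat /= aC; lia. Qed.

Definition arc (D : seq G) a b :=
  if a <= b then nth x0 D a :: up x0 D a b else nth x0 D a :: down x0 D a b.

(** The path along link [x.1], then along [D], then back along link [x.2]. *)
Definition ear (D : seq G) (I : Type) (pD : I -> nat) (inn : I -> seq G) (x : I * I) :=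
  inn x.1 ++ arc D (pD x.1) (pD x.2) ++ rev (inn x.2).

Section Ears.
Variables (C D : seq G) (I : finType) (pC pD : I -> nat) (inn : I -> seq G).
Hypothesis lk : links C D pC pD inn.
Hypothesis ucD : ucycle e D.

Let uD : uniq D. Proof. by case/andP: ucD. Qed.

Lemma mem_arc a b v : a < size D -> b < size D -> v \in arc D a b ->
  v \in D /\ minn a b <= index v D <= maxn a b.
Proof.
move=> aD bD; rewrite /arc; case: (leqP a b) => ab; rewrite inE => /orP[/eqP ->|].
- by rewrite mem_nth // index_uniq // leqnn.
- by move=> /(mem_up uD bD)[-> /andP[/ltnW -> ->]].
- by rewrite mem_nth // index_uniq // leqnn ltnW.
- by move=> /(mem_down uD (ltnW ab) aD)[-> /andP[-> /ltnW ->]].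
Qed.

Lemma size_arc a b : size (arc D a b) = (a - b) + (b - a) + 1.
Proof.
rewrite /arc; case: (leqP a b) => ab /=.
  by rewrite size_up; move: ab; glia.
by rewrite size_down; move: ab; glia.
Qed.

Lemma uniq_arc a b : a < size D -> b < size D -> uniq (arc D a b).
Proof.
move=> aD bD; rewrite /arc; case: (leqP a b) => ab /=.
  rewrite uniq_up // andbT; apply/negP => /(mem_up uD bD)[_].
  by rewrite index_uniq // ltnn.
rewrite uniq_down // andbT; apply/negP => /(mem_down uD (ltnW ab) aD)[_].
by rewrite index_uniq // ltnn andbF.
Qed.

Lemma arc_path a b y : a < size D -> b < size D -> e y (nth x0 D a) ->
  path e y (arc D a b) /\ last y (arc D a b) = nth x0 D b.
Proof.
move=> aD bD ya; have D0 : 0 < size D by apply: leq_ltn_trans aD.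
have [adjD _] := ucycle_adj x0 ucD D0.
rewrite /arc; case: (leqP a b) => ab /=; rewrite ya.
  exact: (up_path adjD ab bD).
exact: (down_path (@adj_sym G) adjD (ltnW ab) aD).
Qed.

Lemma ear_path i j : path e (nth x0 C (pC i)) (rcons (ear D pD inn (i, j)) (nth x0 C (pC j))).
Proof.
have pi := link_path lk i; have pj := link_path (links_sym lk) j.
rewrite rcons_cat rcons_cat cat_path; rewrite rcons_path in pi; case/andP: pi => -> hi /=.
have [h1 h2] := arc_path (link_pD lk i) (link_pD lk j) hi.
by rewrite cat_path h1 h2 pj.
Qed.

Lemma mem_ear i j v : v \in ear D pD inn (i, j) ->
  [\/ v \in inn i, v \in inn j |
     v \in D /\ minn (pD i) (pD j) <= index v D <= maxn (pD i) (pD j)].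
Proof.
rewrite !mem_cat mem_rev => /or3P[h|h|h]; [by constructor 1| |by constructor 2].
by constructor 3; apply: mem_arc h; apply: link_pD lk _.
Qed.

Lemma ear_uniq i j : i != j -> uniq (ear D pD inn (i, j)).
Proof.
move=> ij; rewrite cat_uniq (link_uniq lk) cat_uniq uniq_arc ?(link_pD lk) // rev_uniq (link_uniq lk) andbT /=.
have offA v : v \in arc D (pD i) (pD j) -> v \in D.
  by case/mem_arc => //; apply: link_pD lk _.
apply/andP; split.
  apply/hasPn => v; rewrite mem_cat mem_rev => /orP[/offA vD|vj]; apply/negP => vi.
    by have := link_offD lk vi; rewrite vD.
  by have := link_disj lk ij vi; rewrite vj.
apply/hasPn => v; rewrite mem_rev => vj; apply/negP => /offA vD.
by have := link_offD lk vj; rewrite vD.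
Qed.

Lemma ear_size i j : (pD i - pD j) + (pD j - pD i) < size (ear D pD inn (i, j)).
Proof.
by rewrite !size_cat size_arc addn1 addSn addnS ltnS addnCA leq_addr.
Qed.

Let sD i := crossings C D (pD i).

Lemma sD_between i j x : sD i = sD j -> minn (pD i) (pD j) <= x <= maxn (pD i) (pD j) -> crossings C D x = sD i.
Proof.
wlog ij : i j / pD i <= pD j => [W|].
  case/orP: (leq_total (pD i) (pD j)) => ij h hx; first exact: (W i j).
  by rewrite h; apply: (W j i) => //; rewrite minnC maxnC.
move=> h; rewrite (minn_idPl ij) (maxn_idPr ij) => /andP[h1 h2].
by apply/eqP; rewrite eqn_leq (crossings_mono _ _ h1) andbT h crossings_mono.
Qed.

(** The part of [D] between two positions of the same segment has no vertex on
    [C], even at its ends, because links end outside the other cycle. *)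
Lemma ear_off i j v : sD i = sD j -> v \in ear D pD inn (i, j) -> v \notin C.
Proof.
move=> h /mem_ear[/(link_offC lk) //|/(link_offC lk) //|[vD hx]].
have hc := sD_between h hx.
set x := index v D in hx hc; have xD : x < size D by rewrite index_mem.
have vx : v = nth x0 D x by rewrite nth_index.
rewrite vx; apply/negP => xC; have lt := crossingsS xD xC.
have [m [hm xm]] : exists m, crossings C D (pD m) = sD i /\ x <= pD m.
  case/andP: hx => _; rewrite leq_max => /orP[] xm; [by exists i|by exists j].
move: xm; rewrite leq_eqVlt => /orP[/eqP xe|xm].
  by move: (link_endD lk m); rewrite -xe xC.
by have := crossings_mono C D xm; rewrite hm leqNgt -hc lt.
Qed.

Lemma ears_disjoint i j i' j' v : sD i = sD j -> sD i' = sD j' -> sD i != sD i' ->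
  v \in ear D pD inn (i, j) -> v \notin ear D pD inn (i', j').
Proof.
move=> h h' ne /mem_ear h1; apply/negP => /mem_ear h2.
have [n1 n2 n3 n4] : [/\ i != i', i != j', j != i' & j != j'].
  by split; apply: contraNneq ne => ee; rewrite ?h ?ee ?h' // -?ee -?h' -?h ?ee.
case: h1 => [a|a|[a b]]; case: h2 => [a'|a'|[a' b']].
- by have := link_disj lk n1 a; rewrite a'.
- by have := link_disj lk n2 a; rewrite a'.
- by have := link_offD lk a; rewrite a'.
- by have := link_disj lk n3 a; rewrite a'.
- by have := link_disj lk n4 a; rewrite a'.
- by have := link_offD lk a; rewrite a'.
- by have := link_offD lk a'; rewrite a.
- by have := link_offD lk a'; rewrite a.
- by move: ne; rewrite -(sD_between h b) -(sD_between h' b') eqxx.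
Qed.

(** The ear through two links is longer than the distance of their ends on [D],
    and [ear_bound] applies to it. *)
Lemma link_gap i j : longest C -> i != j -> sD i = sD j ->
  (pD i - pD j) + (pD j - pD i) + 1 < (pC i - pC j) + (pC j - pC i).
Proof.
move=> lC; wlog ij : i j / pC i < pC j => [W ne h|ne h].
  case: (ltngtP (pC i) (pC j)) => [lt|gt|/(link_injC lk) ee].
  - exact: W.
  - rewrite [_ - _ + _]addnC [X in _ < X]addnC; apply: W => //; by rewrite eq_sym.
  - by rewrite ee eqxx in ne.
have := ear_bound lC ij (link_pC lk j) (ear_path i j) (ear_uniq ne) (fun v => ear_off h).
have := ear_size i j.
by move: (size (ear _ _ _ _)) (_ - _ + _); move: ij; move: (pC i) (pC j); glia.
Qed.
End Ears.

(** By [link_gap] in both directions, each of the two distances between the ends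
    would be smaller than the other. *)
Lemma segments_inj C D (I : finType) (pC pD : I -> nat) inn i j :
  links C D pC pD inn -> longest C -> longest D ->
  crossings D C (pC i) = crossings D C (pC j) -> crossings C D (pD i) = crossings C D (pD j) -> i = j.
Proof.
move=> lk lC lD hC hD; apply/eqP; apply/negPn/negP => ij.
have [ucC _ _] := lC; have [ucD _ _] := lD.
have := link_gap lk ucD lC ij hD; have := link_gap (links_sym lk) ucC lD ij hC.
by move: (_ - _ + _) (_ - _ + _); glia.
Qed.
End Links.

Lemma uniq_map_inj (T1 T2 : eqType) (f : T1 -> T2) s x y :
  uniq [seq f i | i <- s] -> x \in s -> y \in s -> f x = f y -> x = y.
Proof.
elim: s => //= a s IH /andP[na us]; rewrite !inE.
move=> /orP[/eqP ->|xs] /orP[/eqP ->|ys] // fxy; last exact: IH.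
  by move: na; rewrite fxy map_f.
by move: na; rewrite -fxy map_f.
Qed.

Section Main.
Variables (G : sgraph) (x0 : G).
Notation e := (@adj G).

(** The disjoint paths that meet the intersection of the two cycles are at most
    as many as the common vertices; the others are trimmed to links. *)
Lemma links_exist (C D : seq G) q : uniq C -> uniq D ->
  linked e [set v in C] [set v in D] q ->
  exists (I : finType) (pC pD : I -> nat) (inn : I -> seq G),
    links x0 C D pC pD inn /\ q <= #|I| + count (mem D) C.
Proof.
move=> uC uD [f [fP fD]].
have /boolp.choice[g gP] : forall i, exists g : bool * (G * seq G * G),
    if g.1 then g.2.2 \in f i /\ g.2.2 \in [set v in C] :&: [set v in D] else
    [/\ path e g.2.1.1 (rcons g.2.1.2 g.2.2),
       g.2.1.1 \in [set v in C] :\: [set v in D], g.2.2 \in [set v in D] :\: [set v in C],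
       uniq (g.2.1.1 :: rcons g.2.1.2 g.2.2) /\ {subset g.2.1.1 :: rcons g.2.1.2 g.2.2 <= f i}
     & forall v, v \in g.2.1.2 -> (v \notin [set v in C]) && (v \notin [set v in D])].
  move=> i; have [h1 h2] := fP i; case: (trim_both h1 h2) => [[v [v1 v2]]|[a [m [b h]]]].
    by exists (true, (v, [::], v)).
  by exists (false, (a, m, b)).
pose I : finType := {i : 'I_q | ~~ (g i).1}.
pose a (i : I) := (g (val i)).2.1.1; pose m (i : I) := (g (val i)).2.1.2; pose b (i : I) := (g (val i)).2.2.
have aP (i : I) : [/\ path e (a i) (rcons (m i) (b i)), (a i \in C) && (a i \notin D),
    (b i \in D) && (b i \notin C), uniq (a i :: rcons (m i) (b i)) /\ {subset a i :: rcons (m i) (b i) <= f (val i)}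
     & forall v, v \in m i -> (v \notin C) && (v \notin D)].
  have := gP (val i); rewrite (negbTE (valP i)) => -[h1 h2 h3 h4 h5]; split=> //.
  - by move: h2; rewrite !inE andbC.
  - by move: h3; rewrite !inE andbC.
  - by move=> v /h5; rewrite !inE.
have fI (i j : I) v : v \in a i :: rcons (m i) (b i) -> v \in a j :: rcons (m j) (b j) -> i = j.
  have [_ _ _ [_ s1] _] := aP i; have [_ _ _ [_ s2] _] := aP j.
  by move=> /s1 h1 /s2 h2; apply: val_inj; apply: fD h1 h2.
exists I, (fun i => index (a i) C), (fun i => index (b i) D), m; split.
  have ea i : nth x0 C (index (a i) C) = a i.
    by have [_ /andP[h _] _ _ _] := aP i; rewrite nth_index.
  have eb i : nth x0 D (index (b i) D) = b i.
    by have [_ _ /andP[h _] _ _] := aP i; rewrite nth_index.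
  split=> [i|i|i|i|i v|i v|i j v ij|i|i|i j ij|i j ij].
  - by have [_ /andP[h _] _ _ _] := aP i; rewrite index_mem.
  - by have [_ _ /andP[h _] _ _] := aP i; rewrite index_mem.
  - by rewrite ea eb; have [] := aP i.
  - by have [_ _ _ [+ _] _] := aP i; rewrite /= rcons_uniq => /and3P[_ _].
  - by have [_ _ _ _ h] := aP i => /h /andP[].
  - by have [_ _ _ _ h] := aP i => /h /andP[].
  - move=> vi; apply/negP => vj; move/eqP: ij; apply; apply: (fI i j v).
      by rewrite inE mem_rcons inE vi !orbT.
    by rewrite inE mem_rcons inE vj !orbT.
  - by rewrite ea; have [_ /andP[]] := aP i.
  - by rewrite eb; have [_ _ /andP[]] := aP i.
  - apply: (fI i j (a i)); first by rewrite inE eqxx.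
    by rewrite -[X in X \in _]ea ij ea inE eqxx.
  - apply: (fI i j (b i)); first by rewrite inE mem_rcons inE eqxx orbT.
    by rewrite -[X in X \in _]eb ij eb inE mem_rcons inE eqxx orbT.
pose B := [set i | (g i).1].
have -> : q = #|I| + #|B|.
  rewrite card_sig -[LHS]card_ord -(cardsC B) addnC; congr (_ + _).
  by rewrite -[RHS]cardsE; apply: eq_card => i; rewrite !inE.
rewrite leq_add2l -size_filter.
rewrite -(card_in_imset (f := fun i => (g i).2.2)).
  apply: leq_trans (card_size _); apply/subset_leq_card/subsetP => v /imsetP[i iB ->].
  by have := gP i; move: iB; rewrite inE => -> [_]; rewrite mem_filter !inE andbC.
move=> i j; rewrite !inE => hi hj hij.
have := gP i; have := gP j; rewrite hi hj => -[h1 _] [h2 _].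
by apply: (fD _ _ _ h2); rewrite hij.
Qed.

Lemma no_chain (C D : seq G) (I : finType) (pC pD : I -> nat) inn k :
  links x0 C D pC pD inn -> longest C -> longest D ->
  ~ chain_found pC pD (fun i => crossings C D (pD i)) k.
Proof.
move=> lk lC lD [J [iota [s [row [col [z [v [u [a [b [a' [b' /=]]]]]]]]]]]].
case=> ii colE [rp gp] [bg bg'] [uc left_of].
have [ucC sC mxC] := lC; have [ucD _ _] := lD.
have C0 : 0 < size C by apply: leq_trans sC.
have [adjC adj0] := ucycle_adj x0 ucC C0.
have uC : uniq C by case/andP: ucC.
pose chain := (a ++ b) ++ (a' ++ b').
pose w (x : J * J) := ear x0 D pD inn (iota x.1, iota x.2).
have LP x : x \in chain -> col x.1 = col x.2 /\ row x.1 < row x.2.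
  have wP f p : walk row col (pC \o iota) f p -> x \in p -> col x.1 = col x.2 /\ row x.1 < row x.2.
    elim: p f => //= y p IH f /and5P[_ _ /eqP h1 h2 wp]; rewrite inE => /orP[/eqP -> //|].
    exact: IH wp.
  have rP z1 v1 p : route row col (pC \o iota) z1 v1 p -> x \in p -> col x.1 = col x.2 /\ row x.1 < row x.2.
    case: p => //= y p /and5P[_ /eqP h1 h2 wp _]; rewrite inE => /orP[/eqP -> //|].
    exact: wP wp.
  case: bg bg' => [[r1 r2] _ _ _ _] [[r3 r4] _ _ _ _].
  by rewrite /chain !mem_cat => /orP[] /orP[]; [exact: rP r1|exact: rP r2|exact: rP r3|exact: rP r4].
have sE x : x \in chain -> crossings C D (pD (iota x.1)) = crossings C D (pD (iota x.2)).
  by move=> /LP[h _]; rewrite -!colE h.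
have ne x : x \in chain -> iota x.1 != iota x.2.
  by move=> /LP[_ h]; apply: contraTneq h => /ii ->; rewrite ltnn.
have h1 i : (pC \o iota) i < size C by apply: (link_pC lk).
have h2 : injective (pC \o iota) by move=> i j /(link_injC lk) /ii.
have h3 x : x \in chain -> path e (nth x0 C ((pC \o iota) x.1)) (rcons (w x) (nth x0 C ((pC \o iota) x.2))).
  by move=> _; apply: (ear_path lk ucD).
have h4 x : x \in chain -> uniq (w x) by move=> xc; apply: (ear_uniq lk ucD); apply: ne.
have h5 x t : x \in chain -> t \in w x -> t \notin C.
  by move=> xc; apply: (ear_off lk ucD); apply: sE.
have h6 x y t : x \in chain -> y \in chain -> x != y -> t \in w x -> t \notin w y.
  move=> xc yc xy; apply: (ears_disjoint lk ucD (sE _ xc) (sE _ yc)).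
  apply: contraNneq xy; rewrite -!colE => /val_inj cxy.
  by apply/eqP; apply: (uniq_map_inj uc).
have h7 x : x \in chain ->
    2 * s <= pD (iota x.1) - pD (iota x.2) + (pD (iota x.2) - pD (iota x.1)) -> 2 * s <= size (w x).
  by move=> _ h; apply: leq_trans h (ltnW _); apply: ear_size.
have al : all (mem chain) chain by apply/allP.
have [cyc [ucyc lcyc]] := two_bigons_cycle (@adj_sym G) uC adjC adj0 h1 rp h2 gp h3 h4 h5 h6 h7 bg bg' uc al left_of.
by have := mxC _ ucyc; rewrite leqNgt lcyc.
Qed.

(** One of the two cycles is such that, for at least half of the links, the group
    along it has the smaller span; [select] is applied with that cycle as the
    one to be rerouted. *)
Lemma few_links (C D : seq G) (I : finType) (pC pD : I -> nat) inn k g t r n :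
  links x0 C D pC pD inn -> longest C -> longest D ->
  count (mem D) C <= k -> count (mem C) D <= k -> size C <= n -> size D <= n ->
  0 < g -> #|I| %/ g + k + 1 < t ^ r ->
  #|I| < (trunc_log 2 n).+1.*2 *
    (r * (k.+1 * (18 * g) + (#|I| %/ g + k + 1) * (t + r * r.*2.+1))).+1.*2.
Proof.
move=> lk lC lD kC kD sC sD g0 tr; rewrite ltnNge; apply/negP => big.
have lk' := links_sym lk.
have bC i : pC i < n by apply: leq_trans (link_pC lk i) sC.
have bD i : pD i < n by apply: leq_trans (link_pD lk i) sD.
have mC i j : pC i <= pC j -> crossings D C (pC i) <= crossings D C (pC j) by apply: crossings_mono.
have mD i j : pD i <= pD j -> crossings C D (pD i) <= crossings C D (pD j) by apply: crossings_mono.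
have leC i : crossings D C (pC i) <= k by apply: leq_trans (crossings_le _ _ _) kC.
have leD i : crossings C D (pD i) <= k by apply: leq_trans (crossings_le _ _ _) kD.
have sinj i j : crossings D C (pC i) = crossings D C (pC j) -> crossings C D (pD i) = crossings C D (pD j) -> i = j.
  exact: segments_inj lk lC lD.
have half : (#|I| <= #|[set i | span pC g i <= span pD g i]|.*2) ||
            (#|I| <= #|[set i | span pD g i <= span pC g i]|.*2).
  have : #|I| <= #|[set i | span pC g i <= span pD g i]| + #|[set i | span pD g i <= span pC g i]|.
    rewrite -cardsUI; apply: leq_trans (leq_addr _ _); rewrite -cardsT.
    by apply/subset_leq_card/subsetP => i _; rewrite !inE leq_total.
  move: #|I| #|[set i | span pC g i <= span pD g i]| #|[set i | span pD g i <= span pC g i]|.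
  move=> a b c h; rewrite -!addnn; case: (leqP c b) => hh; apply/orP; [left|right].
    by apply: leq_trans h _; rewrite leq_add2l.
  by apply: leq_trans h _; rewrite leq_add2r ltnW.
case/orP: half => half.
- exact: (no_chain lk lC lD (select (link_injC lk) (link_injD lk) bC g0 mC leC leD sinj tr big half)).
- have sinj' i j : crossings C D (pD i) = crossings C D (pD j) -> crossings D C (pC i) = crossings D C (pC j) -> i = j.
    by move=> h1 h2; apply: sinj.
  exact: (no_chain lk' lD lC (select (link_injD lk) (link_injC lk) bD g0 mD leD leC sinj' tr big half)).
Qed.

Hypothesis vt : vertex_transitive G.
Hypothesis conn : graph_connected G.

(** Two disjoint longest cycles are joined by two disjoint paths, since there is
    no cut vertex.  Without common vertices each cycle is a single segment, and
    [segments_inj] allows only one link. *)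
Lemma longest_meet (C D : seq G) : longest C -> longest D -> exists2 v, v \in C & v \in D.
Proof.
move=> lC lD; have [ucC sC _] := lC; have [ucD sD _] := lD.
have uC : uniq C by case/andP: ucC.
have uD : uniq D by case/andP: ucD.
case: (boolP (has (mem C) D)) => [/hasP[v vD vC]|noCD]; first by exists v.
have [f fP] : linked e [set v in C] [set v in D] 2.
  apply: menger => S sepS; rewrite ltnNge; apply/negP => S1.
  have [s sP] : exists s : G, {subset S <= [set s]}.
    have [->|[s sS]] := set_0Vmem S; first by exists x0 => v; rewrite in_set0.
    exists s => v vS; move: S1; rewrite (cardsD1 s) sS ltnS leqn0 cards_eq0 => /eqP e0.
    rewrite inE; apply/negPn/negP => vs.
    by have : v \in S :\ s; [rewrite in_setD1 vs vS|rewrite e0 in_set0].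
  have pick (B : seq G) : uniq B -> 2 < size B -> exists2 v, v \in B & v != s.
    move=> uB sB; case: B uB sB => [//|b [//|b' B]] /= /and3P[bb _ _] _.
    case: (eqVneq b s) bb => [-> bb|bs _]; last by exists b; rewrite // inE eqxx.
    by exists b'; rewrite ?inE ?eqxx ?orbT //; apply: contraNneq bb => ->; rewrite inE eqxx.
  have [a aC as_] := pick C uC sC; have [b bD bs] := pick D uD sD.
  have /connectP[p pp lp] := no_cut_vertex vt conn as_ bs.
  have /sepS /hasP[v vp /sP] : abpath e [set v in C] [set v in D] (a :: p).
    rewrite /= !inE aC -lp bD andbT /=.
    by apply: sub_path pp => u v /and3P[].
  rewrite inE => /eqP vs; subst v; move: vp; rewrite inE => /orP[/eqP sa|sp].
    by rewrite sa eqxx in as_.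
  move: pp; case/splitPr: sp => p1 p2; rewrite cat_path /= /avoid /=.
  by rewrite eqxx !andbF.
have [I [pC [pD [inn [lk]]]]] := links_exist uC uD (ex_intro _ f fP).
have c0 : count (mem D) C = 0.
  apply/eqP; rewrite -leqn0 leqNgt -has_count; apply: contra noCD.
  by case/hasP => v vC vD; apply/hasP; exists v.
have c0' : count (mem C) D = 0 by apply/eqP; rewrite -leqn0 leqNgt -has_count.
rewrite c0 addn0 => /card_gt1P[i [j [_ _ ij]]].
have cntC a : crossings D C a = 0 by apply/eqP; rewrite -leqn0 -c0 crossings_le.
have cntD a : crossings C D a = 0 by apply/eqP; rewrite -leqn0 -c0' crossings_le.
have ee : i = j by apply: (segments_inj lk lC lD); rewrite ?cntC ?cntD.
by rewrite ee eqxx in ij.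
Qed.

(** Every image [E] of [C] under an automorphism meets [C] and [D], and so
    contains a path from [C] to [D], which meets [S].  The average number of
    common vertices of [S] and such an image is therefore at least one. *)
Lemma card_separator (C D : seq G) (S : {set G}) : longest C -> longest D ->
  separates e [set v in C] [set v in D] S -> #|G| <= #|S| * size C.
Proof.
move=> lC lD sepS; have [ucC sC mxC] := lC.
have [s sA hs] := average_meet vt S [set v in C].
have uC : uniq C by case/andP: ucC.
have cC : #|[set v in C]| = size C by rewrite cardsE; apply/card_uniqP.
rewrite cC in hs; apply: leq_trans hs.
rewrite leq_pmulr // card_gt0; apply/set0Pn.
pose E := map s C.
have lE : longest E by split; rewrite ?size_map //; apply: map_aut_ucycle.
have [a aC aE] := longest_meet lC lE; have [b bD bE] := longest_meet lD lE.
have [ucE _ _] := lE.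
have [p [pp lp pE]] : exists p, [/\ path e a p, last a p = b & {subset a :: p <= E}].
  have [i E' rE] := rot_to aE.
  have pE' : path e a E'.
    have := ucE; rewrite /ucycle -(rot_cycle i) rE /= rcons_path => /andP[/andP[]] //.
  have mE v : v \in a :: E' -> v \in E by rewrite -rE mem_rot.
  have : b \in a :: E' by rewrite -rE mem_rot.
  rewrite inE => /orP[/eqP ->|bE']; first by exists [::]; split=> // v; rewrite mem_seq1 => /eqP ->.
  case/path.splitP: bE' pE' mE => p1 p2; rewrite cat_path => /andP[pp _] mE.
  exists (rcons p1 b); split=> //; first by rewrite last_rcons.
  by move=> v vp; apply: mE; move: vp; rewrite !inE mem_cat => /orP[->|->] //; rewrite orbT.
have /sepS /hasP[v vp vS] : abpath e [set v in C] [set v in D] (a :: p).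
  by rewrite /= !inE aC pp lp bD.
exists v; rewrite inE (vS : v \in S) /=; have /mapP[u uC' ->] := pE _ vp.
by apply: imset_f; rewrite inE.
Qed.

(** The value of [g] makes the term with [m %/ g] at most [m / 2], which is then
    absorbed by the left-hand side. *)
Lemma links_arith m k L r T (g := 8 * L * r * T) : 0 < L -> 0 < r -> 0 < T ->
  m < L.*2 * (r * (k.+1 * (18 * g) + (m %/ g + k + 1) * T)).+1.*2 ->
  m <= 1280 * L ^ 2 * r ^ 2 * T * k.+1.
Proof.
move=> L0 r0 T0; have := leq_trunc_div m g; rewrite /g; move: (_ %/ _) => d hd hm.
have h1 : 0 < r * (8 * L * r * T) * k.+1 by rewrite !muln_gt0 r0 L0 T0.
have h2 : r * T * k.+1 <= r * (8 * L * r * T) * k.+1.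
  rewrite leq_mul2r leq_mul2l; apply/orP; right; apply/orP; right.
  by rewrite leq_pmull // !muln_gt0 L0 r0.
have h3 : L * (r * T * k.+1 + 1) <= L * (2 * (r * (8 * L * r * T) * k.+1)).
  by rewrite leq_mul2l; apply/orP; right; move: h1 h2; glia.
have h4 : m < 4 * (L * r * T * d) + 72 * (L * (r * (8 * L * r * T) * k.+1))
              + 4 * (L * (r * T * k.+1 + 1)).
  by apply: leq_trans hm _; rewrite -!muln2; apply: eq_leq; nia.
have h5 : 8 * (L * r * T * d) <= m by apply: leq_trans hd; apply: eq_leq; nia.
have -> : 1280 * L ^ 2 * r ^ 2 * T * k.+1 = 160 * (L * (r * (8 * L * r * T) * k.+1)) by nia.
by move: h3 h4 h5; clear; lia.
Qed.

Lemma order_arith a b X k l n m q : a < b -> 0 < X -> m <= a * X * k.+1 -> q <= m + k ->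
  n <= l * q.+1 -> n * k <= l ^ 2 -> n ^ 2 <= b * X * (l ^ 3 + l * n).
Proof.
move=> ab X0 hm hq hn nk.
have h1 : q.+1 <= a * X * k.+1 + k.+1.
  by rewrite addnS ltnS; apply: leq_trans hq _; rewrite leq_add2r.
have hq' : q.+1 <= b * X * k.+1.
  apply: leq_trans h1 _; rewrite -mulSnr leq_mul2r /=.
  by apply: leq_trans (_ : a.+1 * X <= _); rewrite ?leq_mul2r ?ab ?orbT // mulSnr -addn1 leq_add2l.
have hn' : n <= b * X * (l * k.+1).
  by apply: leq_trans hn _; rewrite mulnCA leq_mul2l hq' orbT.
apply: leq_trans (_ : n * (b * X * (l * k.+1)) <= _).
  by rewrite -mulnn leq_mul2l hn' orbT.
rewrite mulnCA leq_mul2l; apply/orP; right.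
by rewrite mulnCA mulnS expnS -mulnDr leq_mul2l addnC leq_add2r nk orbT.
Qed.

(** The conclusion is [n ^ 2 <= n ^ o(1) * (l ^ 3 + l * n)] when [r] is a large
    constant and [t] is of order [n ^ (1 / r)]. *)
Theorem circumference_bound r t (C : seq G) : longest C -> 0 < r -> (#|G| * 2 + 2) <= t ^ r ->
  #|G| ^ 2 <= 10 ^ 4 * r ^ 6 * t ^ 3 * (size C ^ 3 + size C * #|G|).
Proof.
move=> lC r0 tr; have [ucC sC mxC] := lC.
have uC : uniq C by case/andP: ucC.
set n := #|G| in tr *; set l := size C in sC *.
have ln : l <= n by rewrite /l -(card_uniqP uC) max_card.
have [s sA hs] := average_meet vt [set v in C] [set v in C].
pose D := map s C.
have lD : longest D by split; rewrite ?size_map //; apply: map_aut_ucycle.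
have [ucD _ _] := lD; have uD : uniq D by case/andP: ucD.
pose k := count (mem D) C.
have kE : k = #|[set v in C] :&: [set s y | y in [set v in C]]|.
  rewrite /k -size_filter -(card_uniqP (filter_uniq _ uC)); apply: eq_card => v.
  rewrite !inE mem_filter andbC; congr (_ && _).
  apply/mapP/imsetP => [[y yC ->]|[y yC ->]]; exists y => //; first by rewrite inE.
  by rewrite inE in yC.
have kD : count (mem C) D = k.
  rewrite /k -!size_filter -(card_uniqP (filter_uniq _ uC)) -(card_uniqP (filter_uniq _ uD)).
  by apply: eq_card => v; rewrite !mem_filter andbC.
have nk : n * k <= l ^ 2.
  have cC : #|[set v in C]| = l by rewrite cardsE; apply/card_uniqP.
  by rewrite kE; apply: leq_trans hs _; rewrite cC.
have kl : k <= l by rewrite /k /l count_size.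
pose q := n %/ l.
have l0 : 0 < l by apply: leq_trans sC.
have lnk : linked e [set v in C] [set v in D] q.
  apply: menger => S sepS; have h := card_separator lC lD sepS.
  by rewrite -(leq_pmul2r l0); apply: leq_trans (leq_trunc_div n l) h.
have [I [pC [pD [inn [lk hI]]]]] := links_exist uC uD lnk.
have Il : #|I| <= l.
  have h i : pC i < l := link_pC lk i.
  rewrite -[l]card_ord -(card_imset _ (f := fun i => Ordinal (h i))) ?max_card //.
  by move=> i j [] /(link_injC lk).
have t1 : 1 < t.
  rewrite ltnNge; apply/negP => t1; have : t ^ r <= 1 by rewrite -(exp1n r) leq_exp2r.
  by move/(leq_trans tr); rewrite addn2.
(* [Lg] counts the dyadic classes and [T] the choices at a step of a walk; [g] *)
(* is chosen so large that at most half of the links is lost row by row. *)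
pose Lg := (trunc_log 2 n).+1; pose T := t + r * r.*2.+1; pose g := 8 * Lg * r * T.
have n0 : 0 < n by apply: leq_trans ln.
have LgB : Lg <= r * t.
  have h1 : 2 ^ trunc_log 2 n <= n by apply: trunc_logP.
  have h2 : t ^ r <= 2 ^ (r * t) by rewrite mulnC expnM leq_exp2r // ltnW // ltn_expl.
  rewrite -(ltn_exp2l _ _ (ltnSn 1)); apply: leq_ltn_trans h1 _.
  apply: leq_trans h2; apply: leq_trans tr.
  by rewrite addn2 !ltnS (leq_trans (leq_pmulr n (ltn0Sn 1))).
have TB : T <= 4 * r ^ 2 * t.
  by rewrite /T; clear -r0 t1; nia.
have T0 : 0 < T by rewrite addn_gt0 (ltnW t1).
have g0 : 0 < g by rewrite !muln_gt0 r0 T0.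
have tr' : #|I| %/ g + k + 1 < t ^ r.
  apply: leq_trans tr; rewrite addn1 addn2 !ltnS muln2 -addnn leq_add //.
    by apply: leq_trans ln; apply: leq_trans (leq_div _ _) Il.
  exact: leq_trans kl ln.
have := few_links lk lC lD (leqnn k) (eq_leq kD) ln _ g0 tr'.
rewrite size_map => /(_ ln); rewrite -/Lg -/T => hm.
have hm2 : #|I| <= 1280 * 4 * (r ^ 6 * t ^ 3) * k.+1.
  apply: leq_trans (_ : 1280 * Lg ^ 2 * r ^ 2 * T * k.+1 <= _).
    exact: links_arith T0 hm.
  rewrite leq_mul2r; apply/orP; right.
  have E a b : a * b * (r ^ 6 * t ^ 3) = a * (r * t) ^ 2 * r ^ 2 * (b * r ^ 2 * t) by ring.
  by rewrite E; apply: leq_mul => //; rewrite leq_mul2r leq_mul2l leq_exp2r // LgB /= orbT.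
rewrite -(mulnA (10 ^ 4)); apply: order_arith hm2 hI _ nk => //.
  by rewrite muln_gt0 !expn_gt0 r0 (ltnW t1).
by rewrite mulnC; apply: ltnW (ltn_ceil n l0).
Qed.
End Main.

(** * Asymptotics *)

Import Order.TTheory GRing.Theory Num.Theory.
Local Open Scope ring_scope.

(** The number [u.+1] is the least admissible basis in [circumference_bound];
    minimality bounds [u ^ r] from above. *)
Lemma near_root (n r : nat) : (0 < r)%N -> (0 < n)%N ->
  exists u : nat, (n * 2 + 2 <= u.+1 ^ r)%N /\ (u ^ r <= 4 * n)%N /\ (0 < u)%N.
Proof.
move=> r0 n0.
have ex : exists t, (n * 2 + 2 <= t ^ r)%N.
  exists (n * 2 + 2)%N; rewrite -{1}(expn1 (n * 2 + 2)) leq_pexp2l //.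
  by rewrite addn2.
case: (ex_minnP ex) => [[|t]] tP tmin; first by move: tP; rewrite exp0n // addn2.
exists t; split=> //; split.
  have : ~~ (n * 2 + 2 <= t ^ r)%N by apply/negP => /tmin; rewrite ltnn.
  by rewrite -ltnNge; lia.
by case: t tP {tmin} => // ; rewrite exp1n addn2.
Qed.

Section Asymptotics.
Variable R : realType.

Lemma root_bound (u n r : nat) : (0 < r)%N -> (u ^ r <= 4 * n)%N ->
  u%:R <= 4 * n%:R `^ (r%:R^-1) :> R.
Proof.
move=> r0 h.
have r0' : 0 < r%:R :> R by rewrite ltr0n.
have -> : u%:R = (u ^ r)%:R `^ r%:R^-1 :> R.
  by rewrite natrX -powR_mulrn // -powRrM mulfV ?gt_eqF // powRr1.
apply: (le_trans (y := (4 * n)%:R `^ r%:R^-1)).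
  by apply: ge0_ler_powR; rewrite ?invr_ge0 ?nnegrE ?ler_nat ?ler0n.
rewrite natrM powRM ?ler0n // ler_wpM2r ?powR_ge0 //.
by apply: ler1_powR; [lra | rewrite invf_le1 // ler1n].
Qed.

(** If the conclusion failed, the inequality would give
    [n ^ 2 <= K * n ^ (2 - 2 * e)] with a constant [K], because [3 / r <= e] and
    [e <= 1 / 6]; this bounds [n]. *)
Lemma eventual_lower_bound (e : R) (r : nat) : 0 < e -> e <= 6^-1 -> (0 < r)%N -> 3 <= e * r%:R ->
  exists n0 : nat, forall n u l : nat, (n0 <= n)%N -> (0 < n)%N -> (0 < u)%N ->
   (u ^ r <= 4 * n)%N -> 
   (n ^ 2 <= 10 ^ 4 * r ^ 6 * u.+1 ^ 3 * (l ^ 3 + l * n))%N ->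
   n%:R `^ (2%:R / 3%:R - e) <= l%:R.
Proof.
move=> e0 e6 r0 er.
pose K : R := 10 ^+ 4 * r%:R ^+ 6 * 512 * 2.
exists (Num.trunc (K `^ (2 * e)^-1)).+1 => n u l hn n0 u0 hu hl.
rewrite leNgt; apply/negP => lt.
have N0 : 0 < n%:R :> R by rewrite ltr0n.
have N1 : 1 <= n%:R :> R by rewrite ler1n.
have r0' : 0 < r%:R :> R by rewrite ltr0n.
have K0 : 0 <= K by rewrite /K !mulr_ge0 ?exprn_ge0 ?ler0n.
have nE x y : n%:R `^ x * n%:R `^ y = n%:R `^ (x + y) :> R.
  by rewrite powRD //; apply/implyP => _; rewrite gt_eqF.
have hu3 : u.+1%:R ^+ 3 <= 512 * n%:R `^ e :> R.
  have h1 : u.+1%:R <= 8 * n%:R `^ (r%:R^-1) :> R.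
    have : u.+1%:R <= u%:R * 2 :> R by rewrite -natrM ler_nat; lia.
    by have := root_bound r0 hu; lra.
  have h2 : u.+1%:R ^+ 3 <= (8 * n%:R `^ (r%:R^-1)) ^+ 3 :> R.
    by rewrite lerXn2r ?nnegrE ?mulr_ge0 ?powR_ge0 ?ler0n.
  apply: le_trans h2 _; rewrite exprMn; apply: ler_pM; rewrite ?exprn_ge0 ?powR_ge0 ?ler0n //.
    by rewrite -natrX ler_nat.
  rewrite -powR_mulrn ?powR_ge0 // -powRrM; apply: ler_powR => //.
  by rewrite mulrC ler_pdivrMr.
have hl3 : l%:R ^+ 3 + l%:R * n%:R <= 2 * n%:R `^ (2 - 3 * e) :> R.
  have a1 : l%:R ^+ 3 <= n%:R `^ (2 - 3 * e) :> R.
    apply: (le_trans (y := (n%:R `^ (2%:R / 3%:R - e)) ^+ 3)).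
      by rewrite lerXn2r ?nnegrE ?powR_ge0 ?ler0n // ltW.
    by rewrite -powR_mulrn ?powR_ge0 // -powRrM; apply: ler_powR => //; lra.
  have a2 : l%:R * n%:R <= n%:R `^ (2 - 3 * e) :> R.
    apply: (le_trans (y := n%:R `^ (2%:R / 3%:R - e) * n%:R `^ 1)).
      by rewrite powRr1 ?ler0n // ler_wpM2r // ltW.
    by rewrite nE; apply: ler_powR => //; lra.
  lra.
have hn2 : n%:R `^ 2 <= K * n%:R `^ (2 - 2 * e) :> R.
  have : n%:R `^ 2 <= 10 ^+ 4 * r%:R ^+ 6 * u.+1%:R ^+ 3 * (l%:R ^+ 3 + l%:R * n%:R) :> R.
    by rewrite powR_mulrn ?ler0n // -!natrX -!natrM -natrD -natrM ler_nat.
  move/le_trans; apply.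
  have -> : 2 - 2 * e = e + (2 - 3 * e) by lra.
  rewrite -nE.
  apply: (le_trans (y := 10 ^+ 4 * r%:R ^+ 6 * (512 * n%:R `^ e) * (2 * n%:R `^ (2 - 3 * e)))).
    apply: ler_pM => //.
    - by rewrite !mulr_ge0 ?exprn_ge0 ?ler0n.
    - by rewrite addr_ge0 ?mulr_ge0 ?exprn_ge0 ?ler0n.
    - by rewrite ler_wpM2l ?mulr_ge0 ?exprn_ge0 ?ler0n.
  by rewrite /K; rewrite le_eqVlt; apply/orP; left; apply/eqP; ring.
have hK : n%:R `^ (2 * e) <= K.
  rewrite -(ler_pM2r (powR_gt0 (2 - 2 * e) N0)) nE.
  by have -> : 2 * e + (2 - 2 * e) = 2 by lra.
have hn' : n%:R <= K `^ (2 * e)^-1.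
  have -> : n%:R = (n%:R `^ (2 * e)) `^ (2 * e)^-1 :> R.
    by rewrite -powRrM mulfV ?powRr1 ?ler0n // gt_eqF ?mulr_gt0.
  by apply: ge0_ler_powR; rewrite ?invr_ge0 ?nnegrE ?powR_ge0 // mulr_ge0 ?ltW.
by move: hn; rewrite truncn_lt_nat ?powR_ge0 // ltNge hn'.
Qed.
End Asymptotics.

Theorem theorem1p1 (R : realType) (eps : R) (heps : 0 < eps) :
  exists n0 : nat, forall n : nat, (n0 <= n)%N ->
    forall G : sgraph, graph_order G = n -> graph_connected G -> vertex_transitive G ->
      exists c : seq G,
        is_cycle c /\ n%:R `^ (2%:R / 3%:R - eps) <= (size c)%:R.
Proof.
(* below 1/6, the term [l ^ 3] dominates [l * n] at [l = n ^ (2/3 - e)] *)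
pose e := Num.min eps 6^-1.
have e0 : 0 < e by rewrite lt_min heps /=; lra.
have e6 : e <= 6^-1 by rewrite ge_min lexx orbT.
have ee : e <= eps by rewrite ge_min lexx.
pose r := (Num.trunc (3 / e)).+1.
have er : 3 <= e * r%:R.
  rewrite mulrC -ler_pdivrMr // ltW // -truncn_lt_nat //.
  by rewrite divr_ge0 // ltW.
have [n0 n0P] := eventual_lower_bound e0 e6 (ltn0Sn _ : (0 < r)%N) er.
exists (maxn n0 3) => n; rewrite geq_max => /andP[n0n n3] G Gn conn vt.
have n1 : (0 < n)%N by apply: leq_trans n3.
have G3 : (3 <= #|G|)%N by rewrite -/(graph_order G) Gn.
have [C lC] := longest_exists (cycle_exists vt conn G3).
have [ucC sC _] := lC.
have x0 : G by case: (C) sC => [//|x] *; exact: x.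
have [u [h1 [h2 h3]]] := near_root (ltn0Sn _ : (0 < r)%N) n1.
exists C; split; first by [].
apply: le_trans (n0P n u (size C) n0n n1 h3 h2 _).
  by apply: ler_powR; rewrite ?ler1n // lerD2l lerN2.
rewrite -{1 2}Gn; apply: (circumference_bound x0 vt conn lC) => //.
by rewrite -/(graph_order G) Gn.
Qed.
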